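(* Let $1\le k\le d$ be integers and $\varepsilon>0$. The algorithm Joint, specified step by step in the context, samples a sequence from the exponential mechanism with utility $u^*$, i.e. on input the item counts of a dataset $D$ its output satisfies $$\mathbb{P}[\text{Joint outputs } S]=\frac{\exp\left(\varepsilon u^*(D,S)/2\right)}{\sum_{S'\in[d]^k}\exp\left(\varepsilon u^*(D,S')/2\right)}\qquad\text{for every } S\in[d]^k,$$ and Joint runs in time $O(dk\log(k)+d\log(d))$ and space $O(dk)$.
   Context: $[m]=\{1,\dots,m\}$. A dataset $D=\{x_1,\dots,x_n\}$ is a finite multiset of user vectors $x_i\in\{0,1\}^d$, one coordinate per item; the count of item $j$ is $\sum_{i=1}^n x_{i,j}$. Items are relabeled by $[d]$ so that their counts satisfy $c_1\ge c_2\ge\dots\ge c_d$, where $c_j$ is the count of the item with new label $j$; all sequences below use the new labels. For $S=(s_1,\dots,s_k)\in[d]^k$ define $$u^*(D,S)=\begin{cases}-\max_{i\in[k]}\left(c_i-c_{s_i}\right)&\text{if } s_1,\dots,s_k \text{ are distinct},\\ -\infty&\text{otherwise,}\end{cases}$$ with $\exp(-\infty)=0$. (The sensitivity of $u^*$ is taken to be $1$, so the exponential mechanism with privacy parameter $\varepsilon$ outputs $S$ with probability proportional to $\exp(\varepsilon u^*(D,S)/2)$.) Algorithm Joint. Input: vector of item counts, number $k$, privacy parameter $\varepsilon$. (1) Sort and relabel items so that $c_1\ge\dots\ge c_d$. (2) Construct the $k\times d$ matrix $\tilde U$ with $\tilde U_{ij}=-(c_i-c_j)-\frac{d(k-i)+j}{2dk}$.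 Its entries are distinct and each of its rows is decreasing. (3) Sort the entries of $\tilde U$ in decreasing order as $\tilde U_{(1)},\dots,\tilde U_{(dk)}$, storing the row $r(a)$ and column $c(a)$ of each $\tilde U_{(a)}$; since the rows are already decreasing, this is done by $k$-way merging. (4) Initialize $n_1,\dots,n_k\gets 0$, $N\gets\emptyset$, $b\gets 0$. (5) For $a=1,\dots,dk$: set $n_{r(a)}\gets c(a)-(r(a)-1)$ and $N\gets N\cup\{r(a)\}$; if $|N|=k$, leave this loop (keeping the current value of $a$); otherwise set $\tilde m(\tilde U_{(a)})\gets 0$ and $b\gets a$. (6) Set $p\gets\prod_{r\in[k]}n_r$ and $\tilde m(\tilde U_{(b+1)})\gets p/n_{r(a)}$, where $a=b+1$ is the index at which the loop in (5) was left. (7) For $a=b+2,\dots,dk$: set $p\gets p/n_{r(a)}$; set $\tilde m(\tilde U_{(a)})\gets p$; set $n_{r(a)}\gets n_{r(a)}+1$; set $p\gets p\cdot n_{r(a)}$. (8) Sample an entry $\tilde U_{ij}$ of $\tilde U$ with probability proportional to $\tilde m(\tilde U_{ij})\exp\left(\varepsilon\lceil\tilde U_{ij}\rceil/2\right)$. (9) Initialize a length-$k$ output vector $s$ with $s_i\gets j$. For $i'=1,2,\dots,i-1,i+1,\dots,k$ in this order: compute $t_{i'}=\max\{j'\in[d]:\tilde U_{i'j'}\ge\tilde U_{ij}\}$ by iterating through row $i'$ of $\tilde U$, and sample $s_{i'}$ uniformly from $[t_{i'}]\setminus\{j,s_1,s_2,\dots,s_{i'-1}\}$. Output: the vector of item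 indices $s=(s_1,\dots,s_k)$. Time and space are measured in the usual unit-cost model: arithmetic operations, comparisons and exponentials on numbers, storing a number, and drawing a uniform random number in $[0,1]$ or a uniform random element of $[m]$ each cost $O(1)$. *)

(* Defs.v *)
From HB Require Import structures.
From mathcomp Require Import all_boot all_order all_algebra perm.
From mathcomp Require Import all_classical all_reals all_analysis.

Set Implicit Arguments.
Unset Strict Implicit.
Unset Printing Implicit Defensive.

Import Order.TTheory GRing.Theory Num.Theory.
Import numFieldNormedType.Exports.

Local Open Scope nat_scope.

(* A unit-cost random access machine over naturals and reals.  The memory is a
   finite family of arrays; a scalar variable is an array of which only cell 0
   is used.  Values are naturals (counts, labels, indices) or exact reals.
   Programs are syntax: every operation on values, every memory access and every
   test goes through the constructors below and is charged by [exec]. *)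

Inductive ty := TNat | TReal.

Record name (s : ty) := Name { id : nat }.

Inductive binop := Add | Sub | Mul | Div.
Inductive cmpop := LE | LT | EQ.

Inductive expr : ty -> Type :=
| Lit (n : nat) : expr TNat
| Get (s : ty) (x : name s) (i : expr TNat) : expr s
| Cast (e : expr TNat) : expr TReal
| Bin (o : binop) (s : ty) (e1 e2 : expr s) : expr s
| Cmp (o : cmpop) (s : ty) (e1 e2 : expr s) : expr TNat  (* 0 or 1 *)
| Ceil (e : expr TReal) : expr TReal
| Exp (e : expr TReal) : expr TReal.

Definition Var (s : ty) (x : name s) : expr s := Get x (Lit 0).

Coercion Lit : nat >-> expr.
Coercion Var : name >-> expr.

(* Conditions are expressions, 0 meaning false. *)
Inductive cmd :=
| Skip
| Store (s : ty) (x : name s) (i : expr TNat) (e : expr s)   (* x[i] := e *)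
| Seq (c1 c2 : cmd)
| Cond (e : expr TNat) (c1 c2 : cmd)
(* for x = lo, ..., hi, leaving the loop as soon as g is false; g is tested
   before x is updated, so that x keeps the value it had in the last pass *)
| For (x : name TNat) (lo hi g : expr TNat) (c : cmd)
| DrawReal (x : name TReal)                (* x := uniform element of [0, 1] *)
| DrawNat (x : name TNat) (m : expr TNat)  (* x := uniform element of {1..m} *).

Declare Scope prog_scope.
Delimit Scope prog_scope with prog.
Bind Scope prog_scope with expr cmd.

Notation "x $[ i ]" := (Get x i%prog) (at level 9, i at level 90) : prog_scope.
Notation "e1 + e2" := (Bin Add e1 e2) : prog_scope.
Notation "e1 - e2" := (Bin Sub e1 e2) : prog_scope.
Notation "e1 * e2" := (Bin Mul e1 e2) : prog_scope.
Notation "e1 / e2" := (Bin Div e1 e2) : prog_scope.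
Notation "e1 <= e2" := (Cmp LE e1 e2) : prog_scope.
Notation "e1 < e2" := (Cmp LT e1 e2) : prog_scope.
Notation "e1 == e2" := (Cmp EQ e1 e2) : prog_scope.
Notation "e1 && e2" := (Bin Mul (s := TNat) e1 e2) : prog_scope.
Notation "e1 || e2" := (Bin Add (s := TNat) e1 e2) : prog_scope.
Notation "~~ e" := (Cmp EQ (s := TNat) e (Lit 0)) : prog_scope.
Notation "x ::= e" := (Store x (Lit 0) e%prog) (at level 92) : prog_scope.
Notation "x $[ i ] ::= e" := (Store x i%prog e%prog)
  (at level 9, i at level 90, e at level 91) : prog_scope.
Notation "c1 ;; c2" := (Seq c1 c2) (at level 95, right associativity)
  : prog_scope.
Notation "'IF' e 'THEN' c1 'ELSE' c2 'FI'" := (Cond e%prog c1 c2)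
  (at level 0, e at level 91, c1 at level 95, c2 at level 95) : prog_scope.
Notation "'IF' e 'THEN' c1 'FI'" := (Cond e%prog c1 Skip)
  (at level 0, e at level 91, c1 at level 95) : prog_scope.
Notation "'FOR' x 'FROM' lo 'TO' hi 'DO' c 'OD'" :=
  (For x lo%prog hi%prog (Lit 1) c)
  (at level 0, x at level 9, lo at level 91, hi at level 91, c at level 95)
  : prog_scope.
Notation "'FOR' x 'FROM' lo 'TO' hi 'WHILE' g 'DO' c 'OD'" :=
  (For x lo%prog hi%prog g%prog c)
  (at level 0, x at level 9, lo at level 91, hi at level 91, g at level 91,
   c at level 95) : prog_scope.

Section Semantics.
Variable R : realType.

Definition value (s : ty) : Type := match s with TNat => nat | TReal => R end.

(* Cells that were never written contain 0. *)
Definition zero (s : ty) : value s :=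
  match s with TNat => 0%N | TReal => 0%R end.

Record state := State {
  nats : seq (seq nat);   (* the array named x is the (id x)-th element *)
  reals : seq (seq R);
  clock : nat             (* number of elementary operations so far *)
}.

Definition bank (s : ty) (st : state) : seq (seq (value s)) :=
  match s with TNat => nats st | TReal => reals st end.

Definition lookup (s : ty) (st : state) (x : name s) (i : nat) : value s :=
  nth (zero s) (nth [::] (bank s st) (id x)) i.

Definition write (T : Type) (z : T) (m : seq (seq T)) (a i : nat) (v : T) :=
  set_nth [::] m a (set_nth z (nth [::] m a) i v).

(* An array extends up to the largest index ever written. *)
Definition store (s : ty) (x : name s) (i : nat) : value s -> state -> state :=
  match s return value s -> state -> state with
  | TNat => fun v st => State (write 0 (nats st) (id x) i v) (reals st) (clock st)
  | TReal => fun v st =>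
      State (nats st) (write 0%R (reals st) (id x) i v) (clock st)
  end.

Definition tick (n : nat) (st : state) : state :=
  State (nats st) (reals st) (clock st + n).

(* Number of cells in use.  Arrays never shrink, so the value in a final state
   bounds the value at every earlier moment of the execution. *)
Definition footprint (st : state) : nat :=
  sumn (map size (nats st)) + sumn (map size (reals st)).

Definition bin_val (o : binop) (s : ty) : value s -> value s -> value s :=
  match s return value s -> value s -> value s with
  | TNat => match o with
            | Add => addn | Sub => subn | Mul => muln | Div => divn
            end
  | TReal => fun x y => match o with
                        | Add => x + y | Sub => x - y
                        | Mul => x * y | Div => x / y
                        end%R
  end.

Definition cmp_val (o : cmpop) (s : ty) : value s -> value s -> bool :=
  match s return value s -> value s -> bool with
  | TNat => fun x y => match o with
                       | LE => x <= y | LT => x < y | EQ => x == y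
                       end
  | TReal => fun x y => match o with
                        | LE => x <= y | LT => x < y | EQ => x == y
                        end%R
  end.

Fixpoint eval (st : state) (s : ty) (e : expr s) : value s :=
  match e in expr s return value s with
  | Lit n => n
  | Get _ x i => lookup st x (eval st i)
  | Cast e => ((eval st e : nat)%:R)%R
  | Bin o _ e1 e2 => bin_val o (eval st e1) (eval st e2)
  | Cmp o _ e1 e2 => nat_of_bool (cmp_val o (eval st e1) (eval st e2))
  | Ceil e => ((Num.ceil (eval st e : R))%:~R)%R
  | Exp e => expR (eval st e)
  end.

Fixpoint cost (s : ty) (e : expr s) : nat :=
  match e with
  | Lit _ => 1
  | Get _ _ i => (cost i).+1
  | Cast e | Ceil e | Exp e => (cost e).+1
  | Bin _ _ e1 e2 | Cmp _ _ e1 e2 => (cost e1 + cost e2).+1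
  end.

(* Executions form a tree branching at the random draws. *)
Inductive tree (A : Type) :=
| Ret of A
| UReal of (R -> tree A)            (* uniform on [0, 1] *)
| UNat (m : nat) of (nat -> tree A) (* uniform on {1..m} *).

Fixpoint bind (A B : Type) (t : tree A) (f : A -> tree B) : tree B :=
  match t with
  | Ret a => f a
  | UReal g => UReal (fun u => bind (g u) f)
  | UNat m g => UNat m (fun i => bind (g i) f)
  end.

(* at most [n] passes, the first one with x = i *)
Fixpoint loop (x : name TNat) (g : expr TNat) (body : state -> tree state)
    (n i : nat) (st : state) : tree state :=
  match n with
  | 0 => Ret (tick 1 st)
  | n'.+1 =>
      let st1 := tick (cost g).+1 st in
      if (eval st g : nat) == 0 then Ret st1
      else bind (body (tick 1 (store x 0 (i : value TNat) st1)))
                (loop x g body n' i.+1)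
  end.

Fixpoint exec (c : cmd) (st : state) : tree state :=
  match c with
  | Skip => Ret (tick 1 st)
  | Store _ x i e =>
      Ret (tick (cost i + cost e).+1 (store x (eval st i) (eval st e) st))
  | Seq c1 c2 => bind (exec c1 st) (exec c2)
  | Cond e c1 c2 =>
      let st1 := tick (cost e).+1 st in
      if (eval st e : nat) != 0 then exec c1 st1 else exec c2 st1
  | For x lo hi g c =>
      loop x g (exec c) ((eval st hi : nat).+1 - (eval st lo : nat)) (eval st lo)
           (tick (cost lo + cost hi).+1 st)
  | DrawReal x => UReal (fun u => Ret (tick 1 (store x 0 (u : value TReal) st)))
  | DrawNat x m =>
      UNat (eval st m)
        (fun i => Ret (tick (cost m).+1 (store x 0 (i : value TNat) st)))
  end.

(* Probability that the result of the execution satisfies [P]. *)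
Fixpoint Pr (A : Type) (P : A -> bool) (t : tree A) : \bar R :=
  match t with
  | Ret a => ((P a)%:R%R)%:E
  | UReal f => (\int[lebesgue_measure]_(u in `[0%R, 1%R]) Pr P (f u))%E
  | UNat m f => ((m%:R^-1)%R%:E * \sum_(1 <= i < m.+1) Pr P (f i))%E
  end.

(* [Q] holds of the result whatever the outcomes of the random draws are. *)
Fixpoint always (A : Type) (Q : A -> Prop) (t : tree A) : Prop :=
  match t with
  | Ret a => Q a
  | UReal f => forall u : R, (0 <= u <= 1)%R -> always Q (f u)
  | UNat m f => forall i : nat, 1 <= i <= m -> always Q (f i)
  end.

End Semantics.

(* Labels, rows, columns and array indices start from 1, cell 0 of the arrays
   being unused.  The k x d matrix is stored row by row, its (i, j) entry in
   cell (i - 1) d + j.  The input consists of d_, k_, cnt_ (the counts of the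
   original items) and eps_; the output is s_. *)

Definition d_ : name TNat := Name _ 0.
Definition k_ : name TNat := Name _ 1.
Definition cnt_ : name TNat := Name _ 2.
Definition eps_ : name TReal := Name _ 0.

Definition s_ : name TNat := Name _ 3.

Definition total_ : name TNat := Name _ 4.
Definition width_ : name TNat := Name _ 5.
Definition x_ : name TNat := Name _ 6.
Definition xend_ : name TNat := Name _ 7.
Definition y_ : name TNat := Name _ 8.
Definition yend_ : name TNat := Name _ 9.
Definition pass_ : name TNat := Name _ 10.
Definition q_ : name TNat := Name _ 11.
Definition tmp_ : name TNat := Name _ 12.

(* relabeled items: the item with new label j is lab_[j], its count is c_[j] *)
Definition lab_ : name TNat := Name _ 13.
Definition c_ : name TNat := Name _ 14.
Definition key_ : name TReal := Name _ 1.

(* V_[a] is the a-th largest entry of the matrix U_; r_[a] and col_[a] are its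
   row and column *)
Definition U_ : name TReal := Name _ 2.
Definition Urow_ : name TNat := Name _ 15.
Definition Ucol_ : name TNat := Name _ 16.
Definition ord_ : name TNat := Name _ 17.
Definition V_ : name TReal := Name _ 3.
Definition r_ : name TNat := Name _ 18.
Definition col_ : name TNat := Name _ 19.

(* inN_ is the indicator of the set N of rows met so far and cardN_ its size;
   m_[a] is the multiplicity attached to V_[a] *)
Definition n_ : name TReal := Name _ 4.
Definition inN_ : name TNat := Name _ 20.
Definition cardN_ : name TNat := Name _ 21.
Definition b_ : name TNat := Name _ 22.
Definition a_ : name TNat := Name _ 23.
Definition p_ : name TReal := Name _ 5.
Definition m_ : name TReal := Name _ 6.

Definition w_ : name TReal := Name _ 7.
Definition sumw_ : name TReal := Name _ 8.
Definition acc_ : name TReal := Name _ 9.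
Definition u_ : name TReal := Name _ 10.
Definition sel_ : name TNat := Name _ 24.
Definition i0_ : name TNat := Name _ 25.
Definition j0_ : name TNat := Name _ 26.
Definition used_ : name TNat := Name _ 27.
Definition t_ : name TNat := Name _ 28.
Definition pool_ : name TNat := Name _ 29.
Definition npool_ : name TNat := Name _ 30.
Definition z_ : name TNat := Name _ 31.

Definition i_ : name TNat := Name _ 32.
Definition j_ : name TNat := Name _ 33.

Local Open Scope prog_scope.

Definition minimum (x : name TNat) (e1 e2 : expr TNat) : cmd :=
  IF e1 <= e2 THEN x ::= e1 ELSE x ::= e2 FI.

(* [idx] consists of [num] consecutive runs of length [len], along each of which
   [key] is nonincreasing; sort [idx] by nonincreasing [key] by repeatedly
   merging adjacent runs in pairs.  In the inner loop the two runs being merged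
   are what remains of them: cells x_ .. xend_ - 1 and y_ .. yend_ - 1. *)
Definition merge_runs (key : name TReal) (idx : name TNat) (len num : expr TNat)
    : cmd :=
  total_ ::= len * num ;;
  width_ ::= len ;;
  FOR pass_ FROM 1 TO num WHILE width_ < total_ DO
    x_ ::= 1 ;; xend_ ::= 1 ;; y_ ::= 1 ;; yend_ ::= 1 ;;
    FOR q_ FROM 1 TO total_ DO
      IF (xend_ <= x_) && (yend_ <= y_) THEN
        x_ ::= q_ ;;
        minimum xend_ (q_ + width_) (total_ + 1) ;;
        y_ ::= xend_ ;;
        minimum yend_ (q_ + 2 * width_) (total_ + 1)
      FI ;;
      IF (x_ < xend_) && ((yend_ <= y_) || (key$[idx$[y_]] <= key$[idx$[x_]]))
      THEN
        tmp_$[q_] ::= idx$[x_] ;; x_ ::= x_ + 1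
      ELSE
        tmp_$[q_] ::= idx$[y_] ;; y_ ::= y_ + 1
      FI
    OD ;;
    FOR q_ FROM 1 TO total_ DO idx$[q_] ::= tmp_$[q_] OD ;;
    width_ ::= 2 * width_
  OD.

Definition relabel : cmd :=
  FOR j_ FROM 1 TO d_ DO
    key_$[j_] ::= Cast cnt_$[j_] ;; lab_$[j_] ::= j_
  OD ;;
  merge_runs key_ lab_ 1 d_ ;;
  FOR j_ FROM 1 TO d_ DO c_$[j_] ::= cnt_$[lab_$[j_]] OD.

Definition Uidx : expr TNat := (i_ - 1) * d_ + j_.

Definition build_matrix : cmd :=
  FOR i_ FROM 1 TO k_ DO
    FOR j_ FROM 1 TO d_ DO
      U_$[Uidx] ::= Cast 0 - (Cast c_$[i_] - Cast c_$[j_])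
                    - Cast (d_ * (k_ - i_) + j_) / Cast (2 * d_ * k_) ;;
      Urow_$[Uidx] ::= i_ ;;
      Ucol_$[Uidx] ::= j_ ;;
      ord_$[Uidx] ::= Uidx
    OD
  OD.

Definition sort_entries : cmd :=
  merge_runs U_ ord_ d_ k_ ;;
  FOR a_ FROM 1 TO d_ * k_ DO
    V_$[a_] ::= U_$[ord_$[a_]] ;;
    r_$[a_] ::= Urow_$[ord_$[a_]] ;;
    col_$[a_] ::= Ucol_$[ord_$[a_]]
  OD.

Definition reset_counts : cmd :=
  FOR i_ FROM 1 TO k_ DO n_$[i_] ::= Cast 0 ;; inN_$[i_] ::= 0 OD ;;
  cardN_ ::= 0 ;;
  b_ ::= 0.

Definition scan_until_all_rows : cmd :=
  FOR a_ FROM 1 TO d_ * k_ WHILE ~~ (cardN_ == k_) DO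
    n_$[r_$[a_]] ::= Cast col_$[a_] - (Cast r_$[a_] - Cast 1) ;;
    IF ~~ inN_$[r_$[a_]] THEN
      inN_$[r_$[a_]] ::= 1 ;; cardN_ ::= cardN_ + 1
    FI ;;
    IF ~~ (cardN_ == k_) THEN m_$[a_] ::= Cast 0 ;; b_ ::= a_ FI
  OD.

Definition first_multiplicity : cmd :=
  p_ ::= Cast 1 ;;
  FOR i_ FROM 1 TO k_ DO p_ ::= p_ * n_$[i_] OD ;;
  m_$[b_ + 1] ::= p_ / n_$[r_$[a_]].

Definition other_multiplicities : cmd :=
  FOR a_ FROM b_ + 2 TO d_ * k_ DO
    p_ ::= p_ / n_$[r_$[a_]] ;;
    m_$[a_] ::= p_ ;;
    n_$[r_$[a_]] ::= n_$[r_$[a_]] + Cast 1 ;;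
    p_ ::= p_ * n_$[r_$[a_]]
  OD.

(* Inversion of the distribution function: sel_ is the first index at which the
   partial sum of the weights is positive and reaches the fraction u_ of the
   total.  Positivity only matters for u_ = 0, where it prevents the selection of
   an entry of weight 0. *)
Definition sample_entry : cmd :=
  sumw_ ::= Cast 0 ;;
  FOR a_ FROM 1 TO d_ * k_ DO
    w_$[a_] ::= m_$[a_] * Exp (eps_ * Ceil V_$[a_] / Cast 2) ;;
    sumw_ ::= sumw_ + w_$[a_]
  OD ;;
  DrawReal u_ ;;
  acc_ ::= Cast 0 ;;
  sel_ ::= 0 ;;
  FOR a_ FROM 1 TO d_ * k_ WHILE ~~ sel_ DO
    acc_ ::= acc_ + w_$[a_] ;;
    IF (Cast 0 < acc_) && (u_ * sumw_ <= acc_) THEN sel_ ::= a_ FI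
  OD.

(* used_ marks the labels already present in the output; the cells 1 .. npool_
   of pool_ list the candidates for s_[i_] *)
Definition complete_sequence : cmd :=
  i0_ ::= r_$[sel_] ;;
  j0_ ::= col_$[sel_] ;;
  FOR j_ FROM 1 TO d_ DO used_$[j_] ::= 0 OD ;;
  s_$[i0_] ::= j0_ ;;
  used_$[j0_] ::= 1 ;;
  FOR i_ FROM 1 TO k_ DO
    IF ~~ (i_ == i0_) THEN
      t_ ::= 0 ;;
      FOR j_ FROM 1 TO d_ DO
        IF V_$[sel_] <= U_$[Uidx] THEN t_ ::= j_ FI
      OD ;;
      npool_ ::= 0 ;;
      FOR j_ FROM 1 TO t_ DO
        IF ~~ used_$[j_] THEN
          npool_ ::= npool_ + 1 ;; pool_$[npool_] ::= j_
        FI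
      OD ;;
      DrawNat z_ npool_ ;;
      s_$[i_] ::= pool_$[z_] ;;
      used_$[pool_$[z_]] ::= 1
    FI
  OD.

Definition Joint : cmd :=
  relabel ;;
  build_matrix ;;
  sort_entries ;;
  reset_counts ;;
  scan_until_all_rows ;;
  first_multiplicity ;;
  other_multiplicities ;;
  sample_entry ;;
  complete_sequence.

Local Close Scope prog_scope.

Section Mechanism.
Variables (R : realType) (d : nat).

(* A dataset lists the vectors of its users, one bit per item. *)
Definition dataset := seq {ffun 'I_d -> bool}.

Definition item_count (D : dataset) (j : 'I_d) : nat := \sum_(x <- D) x j.

(* [item_of j] is the item with new label [j]. *)
Definition is_relabeling (D : dataset) (item_of : {perm 'I_d}) : Prop :=
  forall i j : 'I_d, i <= j ->
    item_count D (item_of j) <= item_count D (item_of i).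

Definition ustar (D : dataset) (item_of : {perm 'I_d}) (k : nat) (hkd : k <= d)
    (S : k.-tuple 'I_d) : \bar R :=
  let c j : R := ((item_count D (item_of j))%:R)%R in
  if uniq S then
    (- \big[maxe/-oo]_(i < k) (c (widen_ord hkd i) - c (tnth S i))%R%:E)%E
  else (-oo)%E.

(* exp(eps u*(D, S) / 2), where [expeR -oo = 0] *)
Definition em_weight (eps : R) (D : dataset) (item_of : {perm 'I_d}) (k : nat)
    (hkd : k <= d) (S : k.-tuple 'I_d) : R :=
  fine (expeR ((eps / 2)%R%:E * ustar D item_of hkd S)%E).

(* The memory is empty except for the input; the vector of counts is indexed by
   the original items. *)
Definition joint_input (D : dataset) (k : nat) (eps : R) : state R :=
  State [:: [:: d]; [:: k]; 0 :: [seq item_count D j | j <- enum 'I_d]]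
        [:: [:: eps]] 0.

Definition run_Joint (D : dataset) (k : nat) (eps : R) : tree R (state R) :=
  exec Joint (joint_input D k eps).

(* The labels stored by the machine start from 1. *)
Definition outputs (k : nat) (S : k.-tuple 'I_d) (st : state R) : bool :=
  [forall i : 'I_k, lookup st s_ i.+1 == (tnth S i).+1 :> nat].

End Mechanism.

(* Main.v *)
(* Fix an entry (i, j) of the matrix and let t_x be the number of entries of row x
   that are at least as large.  The sequences of distinct items with smallest entry
   (i, j) are those with s_i = j and s_x <= t_x for all x.  Since t_x increases
   with x, the items chosen for the rows before x all lie in [t_x], so the number of
   candidates in step (9) is t_x - (x - 1) whatever was chosen before.  Hence all
   these sequences are equally likely once (i, j) has been drawn, and there are
   as many of them as the multiplicity of (i, j) indicates.  The fraction
   subtracted in the matrix makes all entries distinct without changing their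
   ceilings, so every sequence has a single smallest entry, whose ceiling is its
   utility.  The normalising constant is found by summing the output probabilities,
   whose total is 1. *)
From Pilot Require Import Defs.
From HB Require Import structures.
From mathcomp Require Import all_boot all_order all_algebra perm.
From mathcomp Require Import all_classical all_reals all_analysis.
From mathcomp Require Import measurable_realfun zify ring lra.
Import Pilot.Defs.

Set Implicit Arguments.
Unset Strict Implicit.
Unset Printing Implicit Defensive.

Import Order.TTheory GRing.Theory Num.Theory.
Local Open Scope ring_scope.
Local Open Scope nat_scope.

(** * Programs as transformers of environments *)

(** Values never depend on the clock, so correctness and cost are proved separately. For
    correctness, draw-free stretches are treated by weakest preconditions and collapsed to one state
    by [seq_det]; the execution trees are unfolded only at the draws of [u_] and [z_]. The sorted
    order enters only through [reach i a], the number of entries of row i among the first a. It is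
    at once the threshold t_i of step (9) and, shifted by i - 1, the counter n_i of steps (5)-(7),
    and it changes in a single row when a grows by one; hence one division and one multiplication
    update the product. The divisions are safe because the entry (1, 1) lies below all other
    diagonal entries: once it is met, each row i has at least i entries above the threshold. Ties
    between counts leave the relabeling ambiguous, but the sorted list of counts is unique. For
    cost, a bound read off the syntax suffices except at two places: the number of merge passes,
    which the doubling of the width makes logarithmic, and the length of the pool, which needs a
    loop invariant. *)

Section Logic.
Variable R : realType.

(* The arrays are addressed by the identifiers of their names in Defs: for
   instance [natv e 14] is [c_] and [realv e 3] is [V_]. *)
Record env := Env { natv : nat -> nat -> nat; realv : nat -> nat -> R }.

Definition upd (T : Type) (f : nat -> nat -> T) (a i : nat) (v : T) :=
  fun b => if b == a then fun j => if j == i then v else f b j else f b.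

Definition get (s : ty) (e : env) : name s -> nat -> value R s :=
  match s return name s -> nat -> value R s with
  | TNat => fun x => natv e (id x)
  | TReal => fun x => realv e (id x)
  end.

Definition put (s : ty) : name s -> nat -> value R s -> env -> env :=
  match s return name s -> nat -> value R s -> env -> env with
  | TNat => fun x i v e => Env (upd (natv e) (id x) i v) (realv e)
  | TReal => fun x i v e => Env (natv e) (upd (realv e) (id x) i v)
  end.

Fixpoint veval (e : env) (s : ty) (x : expr s) : value R s :=
  match x in expr s return value R s with
  | Lit n => n
  | Get _ x i => get e x (veval e i)
  | Cast x => ((veval e x : nat)%:R)%R
  | Bin o _ x1 x2 => bin_val o (veval e x1) (veval e x2)
  | Cmp o _ x1 x2 => nat_of_bool (cmp_val o (veval e x1) (veval e x2))
  | Ceil x => ((Num.ceil (veval e x : R))%:~R)%R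
  | Exp x => expR (veval e x)
  end.

(** Forgets the clock and the lengths of the arrays. Cells past the end read as 0, as in [lookup],
    so values and control flow depend on the view alone. *)
Definition view (st : state R) : env :=
  Env (fun a i => nth 0 (nth [::] (nats st) a) i)
      (fun a i => nth 0%R (nth [::] (reals st) a) i).

Lemma lookup_view (st : state R) (s : ty) (x : name s) i :
  lookup st x i = get (view st) x i.
Proof. by case: s x. Qed.

Lemma eval_view (st : state R) (s : ty) (x : expr s) :
  eval st x = veval (view st) x.
Proof.
elim: x => //=.
- by move=> s' x i IH; rewrite IH lookup_view.
- by move=> x ->.
- by move=> o s' x1 -> x2 ->.
- by move=> o s' x1 -> x2 ->.
- by move=> x ->.
- by move=> x ->.
Qed.

Lemma nth_write (T : Type) (z : T) m a i v b j :
  nth z (nth [::] (write z m a i v) b) j =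
  upd (fun b j => nth z (nth [::] m b) j) a i v b j.
Proof.
rewrite /write /upd nth_set_nth /=; case: eqP => [->|] //=.
by rewrite nth_set_nth /=; case: eqP.
Qed.

Lemma view_store (st : state R) (s : ty) (x : name s) i v :
  view (store x i v st) = put x i v (view st).
Proof.
by case: s x v => x v; rewrite /view /=; congr Env;
  apply/funext => b; apply/funext => j; rewrite nth_write.
Qed.

Lemma always_bind (A B : Type) (Q : B -> Prop) (t : tree R A) f :
  always Q (bind t f) <-> always (fun a => always Q (f a)) t.
Proof.
elim: t => //= [g IH|m g IH]; split=> h u hu; apply/IH; exact: h.
Qed.

Lemma always_impl (A : Type) (P Q : A -> Prop) (t : tree R A) :
  (forall a, P a -> Q a) -> always P t -> always Q t.
Proof.
move=> PQ; elim: t => /= [a|g IH|m g IH]; first exact: PQ.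
- by move=> h u hu; apply/IH/h.
- by move=> h u hu; apply/IH/h.
Qed.

Lemma always_and (A : Type) (P Q : A -> Prop) (t : tree R A) :
  always P t -> always Q t -> always (fun a => P a /\ Q a) t.
Proof.
elim: t => /= [a|g IH|m g IH] //.
- by move=> h h' u hu; apply/IH; [exact: h|exact: h'].
- by move=> h h' u hu; apply/IH; [exact: h|exact: h'].
Qed.

Lemma exec_cond (b : expr TNat) c1 c2 (st : state R) :
  exec (Cond b c1 c2) st =
  if (veval (view st) b : nat) != 0 then exec c1 (tick (cost b).+1 st)
  else exec c2 (tick (cost b).+1 st).
Proof. by rewrite /= eval_view. Qed.

Lemma exec_draw_nat (x : name TNat) (m : expr TNat) c (st : state R) :
  exec (Seq (DrawNat x m) c) st =
  UNat (veval (view st) m : nat)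
    (fun i => exec c (tick (cost m).+1 (store x 0 (i : value R TNat) st))).
Proof. by rewrite /= eval_view. Qed.

Lemma bind_assoc (A B C : Type) (t : tree R A) (f : A -> tree R B)
    (g : B -> tree R C) : bind (bind t f) g = bind t (fun a => bind (f a) g).
Proof.
by elim: t => //= [h IH|m h IH]; congr (_ _); apply/funext => u; exact: IH.
Qed.

Lemma exec_seqA c1 c2 c3 (st : state R) :
  exec (Seq (Seq c1 c2) c3) st = exec (Seq c1 (Seq c2 c3)) st.
Proof. exact: bind_assoc. Qed.

Lemma exec_seq_congr c c1 c2 (st : state R) :
  (forall st : state R, exec c1 st = exec c2 st) ->
  exec (Seq c c1) st = exec (Seq c c2) st.
Proof. by move=> h /=; congr bind; apply/funext. Qed.

Lemma exec_draw_real (x : name TReal) c (st : state R) :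
  exec (Seq (DrawReal x) c) st =
  UReal (fun u => exec c (tick 1 (store x 0 (u : value R TReal) st))).
Proof. by []. Qed.

(** All states with view [e] and all outcomes of the draws are covered. The clock is invisible here,
    so the rules below ignore [tick]; probabilities are invisible too and are recovered through
    [seq_det]. *)
Definition wp (c : cmd) (Q : env -> Prop) (e : env) : Prop :=
  forall st, view st = e -> always (fun st' => Q (view st')) (exec c st).

Lemma wp_skip (Q : env -> Prop) e : Q e -> wp Skip Q e.
Proof. by move=> h st ve /=; rewrite -[view _]/(view st) ve. Qed.

Lemma wp_store (s : ty) (x : name s) (i : expr TNat) (v : expr s) (Q : env -> Prop) e :
  Q (put x (veval e i) (veval e v) e) -> wp (Store x i v) Q e.
Proof.
move=> h st ve /=.
by rewrite -[view _]/(view (store _ _ _ _)) view_store !eval_view ve.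
Qed.

Lemma wp_seq c1 c2 (Q : env -> Prop) e :
  wp c1 (wp c2 Q) e -> wp (Seq c1 c2) Q e.
Proof.
move=> h st ve /=; apply/always_bind; apply: always_impl (h _ ve) => st' h2.
exact: h2.
Qed.

Lemma wp_cond (b : expr TNat) c1 c2 (Q : env -> Prop) e :
  (veval e b != 0 -> wp c1 Q e) -> (veval e b = 0 -> wp c2 Q e) ->
  wp (Cond b c1 c2) Q e.
Proof.
move=> h1 h2 st ve /=; rewrite eval_view ve.
by have [/h2|/h1] := eqVneq (veval e b : nat) 0; apply.
Qed.

Lemma wp_impl c (P Q : env -> Prop) e :
  (forall e', P e' -> Q e') -> wp c P e -> wp c Q e.
Proof. by move=> PQ h st ve; apply: always_impl (h st ve) => st'; exact: PQ. Qed.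

Lemma wp_and c (P Q : env -> Prop) e :
  wp c P e -> wp c Q e -> wp c (fun e' => P e' /\ Q e') e.
Proof. by move=> h1 h2 st ve; apply: always_and; [exact: h1|exact: h2]. Qed.

(** * The frame rule: arrays that a program cannot change *)

Definition mods_of (s : ty) : name s -> seq nat * seq nat :=
  match s with
  | TNat => fun x => ([:: id x], [::])
  | TReal => fun x => ([::], [:: id x])
  end.

Fixpoint mods (c : cmd) : seq nat * seq nat :=
  match c with
  | Skip => ([::], [::])
  | Store _ x _ _ => mods_of x
  | Seq c1 c2 | Cond _ c1 c2 =>
      ((mods c1).1 ++ (mods c2).1, (mods c1).2 ++ (mods c2).2)
  | For x _ _ _ c => (id x :: (mods c).1, (mods c).2)
  | DrawReal x => mods_of x
  | DrawNat x _ => mods_of x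
  end.

(** The written arrays are computed from the syntax, so for a concrete program the side condition
    [x \notin m.1] is decided by evaluation. *)
Definition agree (m : seq nat * seq nat) (e e' : env) : Prop :=
  (forall x, x \notin m.1 -> natv e' x = natv e x) /\
  (forall x, x \notin m.2 -> realv e' x = realv e x).

Lemma agree_refl m e : agree m e e. Proof. by []. Qed.

Lemma agree_trans m e1 e2 e3 : agree m e1 e2 -> agree m e2 e3 -> agree m e1 e3.
Proof.
by move=> [h1 h2] [h3 h4]; split=> x xm; rewrite ?h3 ?h4 ?h1 ?h2.
Qed.

Lemma agree_sub m m' e1 e2 : {subset m.1 <= m'.1} -> {subset m.2 <= m'.2} ->
  agree m e1 e2 -> agree m' e1 e2.
Proof.
move=> s1 s2 [h1 h2]; split=> x xm; [apply: h1|apply: h2].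
- by apply: contra xm; exact: s1.
- by apply: contra xm; exact: s2.
Qed.

Lemma agree_put (s : ty) (x : name s) i v e : agree (mods_of x) e (put x i v e).
Proof.
case: s x v => x v /=; split=> y /=; rewrite ?inE => hy //;
  by rewrite /upd (negbTE hy).
Qed.

Lemma frame_loop x g c n i st e :
  (forall st, wp c (agree (mods c) (view st)) (view st)) ->
  agree (id x :: (mods c).1, (mods c).2) e (view st) ->
  always (fun st' => agree (id x :: (mods c).1, (mods c).2) e (view st'))
    (loop x g (exec c) n i st).
Proof.
move=> hc; elim: n i st => //= n IH i st h.
case: eqP => //= _; apply/always_bind.
apply: always_impl; last by apply: hc.
move=> st' h'; apply: IH; apply: agree_trans h _.
apply: (@agree_trans _ _ (view (store x 0 (i : value R TNat) st))).
  rewrite view_store; apply: agree_sub (agree_put _ _ _ _) => //= y.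
  by rewrite !inE => ->.
by apply: agree_sub h' => //= y yc; rewrite inE yc orbT.
Qed.

Lemma frame c e : wp c (agree (mods c) e) e.
Proof.
elim: c e => [|s x i v|c1 IH1 c2 IH2|b c1 IH1 c2 IH2|x lo hi g c IH|x|x m] e.
- exact: wp_skip.
- by apply: wp_store; exact: agree_put.
- apply: wp_seq; apply: wp_impl (IH1 e) => e1 h1.
  apply: wp_impl (IH2 e1) => e2 h2; apply: (@agree_trans _ _ e1).
    by apply: agree_sub h1 => y /= yc; rewrite mem_cat yc.
  by apply: agree_sub h2 => y /= yc; rewrite mem_cat yc orbT.
- apply: wp_cond => _.
    apply: wp_impl (IH1 e) => e1; apply: agree_sub => y /= yc.
      by rewrite mem_cat yc.
    by rewrite mem_cat yc.
  apply: wp_impl (IH2 e) => e1; apply: agree_sub => y /= yc.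
    by rewrite mem_cat yc orbT.
  by rewrite mem_cat yc orbT.
- move=> st <- /=.
  by apply: frame_loop => [st'|]; [exact: IH|exact: agree_refl].
- move=> st <- u hu /=.
  rewrite -[X in agree _ _ X]/(view (store x 0 (u : value R TReal) st)).
  by rewrite view_store; exact: (@agree_put TReal).
- move=> st <- u hu /=.
  rewrite -[X in agree _ _ X]/(view (store x 0 (u : value R TNat) st)).
  by rewrite view_store; exact: (@agree_put TNat).
Qed.

Lemma wp_frame c (Q : env -> Prop) e :
  wp c (fun e' => agree (mods c) e e' -> Q e') e -> wp c Q e.
Proof.
move=> h; apply: wp_impl (wp_and h (@frame c e)) => e' [h1 h2]; exact: h1.
Qed.

(** [Inv i] describes the moment before the pass with counter i; the counter variable is updated
    only after the guard is tested, so the index is kept apart from it. The frame is supplied at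
    every pass and at the exit, so invariants need only mention what the body changes. The bound
    [L <= H.+1] makes an exhausted loop end at exactly [H.+1]. *)
Lemma wp_for (Inv : nat -> env -> Prop) (x : name TNat) (lo hi g : expr TNat) c
    (Q : env -> Prop) e :
  let m := (id x :: (mods c).1, (mods c).2) in
  let L : nat := veval e lo in
  let H : nat := veval e hi in
  L <= H.+1 ->
  Inv L e ->
  (forall i e', L <= i <= H -> agree m e e' -> Inv i e' ->
     veval e' g != 0 -> wp c (Inv i.+1) (put x 0 (i : value R TNat) e')) ->
  (forall i e', L <= i <= H.+1 -> agree m e e' -> Inv i e' ->
     i = H.+1 \/ veval e' g = 0 -> Q e') ->
  wp (For x lo hi g c) Q e.
Proof.
move=> m L H LH I0 Istep Iend st ve /=.
rewrite !eval_view ve -/L -/H.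
set st1 := tick _ st; have ve1 : view st1 = e by [].
have a1 : agree m e (view st1) by rewrite ve1.
have I1 : Inv L (view st1) by rewrite ve1.
have : L <= L <= H.+1 by rewrite leqnn.
move en : (H.+1 - L) => n; move/esym: en.
suff main i st2 : Inv i (view st2) -> agree m e (view st2) ->
    n = H.+1 - i -> L <= i <= H.+1 ->
    always (fun st' => Q (view st')) (loop x g (exec c) n i st2).
  by move=> ? ?; exact: main.
elim: n i st2 {st1 ve1 I1 a1} => [|n IH] i st1 I1 a1 en Li /=.
  by apply: (Iend i) => //; left; lia.
rewrite eval_view; case: eqP => [g0|/eqP g0] /=.
  by apply: (Iend i) => //; right.
apply/always_bind; set st2 := tick 1 _.
have v2 : view st2 = put x 0 (i : value R TNat) (view st1).
  exact: (view_store st1 x 0 (i : value R TNat)).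
have hi' : L <= i <= H by lia.
have h1 := Istep i _ hi' a1 I1 g0 st2 v2.
apply: always_impl (always_and h1 (@frame c _ _ v2)) => st3 [I3 f3].
apply: IH; [by []| |lia|lia].
apply: agree_trans a1 _.
apply: (@agree_trans _ _ (put x 0 (i : value R TNat) (view st1))).
  by apply: agree_sub (agree_put _ _ _ _) => //= y; rewrite !inE => ->.
by apply: agree_sub f3 => //= y yc; rewrite inE yc orbT.
Qed.

Lemma wp_for_all (Inv : nat -> env -> Prop) (x : name TNat) (lo hi : expr TNat) c
    (Q : env -> Prop) e :
  let m := (id x :: (mods c).1, (mods c).2) in
  let L : nat := veval e lo in
  let H : nat := veval e hi in
  L <= H.+1 ->
  Inv L e ->
  (forall i e', L <= i <= H -> agree m e e' -> Inv i e' ->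
     wp c (Inv i.+1) (put x 0 (i : value R TNat) e')) ->
  (forall e', agree m e e' -> Inv H.+1 e' -> Q e') ->
  wp (For x lo hi (Lit 1) c) Q e.
Proof.
move=> m L H LH I0 Is Ie; apply: (wp_for (Inv := Inv)) => //.
- by move=> i e' hi' a Ii _; exact: Is.
- by move=> i e' _ a Ii [ii|//]; apply: Ie => //; rewrite -ii.
Qed.

(** * Draw-free programs *)

Fixpoint nodraw (c : cmd) : bool :=
  match c with
  | Skip | Store _ _ _ _ => true
  | Seq c1 c2 | Cond _ c1 c2 => nodraw c1 && nodraw c2
  | For _ _ _ _ c => nodraw c
  | DrawReal _ | DrawNat _ _ => false
  end.

Lemma nodraw_exec c (st : state R) :
  nodraw c -> exists st', exec c st = Ret R st'.
Proof.
elim: c st => //= [st _|s x i v st _|c1 IH1 c2 IH2 st|b c1 IH1 c2 IH2 st|].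
- by eexists.
- by eexists.
- case/andP=> /(IH1 st)[st1 ->] /(IH2 st1)[st2 e2]; by exists st2.
- case/andP=> h1 h2; case: ifP => _; [exact: IH1|exact: IH2].
- move=> x lo hi g c IH st hc.
  suff main n i st0 : exists st', loop x g (exec c) n i st0 = Ret R st'.
    exact: main.
  elim: n i st0 => [|n IHn] i st0 /=; first by eexists.
  case: ifP => _; first by eexists.
  case: (IH (tick 1 (store x 0 (i : value R TNat) (tick (cost g).+1 st0))) hc).
  by move=> st1 -> /=.
Qed.

Lemma wp_exec c (Q : env -> Prop) (st : state R) :
  nodraw c -> wp c Q (view st) ->
  exists2 st', exec c st = Ret R st' & Q (view st').
Proof.
move=> /(nodraw_exec st)[st' est] h; exists st' => //.
by have := h st erefl; rewrite est.
Qed.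

Lemma loopS (x : name TNat) (g : expr TNat) (body : state R -> tree R (state R)) n i
    (st : state R) :
  loop x g body n.+1 i st =
  if (eval st g : nat) == 0 then Ret R (tick (cost g).+1 st)
  else bind (body (tick 1 (store x 0 (i : value R TNat) (tick (cost g).+1 st))))
            (loop x g body n i.+1).
Proof. by []. Qed.

Lemma exec_for (x : name TNat) (lo hi g : expr TNat) c (st : state R) :
  exec (For x lo hi g c) st =
  loop x g (exec c) ((eval st hi : nat).+1 - (eval st lo : nat)) (eval st lo)
    (tick (cost lo + cost hi).+1 st).
Proof. by []. Qed.

(** The tree of a draw-free program is a single leaf, so a weakest precondition yields an actual
    state from which the rest is executed. This is how facts about environments reach [Pr]. *)
Lemma seq_det c1 (Q : env -> Prop) (st : state R) : nodraw c1 ->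
  wp c1 Q (view st) ->
  exists2 st1, forall c2, exec (Seq c1 c2) st = exec c2 st1 &
    Q (view st1) /\ agree (mods c1) (view st) (view st1).
Proof.
move=> nd h; have [st1 E1 [h1 f1]] := wp_exec nd (wp_and h (@frame c1 _)).
by exists st1 => // c2 /=; rewrite E1.
Qed.

End Logic.

Arguments view : simpl never.
Arguments upd T f a i v b /.
Arguments get {R s} e !x i /.
Arguments put {R s} !x i v e /.
Arguments wp_for {R} Inv {x lo hi g c Q e}.
Arguments wp_for_all {R} Inv {x lo hi c Q e}.

(** * Merging adjacent runs *)

Section Seg.
Variable T : eqType.
Implicit Types (f g : nat -> T) (a b c : nat).

Definition seg f a b := [seq f p | p <- index_iota a b].

Lemma seg_geq f a b : b <= a -> seg f a b = [::].
Proof. by rewrite /seg /index_iota -subn_eq0 => /eqP->. Qed.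

Lemma seg_ltn f a b : a < b -> seg f a b = f a :: seg f a.+1 b.
Proof.
by move=> ab; rewrite /seg /index_iota (_ : b - a = (b - a.+1).+1) //; lia.
Qed.

Lemma seg_cat f a b c : a <= b -> b <= c -> seg f a c = seg f a b ++ seg f b c.
Proof.
move=> ab bc; rewrite /seg /index_iota -map_cat (_ : c - a = (b - a) + (c - b)).
  by rewrite iotaD subnKC.
by lia.
Qed.

Lemma seg_recr f a b : a <= b -> seg f a b.+1 = rcons (seg f a b) (f b).
Proof.
move=> ab; rewrite (@seg_cat _ a b) // (@seg_ltn _ b) // (@seg_geq _ b.+1) //.
by rewrite cats1.
Qed.

Lemma eq_seg f g a b : (forall p, a <= p < b -> f p = g p) -> seg f a b = seg g a b.
Proof. by move=> fg; apply/eq_in_map => p; rewrite mem_index_iota => /fg. Qed.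

Lemma size_seg f a b : size (seg f a b) = b - a.
Proof. by rewrite size_map size_iota. Qed.

Lemma mem_seg f a b p : a <= p < b -> f p \in seg f a b.
Proof. by move=> pab; apply: map_f; rewrite mem_index_iota. Qed.

Lemma segP f a b y : reflect (exists2 p, a <= p < b & y = f p) (y \in seg f a b).
Proof.
apply: (iffP mapP) => -[p]; rewrite ?mem_index_iota => pab ->; exists p => //.
by rewrite mem_index_iota.
Qed.

End Seg.

Lemma seg_map (S T : eqType) (h : S -> T) (f : nat -> S) a b :
  [seq h x | x <- seg f a b] = seg (h \o f) a b.
Proof. by rewrite /seg -map_comp. Qed.

Section Merging.
Variables (R : realType) (w T : nat) (I : nat -> nat) (K : nat -> R).
Hypothesis w_gt0 : 0 < w.

Definition nonincr (f : nat -> R) (a b : nat) : Prop :=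
  forall p, a <= p -> p.+1 < b -> (f p.+1 <= f p)%R.

(* Positions start from 1, so [p] and [p.+1] lie in the same run of length [v]
   unless [v] divides [p]. *)
Definition runs (v : nat) (f : nat -> R) (b : nat) : Prop :=
  forall p, 0 < p -> p.+1 < b -> ~~ (v %| p) -> (f p.+1 <= f p)%R.

(** In a pass over runs of length w, the cells of [t] below q are the output, [x .. xe - 1] and
    [y .. ye - 1] are the remains of the current pair, and everything from [ye] on is untouched. As
    [xe] is where the second run began, [q + xe = x + y] says that as much was written as consumed.
    By the last clause the latest output dominates both heads, unless a pair has just been
    finished. *)
Definition merging (x xe y ye q : nat) (t : nat -> nat) : Prop :=
  [/\ [/\ 0 < q, x <= xe, y <= ye, ye <= T.+1 & q + xe = x + y],
      perm_eq (seg t 1 q ++ seg I x xe ++ seg I y ye ++ seg I ye T.+1)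
              (seg I 1 T.+1) /\ (ye <= T -> 2 * w %| ye.-1),
      nonincr (K \o I) x xe /\ nonincr (K \o I) y ye,
      runs (2 * w) (K \o t) q
    & 1 < q -> ~~ (2 * w %| q.-1) ->
        (x < xe -> (K (I x) <= K (t q.-1))%R) /\
        (y < ye -> (K (I y) <= K (t q.-1))%R)].

Lemma merging_init t : merging 1 1 1 1 1 t.
Proof.
split; [by split; lia| |by split=> p; lia|by move=> p; lia|by []].
by split; rewrite ?(@seg_geq _ _ 1 1) //= dvdn0.
Qed.

(** With both runs used up, the count in the invariant gives [ye = q], so [q.-1] is a multiple of
    [2 * w] and the next two blocks of length w start at run boundaries. The minima with [T.+1]
    allow the last blocks to be short or empty. *)
Lemma merging_restart x xe y ye q t : runs w (K \o I) T.+1 -> q <= T ->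
  xe <= x -> ye <= y -> merging x xe y ye q t ->
  merging q (minn (q + w) T.+1) (minn (q + w) T.+1) (minn (q + 2 * w) T.+1) q t.
Proof.
move=> rI qT xex yey [[q0 xxe yye yeT eq_ye] [pm al] _ rt _].
have {eq_ye}eq_ye : ye = q by lia.
have wq : w %| q.-1 by apply: (dvdn_trans (dvdn_mull 2 (dvdnn w))); rewrite -eq_ye al; lia.
have nd p : q.-1 < p < q.-1 + w -> ~~ (w %| p).
  move=> hp; rewrite (_ : p = q.-1 + (p - q.-1)); last by lia.
  by rewrite dvdn_addr // gtnNdvd //; lia.
split=> //.
- by clear -qT q0 eq_ye xxe yye yeT xex yey w_gt0; split; lia.
- split.
    move: pm; rewrite (@seg_geq _ _ x) // (@seg_geq _ _ y) //= eq_ye.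
    by rewrite catA -!catA -!seg_cat //; lia.
  rewrite /minn; case: ifP => h; last by lia.
  move=> _; rewrite (_ : (q + 2 * w).-1 = q.-1 + 2 * w); last by lia.
  by rewrite dvdn_addl // -eq_ye al //; lia.
- split=> p p1 p2; apply: rI; try lia; first by apply: nd; lia.
  rewrite (_ : p = w + (p - w)); last by lia.
  by rewrite dvdn_addr // nd //; lia.
- move=> q1 /negP[]; rewrite -eq_ye al //; lia.
Qed.

(** Order across position q is the last clause of the old invariant. The new last clause holds
    because [I x] dominates the rest of its own run and, by hypothesis, the head of the other
    one. *)
Lemma merging_takex x xe y ye q (t t' : nat -> nat) : q <= T ->
  x < xe -> (y < ye -> (K (I y) <= K (I x))%R) ->
  (forall j, t' j = if j == q then I x else t j) ->
  merging x xe y ye q t -> merging x.+1 xe y ye q.+1 t'.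
Proof.
move=> qT xxe Kyx ht [[q0 _ yye yeT eq_ye] [pm al] [sx sy] rt hd].
have tq : t' q = I x by rewrite ht eqxx.
have tlt p : p < q -> t' p = t p by move=> pq; rewrite ht ltn_eqF.
split.
- by clear -qT xxe q0 yye yeT eq_ye; split; lia.
- split=> //; apply: perm_trans pm.
  rewrite seg_recr // tq -cats1 (@eq_seg _ t' t); last by move=> p hp; apply: tlt; lia.
  by rewrite (@seg_ltn _ I x) // -catA.
- by split=> // p p1 p2; apply: sx => //; lia.
- move=> p p0 pq nd /=; rewrite (tlt p) //.
  have [pq'|pq'] := ltnP p.+1 q; first by rewrite tlt //; exact: rt.
  have eq : p.+1 = q by lia.
  rewrite eq tq; have := hd _ _; rewrite -eq /= => /(_ _ _)[] //; lia.
- move=> _ _ /=; rewrite tq; split=> // xxe'; exact: sx.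
Qed.

Lemma merging_takey x xe y ye q (t t' : nat -> nat) : q <= T ->
  y < ye -> (x < xe -> (K (I x) <= K (I y))%R) ->
  (forall j, t' j = if j == q then I y else t j) ->
  merging x xe y ye q t -> merging x xe y.+1 ye q.+1 t'.
Proof.
move=> qT yye Kxy ht [[q0 xxe _ yeT eq_ye] [pm al] [sx sy] rt hd].
have tq : t' q = I y by rewrite ht eqxx.
have tlt p : p < q -> t' p = t p by move=> pq; rewrite ht ltn_eqF.
split.
- by clear -qT xxe q0 yye yeT eq_ye; split; lia.
- split=> //; apply: perm_trans pm.
  rewrite seg_recr // tq -cats1 (@eq_seg _ t' t); last by move=> p hp; apply: tlt; lia.
  rewrite (@seg_ltn _ I y) // -catA perm_cat2l.
  by rewrite -[_ :: seg I y.+1 ye]cat1s -!catA perm_catCA perm_refl.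
- by split=> // p p1 p2; apply: sy => //; lia.
- move=> p p0 pq nd /=; rewrite (tlt p) //.
  have [pq'|pq'] := ltnP p.+1 q; first by rewrite tlt //; exact: rt.
  have eq : p.+1 = q by lia.
  rewrite eq tq; have := hd _ _; rewrite -eq /= => /(_ _ _)[] //; lia.
- move=> _ _ /=; rewrite tq; split=> // yye'; exact: sy.
Qed.

(** At [q = T.+1] the count leaves no remainder: x = xe and y = ye = T.+1. *)
Lemma merging_end x xe y ye t : merging x xe y ye T.+1 t ->
  perm_eq (seg t 1 T.+1) (seg I 1 T.+1) /\ runs (2 * w) (K \o t) T.+1.
Proof.
move=> [[q0 xxe yye yeT eq_ye] [pm al] _ rt _]; split=> //.
move: pm; rewrite (@seg_geq _ I x) 1?(@seg_geq _ I y) 1?(@seg_geq _ I ye) ?cats0 //; lia.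
Qed.

End Merging.

(** * Correctness of the merge sort program *)

Section MergeProgram.

(** The layers of [merge_runs] are named so that each can get its own specification; [merge_runsE]
    holds by computation. *)
Definition merge_step (key : name TReal) (idx : name TNat) : cmd :=
  IF (xend_ <= x_) && (yend_ <= y_) THEN
    x_ ::= q_ ;;
    minimum xend_ (q_ + width_) (total_ + 1) ;;
    y_ ::= xend_ ;;
    minimum yend_ (q_ + 2 * width_) (total_ + 1)
  FI ;;
  IF (x_ < xend_) && ((yend_ <= y_) || (key$[idx$[y_]] <= key$[idx$[x_]]))
  THEN
    tmp_$[q_] ::= idx$[x_] ;; x_ ::= x_ + 1
  ELSE
    tmp_$[q_] ::= idx$[y_] ;; y_ ::= y_ + 1
  FI.

Definition merge_pass (key : name TReal) (idx : name TNat) : cmd :=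
  x_ ::= 1 ;; xend_ ::= 1 ;; y_ ::= 1 ;; yend_ ::= 1 ;;
  FOR q_ FROM 1 TO total_ DO merge_step key idx OD ;;
  FOR q_ FROM 1 TO total_ DO idx$[q_] ::= tmp_$[q_] OD ;;
  width_ ::= 2 * width_.

Definition merge_loop (key : name TReal) (idx : name TNat) (num : expr TNat) :=
  FOR pass_ FROM 1 TO num WHILE width_ < total_ DO merge_pass key idx OD%prog.

Lemma merge_runsE key idx len num :
  merge_runs key idx len num =
  (total_ ::= len * num ;; width_ ::= len ;; merge_loop key idx num)%prog.
Proof. by []. Qed.

Variable R : realType.
Implicit Types e : env R.

Lemma wp_minimum x (e1 e2 : expr TNat) (Q : env R -> Prop) e :
  Q (put x 0 (minn (veval e e1) (veval e e2) : value R TNat) e) ->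
  wp (minimum x e1 e2) Q e.
Proof.
move=> h; apply: wp_cond => /=; case: leqP => // ab _; apply: wp_store.
  by rewrite (minn_idPl ab) in h.
by rewrite (minn_idPr (ltnW ab)) in h.
Qed.

(* The form of [idx] makes it different from the names 0 .. 12, hence from the
   auxiliary variables of the program, and lets this be decided by computation. *)
Variables kk i : nat.
Let key : name TReal := Name TReal kk.
Let idx : name TNat := Name TNat i.+4.+4.+4.+1.

Definition merging_env (w T : nat) (I : nat -> nat) (q : nat) (e : env R) : Prop :=
  merging w T I (realv e kk) (natv e 6 0) (natv e 7 0) (natv e 8 0)
    (natv e 9 0) q (natv e 12).

Lemma merge_step_wp (w T : nat) q e : 0 < w -> q <= T ->
  natv e 4 0 = T -> natv e 5 0 = w -> natv e 11 0 = q ->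
  runs w (realv e kk \o natv e i.+4.+4.+4.+1) T.+1 ->
  merging_env w T (natv e i.+4.+4.+4.+1) q e ->
  wp (merge_step key idx) (merging_env w T (natv e i.+4.+4.+4.+1) q.+1) e.
Proof.
move=> w0 qT eT ew eq rI hm; apply: wp_seq.
(* Assertion between the two conditionals. After the refill at least one run is nonempty, which is
   needed where the second conditional takes from the y-run by default. *)
pose mid e' := [/\ merging_env w T (natv e i.+4.+4.+4.+1) q e',
  natv e' i.+4.+4.+4.+1 = natv e i.+4.+4.+4.+1, natv e' 11 0 = q,
  realv e' = realv e
  & natv e' 6 0 < natv e' 7 0 \/ natv e' 8 0 < natv e' 9 0].
apply: (@wp_impl _ _ mid) => [e' [hm' eI' eq' er' ne]|].
  apply: wp_cond => /=; rewrite eI' er'.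
    move=> c; apply: wp_seq; apply: wp_store => /=; apply: wp_store => /=.
    rewrite /merging_env /= eI' eq' er' addn1.
    have {c}[c1 c2] : natv e' 6 0 < natv e' 7 0 /\ (natv e' 8 0 < natv e' 9 0 ->
        (realv e kk (natv e i.+4.+4.+4.+1 (natv e' 8 0)) <=
         realv e kk (natv e i.+4.+4.+4.+1 (natv e' 6 0)))%R).
      move: c; case: (ltnP (natv e' 6 0)) => //= _.
      by case: (leqP (natv e' 9 0)) => //= _; case: (_ <= _)%R.
    rewrite /merging_env er' in hm'; apply: merging_takex hm' => //.
  move=> c; apply: wp_seq; apply: wp_store => /=; apply: wp_store => /=.
  rewrite /merging_env /= eI' eq' er' addn1.
  have {c}[c1 c2] : natv e' 8 0 < natv e' 9 0 /\ (natv e' 6 0 < natv e' 7 0 ->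
      (realv e kk (natv e i.+4.+4.+4.+1 (natv e' 6 0)) <=
       realv e kk (natv e i.+4.+4.+4.+1 (natv e' 8 0)))%R).
    move: c ne; case: (ltnP (natv e' 6 0)) => //= _; last by move=> _ [].
    case: (leqP (natv e' 9 0)) => //= _.
    by case: (leP (realv e kk _)) => //= /ltW.
  rewrite /merging_env er' in hm'; apply: merging_takey hm' => //.
apply: wp_cond => /= c; last first.
  apply: wp_skip; split=> //.
  case: (leqP (natv e 7 0)) c => [|//]; last by left.
  by case: (leqP (natv e 9 0)) => // *; right.
apply: wp_seq; apply: wp_store; apply: wp_seq; apply: wp_minimum.
apply: wp_seq; apply: wp_store; apply: wp_minimum => /=.
rewrite eq ew eT addn1; split=> //=; last by left; lia.
have [c1 c2] : natv e 7 0 <= natv e 6 0 /\ natv e 9 0 <= natv e 8 0.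
  by move: c; case: (natv e 7 0 <= _); case: (natv e 9 0 <= _).
by rewrite /merging_env /=; apply: merging_restart hm.
Qed.

Lemma merge_pass_wp (w T : nat) e : 0 < w -> natv e 4 0 = T -> natv e 5 0 = w ->
  runs w (realv e kk \o natv e i.+4.+4.+4.+1) T.+1 ->
  wp (merge_pass key idx) (fun e' => [/\ natv e' 5 0 = 2 * w,
    runs (2 * w) (realv e kk \o natv e' i.+4.+4.+4.+1) T.+1
    & perm_eq (seg (natv e' i.+4.+4.+4.+1) 1 T.+1)
              (seg (natv e i.+4.+4.+4.+1) 1 T.+1)]) e.
Proof.
move=> w0 eT ew rI.
do 4 (apply: wp_seq; apply: wp_store => /=).
set e1 := Env _ _.
have hm1 : merging_env w T (natv e i.+4.+4.+4.+1) 1 e1 by exact: merging_init.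
apply: wp_seq; apply: (wp_for_all (merging_env w T (natv e i.+4.+4.+4.+1))) => //=.
  move=> q e2 hq [aN aR] hm2.
  have eI : natv e2 i.+4.+4.+4.+1 = natv e i.+4.+4.+4.+1 by rewrite aN.
  have er : realv e2 = realv e by apply/funext => x; rewrite aR.
  rewrite -eI; apply: merge_step_wp => //=; rewrite ?aN //= ?eI ?er //.
  by move: hq; rewrite eT; lia.
move=> e2 [aN aR]; rewrite eT => hm2; have [pm rt] := merging_end w0 hm2.
have eT2 : natv e2 4 0 = T by rewrite aN.
have er : realv e2 = realv e by apply/funext => x; rewrite aR.
apply: wp_seq; apply: (wp_for_all (fun q e' =>
  forall j, 0 < j < q -> natv e' i.+4.+4.+4.+1 j = natv e2 12 j)).
- by [].
- by move=> j /=; lia.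
- move=> q e3 /= hq [aN3 aR3] h; apply: wp_store => /= j hj.
  by rewrite eqxx aN3 //=; case: eqP => [->//|jq]; apply: h; lia.
- move=> e3 /= [aN3 aR3] h; apply: wp_store => /=.
  rewrite aN3 // aN //= ew.
  have e32 j : 0 < j < T.+1 -> natv e3 i.+4.+4.+4.+1 j = natv e2 12 j.
    by rewrite -eT2; exact: h.
  split=> //; last by rewrite (@eq_seg _ _ (natv e2 12)).
  by move=> p p0 pT nd /=; rewrite !e32 -?er; [exact: rt|lia..].
Qed.

(** Whether the guard fails or all [num] passes are made, the width has reached T at the exit. Then
    no position below T is a multiple of it, and [runs] becomes plain monotonicity. *)
Lemma merge_loop_wp (num : expr TNat) (w T : nat) e : 0 < w ->
  natv e 4 0 = T -> natv e 5 0 = w -> T <= w * 2 ^ (veval e num : nat) ->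
  runs w (realv e kk \o natv e i.+4.+4.+4.+1) T.+1 ->
  wp (merge_loop key idx num) (fun e' =>
    nonincr (realv e kk \o natv e' i.+4.+4.+4.+1) 1 T.+1 /\
    perm_eq (seg (natv e' i.+4.+4.+4.+1) 1 T.+1)
            (seg (natv e i.+4.+4.+4.+1) 1 T.+1)) e.
Proof.
move=> w0 eT ew hT rI.
apply: (wp_for (fun p e' => [/\ natv e' 5 0 = w * 2 ^ p.-1,
    runs (w * 2 ^ p.-1) (realv e kk \o natv e' i.+4.+4.+4.+1) T.+1
    & perm_eq (seg (natv e' i.+4.+4.+4.+1) 1 T.+1)
              (seg (natv e i.+4.+4.+4.+1) 1 T.+1)])) => /=.
- by [].
- by rewrite ew muln1.
- move=> p e1 hp [aN aR] [ew1 r1 p1] _.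
  have er : realv e1 = realv e by apply/funext => x; rewrite aR.
  apply: (wp_impl _ (@merge_pass_wp (w * 2 ^ p.-1) T _ _ _ _ _)) => //=; last 3 first.
  + by rewrite muln_gt0 w0 expn_gt0.
  + by rewrite aN.
  + by rewrite er.
  move=> e2 [ew2 r2 p2].
  have e2p : 2 * (w * 2 ^ p.-1) = w * 2 ^ p by rewrite -[in RHS](prednK (n := p)) ?expnS; lia.
  rewrite -e2p; split=> //; first by rewrite er in r2.
  exact: perm_trans p2 p1.
- move=> p e1 hp [aN aR] [ew1 r1 p1] ex; split=> // q q0 qT.
  apply: r1 => //; apply/negP => /dvdn_leq; rewrite q0 => /(_ isT).
  have wT : T <= w * 2 ^ p.-1.
    case: ex => [->//|]; rewrite (aN 4) //= ew1 eT.
    by case: ltnP.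
  lia.
Qed.

End MergeProgram.

(** * The matrix and the order of its entries *)

Section Matrix.
Variables (R : realType) (d k : nat) (c : nat -> nat).

Definition Umx (i j : nat) : R :=
  (0%:R - ((c i)%:R - (c j)%:R) - (d * (k - i) + j)%:R / (2 * d * k)%:R)%R.

Hypotheses (k_gt0 : 0 < k) (kd : k <= d).
Hypothesis c_noninc : forall i j, 0 < i -> i <= j -> j <= d -> c j <= c i.

Let den_gt0 : (0 < (2 * d * k)%:R :> R)%R.
Proof. by rewrite ltr0n !muln_gt0 k_gt0 (leq_trans k_gt0 kd). Qed.

Lemma Umx_row i j j' : 0 < j -> j < j' -> j' <= d -> (Umx i j' < Umx i j)%R.
Proof.
move=> j0 jj' j'd; rewrite /Umx.
have h1 : ((c j')%:R <= (c j)%:R :> R)%R by rewrite ler_nat c_noninc // ltnW.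
have h2 : ((d * (k - i) + j)%:R / (2 * d * k)%:R <
           (d * (k - i) + j')%:R / (2 * d * k)%:R :> R)%R.
  by rewrite ltr_pM2r ?invr_gt0 // ltr_nat ltn_add2l.
lra.
Qed.

(** The summand [d * (k - i)] of the fraction breaks ties so that columns increase strictly
    downwards; this makes the thresholds monotone in the row. *)
Lemma Umx_col i i' j : 0 < i -> i < i' -> i' <= k -> (Umx i j < Umx i' j)%R.
Proof.
move=> i0 ii' i'k; rewrite /Umx.
have h1 : ((c i')%:R <= (c i)%:R :> R)%R.
  by rewrite ler_nat c_noninc //; [exact: ltnW|exact: leq_trans i'k _].
have h2 : ((d * (k - i') + j)%:R / (2 * d * k)%:R <
           (d * (k - i) + j)%:R / (2 * d * k)%:R :> R)%R.
  by rewrite ltr_pM2r ?invr_gt0 // ltr_nat ltn_add2r ltn_pmul2l; lia.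
lra.
Qed.

(** On the diagonal the counts cancel, and the fraction is largest in row 1. *)
Lemma Umx_diag i : 0 < i -> i <= k -> (Umx 1 1 <= Umx i i)%R.
Proof.
move=> i0 ik; rewrite /Umx !subrr.
suff : ((d * (k - i) + i)%:R / (2 * d * k)%:R <=
        (d * (k - 1) + 1)%:R / (2 * d * k)%:R :> R)%R by lra.
rewrite ler_pM2r ?invr_gt0 // ler_nat.
have -> : k - 1 = (k - i) + (i - 1) by lia.
by have : i - 1 <= d * (i - 1); [rewrite leq_pmull //; lia|lia].
Qed.

(* The subtracted fractions lie in the interval ]0, 1/2]. *)
Lemma ceil_Umx i j : 0 < i -> i <= k -> 0 < j -> j <= d ->
  Num.ceil (Umx i j) = ((c j)%:Z - (c i)%:Z)%R.
Proof.
move=> i0 ik j0 jd; apply: ceil_def; rewrite /Umx !rmorphB /= -!pmulrn.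
have h1 : (0 < (d * (k - i) + j)%:R / (2 * d * k)%:R :> R)%R.
  by rewrite divr_gt0 // ltr0n addn_gt0 j0 orbT.
have h2 : ((d * (k - i) + j)%:R / (2 * d * k)%:R < 1 :> R)%R.
  rewrite ltr_pdivrMr // mul1r ltr_nat.
  have -> : 2 * d * k = d * k + d * (k - i) + d * i by nia.
  have : d <= d * i by rewrite leq_pmulr.
  have : 0 < d * k by rewrite muln_gt0 k_gt0 andbT; lia.
  lia.
by apply/andP; split; lra.
Qed.

(** Equal entries have equal ceilings, hence equal fractions, and [d * (k - i) + j] with 1 <= j <= d
    determines i and j. *)
Lemma Umx_inj i j i' j' : 0 < i -> i <= k -> 0 < j -> j <= d ->
  0 < i' -> i' <= k -> 0 < j' -> j' <= d -> Umx i j = Umx i' j' ->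
  i = i' /\ j = j'.
Proof.
move=> i0 ik j0 jd i0' ik' j0' jd' eqU.
have /(congr1 (fun z : int => z%:~R : R)) := ceil_Umx i0 ik j0 jd.
rewrite eqU ceil_Umx // !rmorphB /= -!pmulrn => eqc.
have : ((d * (k - i) + j)%:R / (2 * d * k)%:R =
        (d * (k - i') + j')%:R / (2 * d * k)%:R :> R)%R.
  by move: eqU; rewrite /Umx; lra.
move/(mulIf _); rewrite invr_eq0 gt_eqF // => /(_ isT) /eqP.
rewrite eqr_nat => /eqP eqn.
have eqi : k - i = k - i'.
  have [lt|lt|//] := ltngtP (k - i) (k - i').
    by have := leq_mul2l d (k - i).+1 (k - i'); rewrite lt orbT mulnS; lia.
  by have := leq_mul2l d (k - i').+1 (k - i); rewrite lt orbT mulnS; lia.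
by split; [lia|move: eqn; rewrite eqi; lia].
Qed.

(** * Entries of one row within an initial part of the sorted order *)

Section SortedEntries.
Variables (V : nat -> R) (r col : nat -> nat).

(** The interface between sorting and everything after it. Strict decrease also ensures that no
    entry is listed twice. *)
Definition sorted_entries : Prop :=
  [/\ forall a, 0 < a -> a <= d * k ->
        [/\ 0 < r a, r a <= k, 0 < col a, col a <= d & V a = Umx (r a) (col a)],
      forall i j, 0 < i -> i <= k -> 0 < j -> j <= d ->
        exists2 a, 0 < a <= d * k & r a = i /\ col a = j
    & forall a b, 0 < a -> a < b -> b <= d * k -> (V b < V a)%R].

Hypothesis entries : sorted_entries.

(* For the threshold [V a], the entries of row [i] above it are those of the
   columns 1 .. [reach i a]. *)
Definition reach (i a : nat) : nat := \sum_(1 <= a' < a.+1) (r a' == i).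

Lemma reach0 i : reach i 0 = 0. Proof. by rewrite /reach big_geq. Qed.

Lemma reachS i a : reach i a.+1 = reach i a + (r a.+1 == i).
Proof. by rewrite /reach big_nat_recr. Qed.

Lemma reach_le i a b : a <= b -> reach i a <= reach i b.
Proof.
move=> /subnK <-; elim: (b - a) => // n IH.
by rewrite addSn reachS (leq_trans IH) // leq_addr.
Qed.

Lemma V_lt a b : 0 < a <= d * k -> 0 < b <= d * k -> (V b < V a)%R = (a < b).
Proof.
case: entries => _ _ dec /andP[a0 ad] /andP[b0 bd].
case: (ltngtP a b) => [ab|ba|->]; last by rewrite ltxx.
  by rewrite dec.
by apply/negbTE; rewrite -leNgt ltW // dec.
Qed.

Let seen i a j := exists2 b, 0 < b <= a & r b = i /\ col b = j.

(** A column beyond the next one would skip an entry of the same row that is larger, hence listed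
    earlier; a column already seen would repeat a value of V. *)
Let next_col i a : 0 < i -> i <= k -> a < d * k -> r a.+1 = i ->
  (forall j, 0 < j -> j <= d -> seen i a j <-> j <= reach i a) ->
  col a.+1 = (reach i a).+1.
Proof.
move=> i0 ik ad ri IH; have [rng ex dec] := entries.
have [_ _ c0 cd eV] := rng _ (ltn0Sn a) ad.
apply/eqP; rewrite eqn_leq; apply/andP; split.
  rewrite leqNgt; apply/negP => lt.
  have [|b hb [rb cb]] := ex i (reach i a).+1 i0 ik isT; first by lia.
  have [b0 bd] := andP hb; have [_ _ _ _ eVb] := rng _ b0 bd.
  have : (V a.+1 < V b)%R by rewrite eV eVb ri rb cb; apply: Umx_row.
  rewrite V_lt // => ba.
  suff : (reach i a).+1 <= reach i a by rewrite ltnn.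
  by apply/IH => //; [lia|exists b; lia].
rewrite ltnNge; apply/negP => /(IH _ c0 cd).2 [b hb [rb cb]].
have [||_ _ _ _ eVb] := rng b; [lia|lia|].
have : V b = V a.+1 by rewrite eV eVb rb cb ri.
by move/eqP; apply/negP; rewrite gt_eqF // V_lt //; lia.
Qed.

Lemma reach_entry i a j : 0 < i -> i <= k -> a <= d * k -> 0 < j -> j <= d ->
  (exists2 b, 0 < b <= a & r b = i /\ col b = j) <-> j <= reach i a.
Proof.
move=> i0 ik; elim: a j => [|a IH] j ad j0 jd.
  by rewrite reach0; split=> [[b]|]; lia.
have {}IH j' : 0 < j' -> j' <= d -> seen i a j' <-> j' <= reach i a.
  exact: IH (ltnW ad).
rewrite reachS; case: eqP => [ri|ri]; last first.
  rewrite addn0 -IH //; split=> -[b hb [rb cb]]; exists b => //; last by lia.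
  by have [eb|nb] := eqVneq b a.+1; [move: ri; rewrite -eb rb|lia].
have cE := next_col i0 ik ad ri IH.
rewrite addn1; split=> [[b hb [rb cb]]|].
  have [eb|nb] := eqVneq b a.+1; first by rewrite -cb eb cE.
  by rewrite (leq_trans _ (leqnSn _)) //; apply/IH => //; exists b => //; lia.
rewrite leq_eqVlt => /orP[/eqP je|]; first by exists a.+1; [lia|rewrite cE ri je].
rewrite ltnS => /(IH _ j0 jd)[b hb hb2]; exists b => //; lia.
Qed.

(** Justifies the assignment of step (5), which uses the column as a count of the entries of the row
    met so far. *)
Lemma reach_col a : 0 < a -> a <= d * k -> reach (r a) a = col a.
Proof.
case: a => // a _ ad; have [rng ex dec] := entries.
have [r0 rk c0 cd eV] := rng _ (ltn0Sn a) ad.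
rewrite reachS eqxx addn1 -(@next_col (r a.+1) a) // => j j0 jd.
by apply: reach_entry => //; exact: ltnW.
Qed.

Lemma reach_le_d i a : a <= d * k -> reach i a <= d.
Proof.
have [rng _ _] := entries; elim: a => [|a IH] ad; first by rewrite reach0.
have [ri|ri] := eqVneq (r a.+1) i; last by rewrite reachS (negbTE ri) addn0 IH // ltnW.
by rewrite -ri reach_col //; have [] := rng _ (ltn0Sn a) ad.
Qed.

(** Identifies [reach i a] with the threshold t_i of step (9): an entry is at least V a exactly when
    it is listed no later than position a. *)
Lemma V_le_Umx a i j : 0 < a -> a <= d * k -> 0 < i -> i <= k ->
  0 < j -> j <= d -> (V a <= Umx i j)%R = (j <= reach i a).
Proof.
move=> a0 ad i0 ik j0 jd; have [rng ex dec] := entries.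
have [b hb [rb cb]] := ex i j i0 ik j0 jd; have [b0 bd] := andP hb.
have [_ _ _ _ eVb] := rng b b0 bd; rewrite -rb -cb -eVb.
apply/idP/idP => [|/reach_entry].
  rewrite leNgt V_lt -?leqNgt ?a0 // => ba; apply/reach_entry => //; rewrite ?rb ?cb //.
  by exists b; rewrite ?b0.
rewrite rb cb => /(_ i0 ik ad j0 jd)[b' hb' [rb' cb']].
have [||_ _ _ _ eVb'] := rng b'; [lia|lia|].
have -> : V b = V b' by rewrite eVb eVb' rb cb rb' cb'.
by rewrite leNgt V_lt -?leqNgt; lia.
Qed.

(** Columns increase downwards, so the last column reached in row i is reached in every later row as
    well. *)
Lemma reach_mono i i' a : a <= d * k -> 0 < i -> i <= i' -> i' <= k ->
  reach i a <= reach i' a.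
Proof.
move=> ad i0; rewrite leq_eqVlt => /orP[/eqP->//|ii' i'k].
have [->//|] := posnP (reach i a); move: (reach_le_d i ad).
case: (posnP a) => [->|a0]; first by rewrite reach0.
move=> rd r0; rewrite -V_le_Umx //; last by lia.
rewrite ltW // (le_lt_trans _ (Umx_col _ i0 ii' i'k)) // V_le_Umx //; lia.
Qed.

(** In column [col a], the entry of the earlier row i is smaller than V a by [Umx_col]. Hence fixing
    the item [col a] takes no candidate away from the rows before [r a]. *)
Lemma reach_lt_col i a : 0 < a -> a <= d * k -> 0 < i -> i < r a ->
  reach i a < col a.
Proof.
move=> a0 ad i0 ir; have [rng ex dec] := entries.
have [r0 rk c0 cd eV] := rng _ a0 ad.
rewrite ltnNge -V_le_Umx //; last by lia.
by rewrite -ltNge eV Umx_col.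
Qed.

(** V a <= U(1,1) <= U(i,i). This keeps every factor [reach i a - i.-1] positive. *)
Lemma reach_ge i a : a <= d * k -> 0 < i -> i <= k -> 0 < reach 1 a ->
  i <= reach i a.
Proof.
move=> ad i0 ik; case: (posnP a) => [->|a0]; first by rewrite reach0.
rewrite -V_le_Umx //; last by lia.
move=> h; rewrite -V_le_Umx //; last by lia.
exact: le_trans h (Umx_diag _ _).
Qed.

Lemma reach_full i : 0 < i -> i <= k -> reach i (d * k) = d.
Proof.
move=> i0 ik; apply/eqP; rewrite eqn_leq reach_le_d //=.
have [rng ex dec] := entries.
have d0 : 0 < d := leq_trans k_gt0 kd.
by apply/reach_entry => //; have [b] := ex i d i0 ik d0 (leqnn d); exists b.
Qed.

(** A is the position of the entry (1, 1), the index at which the loop of step (5) is left. *)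
Lemma first_full : exists2 A, 0 < A <= d * k &
  r A = 1 /\ forall a, a <= d * k -> (0 < reach 1 a) = (A <= a).
Proof.
have [rng ex dec] := entries.
have d0 : 0 < d := leq_trans k_gt0 kd.
have [//|//|//|//|A hA [rA cA]] := ex 1 1; exists A => //; split=> // a ad.
case: (posnP a) => [->|a0]; first by rewrite reach0; lia.
have [A0 Ad] := andP hA; have [_ _ _ _ eV] := rng A A0 Ad.
rewrite -V_le_Umx //.
by rewrite -[X in Umx X _]rA -[X in Umx _ X]cA -eV leNgt V_lt ?a0 // -leqNgt.
Qed.

(** Through [V_le_Umx] this says that V a is the smallest of the entries (i, S i) and is attained in
    row [r a]. Distinctness of the items is kept separate. *)
Definition compatible (a : nat) (S : nat -> nat) : Prop :=
  S (r a) = col a /\ forall i, 0 < i <= k -> 0 < S i <= reach i a.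

(** Take the least a whose thresholds cover S. At a - 1 some row i fails, and only row [r a] grows
    at a, so i = r a and S i equals the new threshold, which is [col a]. *)
Lemma compatible_ex S : (forall i, 0 < i <= k -> 0 < S i <= d) ->
  exists2 a, 0 < a <= d * k & compatible a S.
Proof.
move=> hS; pose P a := all (fun i => S i <= reach i a) (iota 1 k).
have PP a : reflect (forall i, 0 < i <= k -> S i <= reach i a) (P a).
  apply: (iffP allP) => h i hi; apply: h; move: hi; rewrite mem_iota; lia.
have exP : exists a, P a.
  exists (d * k); apply/PP => i /andP[i0 ik].
  by rewrite reach_full //; have [] := andP (hS i _); lia.
case: (ex_minnP exP) => a /PP hP amin.
have a0 : 0 < a.
  case: a hP {amin} => // /(_ 1); rewrite reach0 => /(_ _) h.
  by have := hS 1; have := h; lia.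
have ad : a <= d * k.
  apply: amin; apply/PP => i /andP[i0 ik].
  by rewrite reach_full //; have [] := andP (hS i _); lia.
exists a; first by rewrite a0.
split=> [|i hi]; last by have := hS i hi; have := hP i hi; lia.
have : ~~ P a.-1 by apply/negP => /amin; lia.
rewrite -has_predC => /hasP[i]; rewrite mem_iota /= -ltnNge => hi lt.
have hi' : 0 < i <= k by lia.
have := reachS i a.-1; rewrite prednK //; have := hP i hi'.
by case: eqP => [ri|_]; [rewrite -reach_col // ri; lia|lia].
Qed.

(** If a < b, the threshold of row [r b] only reaches S (r b) = col b at b, so it was still too
    small at a. *)
Lemma compatible_inj a b S : 0 < a <= d * k -> 0 < b <= d * k ->
  compatible a S -> compatible b S -> a = b.
Proof.
have [rng ex dec] := entries.
wlog lt : a b / a < b.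
  move=> h ha hb ca cb; have [lt|lt|//] := ltngtP a b; first exact: h.
  by apply/esym; exact: h.
move=> /andP[a0 ad] /andP[b0 bd] [ca ha] [cb hb].
have [r0 rk _ _ _] := rng b b0 bd.
have := ha (r b); rewrite r0 rk cb => /(_ isT)/andP[_].
rewrite -reach_col //; have := reachS (r b) b.-1; rewrite prednK // eqxx.
by have := @reach_le (r b) a b.-1; lia.
Qed.

(** The ceiling is monotone and removes the fraction, so a minimum over entries becomes a minimum
    over differences of counts. *)
Lemma compatible_util a S : 0 < a <= d * k -> compatible a S ->
  Num.ceil (V a) = ((c (S (r a)))%:Z - (c (r a))%:Z)%R /\
  forall i, 0 < i <= k -> (Num.ceil (V a) <= (c (S i))%:Z - (c i)%:Z)%R.
Proof.
move=> /andP[a0 ad] [ca ha]; have [rng ex dec] := entries.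
have [r0 rk c0 cd eV] := rng a a0 ad.
split; first by rewrite eV ceil_Umx // ca.
move=> i hi; have [i0 ik] := andP hi; have /andP[S0 Sr] := ha i hi.
have Sd : S i <= d by rewrite (leq_trans Sr) // reach_le_d.
by rewrite -ceil_Umx //; apply: le_ceil; rewrite V_le_Umx.
Qed.

End SortedEntries.
End Matrix.

(** * Relabelling, building and sorting the matrix *)

Lemma nonincr_le (R : realType) (f : nat -> R) a b i j :
  nonincr f a b -> a <= i -> i <= j -> j < b -> (f j <= f i)%R.
Proof.
move=> h ai /subnK <-; elim: (j - i) => [//|n IH] jb.
by rewrite addSn (le_trans (h _ _ _)) ?IH //; lia.
Qed.

Section Phases.
Variable R : realType.
Implicit Types e : env R.

(** Only the sorted counts are specified: later steps read [c_] alone, so the order given to items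
    of equal count does not matter. *)
Lemma relabel_wp (d : nat) e : natv e 0 0 = d -> 0 < d ->
  wp relabel (fun e' =>
    perm_eq (seg (natv e' 14) 1 d.+1) (seg (natv e 2) 1 d.+1) /\
    forall i j, 0 < i -> i <= j -> j <= d -> natv e' 14 j <= natv e' 14 i) e.
Proof.
move=> ed d0; apply: wp_seq; apply: (wp_for_all (fun j e' => forall x, 0 < x < j ->
  realv e' 1 x = (natv e 2 x)%:R%R /\ natv e' 13 x = x)) => /=.
- by [].
- by move=> x; lia.
- move=> j e' hj [aN aR] h; apply: wp_seq; apply: wp_store; apply: wp_store => /=.
  by move=> x hx; rewrite aN //; case: eqP => [->//|ne]; apply: h; lia.
rewrite ed => e1 [aN1 aR1] h1.
apply: wp_seq; rewrite merge_runsE; apply: wp_seq; apply: wp_store => /=.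
apply: wp_seq; apply: wp_store => /=; apply: wp_frame.
apply: wp_impl (@merge_loop_wp _ 1 0 d_ 1 d _ _ _ _ _ _) => //=; last 3 first.
- by rewrite aN1 // ed mul1n.
- by rewrite aN1 // ed mul1n ltnW // ltn_expl.
- by move=> p; rewrite dvd1n.
- move=> e2 [noninc pm] [aN2 aR2].
  have rng x : 0 < x <= d -> 0 < natv e2 13 x <= d.
    move=> hx; have : natv e2 13 x \in seg (natv e1 13) 1 d.+1.
      by rewrite -(perm_mem pm) mem_seg.
    by move=> /segP[p hp ->]; have [_ ->] := h1 p hp.
  apply: (wp_for_all (fun j e' => forall x, 0 < x < j ->
    natv e' 14 x = natv e 2 (natv e2 13 x))) => /=.
  + by [].
  + by move=> x; lia.
  + move=> j e' hj [aN aR] h; apply: wp_store => /= x hx.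
    rewrite (aN 13) // (aN 2) // aN2 //= aN1 //.
    by case: eqP => [->//|ne]; apply: h; lia.
  rewrite aN2 //= aN1 // ed => e3 [aN3 aR3] h3; split.
    rewrite (@eq_seg _ _ (natv e 2 \o natv e2 13)) //.
    rewrite -seg_map (perm_trans (perm_map _ pm)) // seg_map.
    by rewrite (@eq_seg _ _ (natv e 2)) // => p hp /=; have [_ ->] := h1 p hp.
  move=> i j i0 ij jd; rewrite !h3 //; try lia.
  have := nonincr_le noninc i0 ij jd => /=.
  have [|-> _] := h1 (natv e2 13 j); first by have := rng j; lia.
  have [|-> _] := h1 (natv e2 13 i); first by have := rng i; lia.
  by rewrite ler_nat.
Qed.

(** Together with [entry_col], the inverse of the cell number [(i - 1) * d + j]. The shifts by one
    arise because cells, rows and columns all start from 1. *)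
Definition entry_row (d x : nat) := (x.-1 %/ d).+1.
Definition entry_col (d x : nat) := (x.-1 %% d).+1.

Lemma entry_rowE d i j : 0 < i -> 0 < j -> j <= d ->
  entry_row d ((i - 1) * d + j) = i.
Proof.
move=> i0 j0 jd; rewrite /entry_row -[in LHS](prednK j0) addnS /=.
by rewrite divnMDl ?divn_small ?addn0 ?subn1 ?prednK //; lia.
Qed.

Lemma entry_colE d i j : 0 < i -> 0 < j -> j <= d ->
  entry_col d ((i - 1) * d + j) = j.
Proof.
move=> i0 j0 jd; rewrite /entry_col -[in LHS](prednK j0) addnS /=.
by rewrite modnMDl modn_small ?prednK //; lia.
Qed.

Lemma entry_index d x : 0 < x -> (entry_row d x - 1) * d + entry_col d x = x.
Proof.
by move=> x0; rewrite /entry_row /entry_col subn1 /= addnS -divn_eq prednK.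
Qed.

Lemma entry_row_le d k x : 0 < x -> x <= d * k -> entry_row d x <= k.
Proof.
move=> x0 xdk; rewrite /entry_row ltn_divLR; first by rewrite mulnC; lia.
by case: d xdk => //; rewrite mul0n; lia.
Qed.

Lemma entry_col_le d x : 0 < d -> entry_col d x <= d.
Proof. by move=> d0; rewrite /entry_col ltn_mod. Qed.

Definition matrix_stored (d k : nat) (c : nat -> nat) (e : env R) (n : nat) : Prop :=
  forall x, 0 < x < n ->
  [/\ realv e 2 x = Umx R d k c (entry_row d x) (entry_col d x),
      natv e 15 x = entry_row d x, natv e 16 x = entry_col d x
    & natv e 17 x = x].

Lemma build_matrix_wp (d k : nat) e : natv e 0 0 = d -> natv e 1 0 = k ->
  wp build_matrix (fun e' => matrix_stored d k (natv e 14) e' (d * k).+1) e.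
Proof.
move=> ed ek; apply: (wp_for_all (fun i e' =>
   matrix_stored d k (natv e 14) e' ((i - 1) * d).+1)) => /=.
- by [].
- by move=> x; rewrite mul0n; lia.
- move=> i e1 hi [aN1 aR1] h1; apply: (wp_for_all (fun j e' =>
    matrix_stored d k (natv e 14) e' ((i - 1) * d + j))) => /=.
  + by [].
  + by rewrite addn1.
  + move=> j e2; rewrite aN1 // ed => hj [aN2 aR2] h2.
    do 3 (apply: wp_seq; apply: wp_store); apply: wp_store => /= x hx.
    rewrite ?(aN2 0) ?(aN2 1) ?(aN2 14) ?(aN2 32) //= !aN1 // ed ek.
    case: eqP => [->|ne]; last by apply: h2; lia.
    by rewrite entry_rowE ?entry_colE //; lia.
  rewrite aN1 // ed => e2 [aN2 aR2] h2; move: h2.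
  by rewrite (_ : _ + _ = (i.+1 - 1) * d + 1) ?addn1 // subSS subn0 -{2}(@subnK 1 i)
    ?mulnDl; lia.
by rewrite ek => e1 _; rewrite subSS subn0 mulnC.
Qed.

Lemma sort_entries_wp (d k : nat) (c : nat -> nat) e : 0 < k -> k <= d ->
  (forall i j, 0 < i -> i <= j -> j <= d -> c j <= c i) ->
  natv e 0 0 = d -> natv e 1 0 = k -> matrix_stored d k c e (d * k).+1 ->
  wp sort_entries (fun e' => sorted_entries d k c (realv e' 3) (natv e' 18) (natv e' 19)) e.
Proof.
move=> k0 kd hc ed ek hM; have d0 : 0 < d by exact: leq_trans kd.
apply: wp_seq; rewrite merge_runsE; apply: wp_seq; apply: wp_store => /=.
apply: wp_seq; apply: wp_store => /=; apply: wp_frame.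
rewrite ed ek; set e1 := Env _ _.
apply: wp_impl (@merge_loop_wp _ 2 4 k_ d (d * k) _ _ _ _ _ _) => //=; last 2 first.
- by rewrite ek leq_mul // ltnW // ltn_expl.
(* The initial runs are the rows: unless d divides x, cell x.+1 holds the next column of the same
   row. *)
- move=> x x0 xdk ndx /=.
  have [|U0 _ _ ->] := hM x; first by lia.
  have [|U1 _ _ ->] := hM x.+1; first by lia.
  rewrite U0 U1.
  have xE : x = x.-1.+1 by rewrite prednK.
  have h1 : entry_row d x.+1 = entry_row d x.
    by rewrite /entry_row /= {1}xE divnS // -xE (negbTE ndx).
  have h2 : entry_col d x.+1 = (entry_col d x).+1.
    by rewrite /entry_col /= {1}xE modnS -xE (negbTE ndx).
  rewrite h1 h2 ltW // Umx_row // -h2; exact: entry_col_le.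
move=> e2 [noninc pm] [aN2 aR2].
rewrite /= in noninc pm.
have rng x : 0 < x <= d * k -> 0 < natv e2 17 x <= d * k.
  move=> hx; have : natv e2 17 x \in seg (natv e 17) 1 (d * k).+1.
    by rewrite -(perm_mem pm) mem_seg.
  by move=> /segP[p hp ->]; have [_ _ _ ->] := hM p hp.
have onto x : 0 < x <= d * k -> exists2 y, 0 < y <= d * k & natv e2 17 y = x.
  move=> hx; have : x \in seg (natv e 17) 1 (d * k).+1.
    by apply/segP; exists x; rewrite //; have [_ _ _ ->] := hM x hx.
  by rewrite -(perm_mem pm) => /segP[y hy ->]; exists y.
(* The sorted indices are a permutation of 1 .. d * k, so none occurs twice. Since equal entries
   have equal indices by [Umx_inj], the weak order given by the sort is strict. *)
have inj x y : 0 < x <= d * k -> 0 < y <= d * k -> natv e2 17 x = natv e2 17 y -> x = y.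
  move=> hx hy exy.
  have un : uniq (seg (natv e2 17) 1 (d * k).+1).
    rewrite (perm_uniq pm) (@eq_seg _ _ ssrfun.id) /seg ?map_id ?iota_uniq //.
    by move=> p hp; have [_ _ _ ->] := hM p hp.
  have nthE z : 0 < z <= d * k -> nth 0 (seg (natv e2 17) 1 (d * k).+1) z.-1 = natv e2 17 z.
    by move=> hz; rewrite (nth_map 0) ?size_iota ?nth_iota; [congr natv|..]; lia.
  have : x.-1 == y.-1.
    by rewrite -(nth_uniq 0 _ _ un) ?size_seg ?nthE ?exy //; lia.
  by move/eqP; lia.
apply: (wp_for_all (fun a e' => forall x, 0 < x < a ->
  [/\ realv e' 3 x = Umx R d k c (natv e' 18 x) (natv e' 19 x),
      natv e' 18 x = entry_row d (natv e2 17 x)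
    & natv e' 19 x = entry_col d (natv e2 17 x)])) => /=.
- by [].
- by move=> x; lia.
- move=> a e3; rewrite aN2 //= (aN2 1) //= ed ek => ha [aN3 aR3] h3.
  do 2 (apply: wp_seq; apply: wp_store); apply: wp_store => /= x hx.
  case: eqP => [->|ne]; last by apply: h3; lia.
  rewrite !(aN3 17) // !aR3 // !(aN3 15) // !(aN3 16) //.
  rewrite !(aN2 15) // !(aN2 16) // !aR2 //=.
  by have [-> -> -> _] := hM _ (rng a ha).
rewrite aN2 //= (aN2 1) //= ed ek => e3 _ h3; split.
- move=> a a0 ad; have [|-> -> ->] := h3 a; first by lia.
  have /andP[oo0 ood] : 0 < natv e2 17 a <= d * k by apply: rng; lia.
  by split=> //; [exact: entry_row_le|exact: entry_col_le].
- move=> i j i0 ik j0 jd.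
  have [|a ha ea] := onto ((i - 1) * d + j).
    by rewrite mulnC; have := leq_mul2l d i k; rewrite ik orbT mulnBr; nia.
  exists a => //; have [|_ -> ->] := h3 a; first by [].
  by rewrite ea entry_rowE ?entry_colE.
- move=> a b a0 ab bd; have a0' : 0 < a <= d * k by lia.
  have b0' : 0 < b <= d * k by lia.
  have [//|ea ra ca] := h3 a; have [//|eb rb cb] := h3 b.
  have [a1 a2] := andP (rng a a0'); have [b1 b2] := andP (rng b b0').
  rewrite lt_neqAle; apply/andP; split.
    apply/eqP; rewrite ea eb ra rb ca cb => /(Umx_inj k0 kd) [] //;
      try exact: entry_row_le; try exact: entry_col_le.
    move=> e_r e_c; have : natv e2 17 b = natv e2 17 a.
      by rewrite -(entry_index d b1) -(entry_index d a1) e_r e_c.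
    by move/inj => /(_ b0' a0'); lia.
  have := nonincr_le noninc a0 (ltnW ab) bd => /=.
  have [-> _ _ _] := hM _ (rng a a0'); have [-> _ _ _] := hM _ (rng b b0').
  by rewrite ea eb ra rb ca cb.
Qed.

End Phases.

(** * Computing the multiplicities *)

Section Multiplicities.
Variables (R : realType) (d k : nat) (c : nat -> nat).
Variables (V : nat -> R) (r col : nat -> nat).
Hypotheses (k_gt0 : 0 < k) (kd : k <= d).
Hypothesis c_noninc : forall i j, 0 < i -> i <= j -> j <= d -> c j <= c i.
Hypothesis entries : sorted_entries d k c V r col.
Implicit Types e : env R.

(** Closed form of what steps (5)-(7) compute incrementally: the product over the other rows of
    their numbers of candidates, and 0 as long as row 1 has not been met. *)
Definition mult (a : nat) : nat :=
  (0 < reach r 1 a) * \prod_(1 <= i < k.+1 | i != r a) (reach r i a - i.-1).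

Definition rows_met (a : nat) : nat := \sum_(1 <= i < k.+1) (0 < reach r i a).

Lemma rows_met0 : rows_met 0 = 0.
Proof. by rewrite /rows_met big1_seq // => i _; rewrite reach0. Qed.

Lemma rows_metS a : a < d * k ->
  rows_met a.+1 = rows_met a + (reach r (r a.+1) a == 0).
Proof.
move=> ad; have [rng _ _] := entries; have [r0 rk _ _ _] := rng _ (ltn0Sn a) ad.
have rin : r a.+1 \in index_iota 1 k.+1 by rewrite mem_index_iota; lia.
rewrite /rows_met !(bigD1_seq (r a.+1)) ?iota_uniq //= reachS eqxx addn1 ltnS.
rewrite leq0n addnAC; congr (_ + _); last first.
  by apply: eq_bigr => i /negbTE ne; rewrite reachS eq_sym ne addn0.
by case: (reach r _ a).
Qed.

(* Row 1 is the last one to be met, as its first entry is below all diagonal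
   entries. *)
Lemma rows_met_full a : a <= d * k -> (rows_met a == k) = (0 < reach r 1 a).
Proof.
move=> ad; rewrite /rows_met; case: posnP => [r1|r1].
  rewrite big_ltn //= r1 add0n; apply/eqP => e.
  have : \sum_(2 <= i < k.+1) (0 < reach r i a) <= \sum_(2 <= i < k.+1) 1.
    by apply: leq_sum => i _; case: (0 < _).
  by rewrite e sum_nat_const_nat; lia.
rewrite (eq_big_nat _ _ (F2 := fun=> 1)) ?sum_nat_const_nat ?muln1 ?subn1 ?eqxx //.
move=> i /andP[i0 ik]; suff -> : 0 < reach r i a by [].
by apply: leq_trans r1 _; apply: (reach_mono _ _ _ entries).
Qed.

Definition tables e : Prop :=
  [/\ natv e 0 0 = d, natv e 1 0 = k, natv e 18 = r & natv e 19 = col].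

Lemma tables_agree m e e' : agree m e e' ->
  [&& 0 \notin m.1, 1 \notin m.1, 18 \notin m.1 & 19 \notin m.1] ->
  tables e -> tables e'.
Proof.
move=> [aN _] /and4P[m0 m1 m18 m19] [t0 t1 t18 t19].
by rewrite /tables !aN.
Qed.

Lemma reset_counts_wp e : tables e -> wp reset_counts (fun e' =>
  [/\ forall i, 0 < i <= k -> natv e' 20 i = 0, natv e' 21 0 = 0 & natv e' 22 0 = 0]) e.
Proof.
move=> te; apply: wp_seq; apply: (wp_for_all (fun i e' =>
   forall x, 0 < x < i -> natv e' 20 x = 0)) => /=.
- by [].
- by move=> x; lia.
- move=> i e1 hi [aN1 _] h1; apply: wp_seq; apply: wp_store; apply: wp_store => /= x hx.
  by case: eqP => // ne; apply: h1; lia.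
case: te => _ -> _ _ e1 _ h1.
by apply: wp_seq; apply: wp_store; apply: wp_store.
Qed.

(** The subtraction is real: before row 1 is met, a row i may have fewer than i entries in the
    prefix, and its counter is then zero or negative. *)
Definition counts_stored (a : nat) e : Prop := forall i, 0 < i <= k ->
  0 < reach r i a -> realv e 4 i = ((reach r i a)%:R - (i%:R - 1))%R.

Lemma scan_wp A e : tables e ->
  (forall a, a <= d * k -> (0 < reach r 1 a) = (A <= a)) -> 0 < A <= d * k ->
  (forall i, 0 < i <= k -> natv e 20 i = 0) -> natv e 21 0 = 0 -> natv e 22 0 = 0 ->
  wp scan_until_all_rows (fun e' =>
    [/\ natv e' 23 0 = A, natv e' 22 0 = A.-1, counts_stored A e'
      & forall a, 0 < a < A -> realv e' 6 a = 0%R]) e.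
Proof.
move=> te hA /andP[A0 Ad] e20 e21 e22; have [rng _ _] := entries.
(* Before pass a > 1 the variable [a_] still holds a.-1. [b_] follows it up to A.-1 and stays there,
   since pass A completes the set of rows. *)
apply: (wp_for (fun a e' =>
  [/\ a <= A.+1 /\ (1 < a -> natv e' 23 0 = a.-1),
      forall i, 0 < i <= k -> natv e' 20 i = (0 < reach r i a.-1),
      natv e' 21 0 = rows_met a.-1 /\ natv e' 22 0 = (minn a A).-1,
      counts_stored a.-1 e'
    & forall a', 0 < a' < a -> a' < A -> realv e' 6 a' = 0%R])) => /=.
- by [].
- split=> //=.
  + by move=> i hi; rewrite e20 // reach0.
  + by rewrite rows_met0 e22; split=> //; lia.
  + by move=> i _; rewrite reach0.
  + by move=> a' ; lia.
- move=> a e1 ha ag1 [[aA _] hin [hcard hb] hcnt hm] hg.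
  have te1 : tables e1 by exact: tables_agree ag1 _ te.
  have [t0 t1 t18 t19] := te1; have [u0 u1 _ _] := te.
  rewrite u0 u1 in ha; have [a0 ad] := andP ha.
  have aP : a = a.-1.+1 by rewrite prednK.
  (* As the guard still holds, some row is missing after a.-1 entries, so a.-1 < A. *)
  have {}aA : a <= A.
    move: hg; rewrite t1 hcard; case: eqP => // ne _.
    rewrite leqNgt; apply/negP => lt; apply: ne; apply/eqP.
    by rewrite rows_met_full ?hA; lia.
  have [r0 rk c0 cd' _] := rng a a0 ad.
  have rS i : reach r i a = reach r i a.-1 + (r a == i).
    by rewrite {1}aP reachS -aP.
  have mS : rows_met a = rows_met a.-1 + (reach r (r a) a.-1 == 0).
    by rewrite {1}aP rows_metS -?aP.
  have mA : (rows_met a == k) = (A <= a) by rewrite rows_met_full // hA.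
  apply: wp_seq; apply: wp_store => /=; rewrite t18 t19; apply: wp_seq.
  pose mid e' := [/\ tables e', natv e' 23 0 = a /\ natv e' 22 0 = (minn a A).-1,
    forall i, 0 < i <= k -> natv e' 20 i = (0 < reach r i a),
    natv e' 21 0 = rows_met a & counts_stored a e' /\
    forall a', 0 < a' < a -> a' < A -> realv e' 6 a' = 0%R].
  have cnt n1 : counts_stored a
      (Env n1 (upd (realv e1) 4 (r a) ((col a)%:R - ((r a)%:R - 1))%R)).
    move=> i hi hr /=; case: eqP => [->|ne].
      by rewrite (reach_col k_gt0 kd c_noninc entries).
    by move: hr; rewrite !rS (_ : (r a == i) = false) ?addn0; [exact: hcnt|lia].
  apply: (@wp_impl _ _ mid) => [e2 [te2 [e2a e2b] e2n e2c [e2cnt e2m]]|].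
    apply: wp_cond => /=; have [_ v1 _ _] := te2; rewrite v1 e2c mA.
      move=> h; have lt : a < A by move: h; rewrite ltnNge; case: (A <= a).
      apply: wp_seq; apply: wp_store; apply: wp_store => /=; rewrite e2a.
      split=> //=.
      + by split=> //; rewrite (minn_idPl lt).
      + by move=> a' h1 h2; case: eqP => // ne; apply: e2m; lia.
    move=> h; have le : A <= a by move: h; case: (A <= a).
    apply: wp_skip; split=> //=.
    + by split=> //; rewrite e2b (minn_idPr le) (minn_idPr (leqW le)).
    + by move=> a' h1 h2; apply: e2m => //; lia.
  apply: wp_cond => /=; rewrite t18 hin ?r0 // => h.
    have hz : reach r (r a) a.-1 = 0 by move: h; case: posnP.
    apply: wp_seq; apply: wp_store; apply: wp_store => /=.
    split=> //=.
    + move=> i hi; rewrite t18; case: eqP => [->|ne]; first by rewrite rS eqxx addn1.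
      by rewrite hin // rS (_ : (r a == i) = false) ?addn0; lia.
    + by rewrite hcard mS hz.
  have hz : 0 < reach r (r a) a.-1 by move: h; case: posnP.
  apply: wp_skip; split=> //=.
  + move=> i hi; rewrite hin // rS; case: eqP => [<-|_]; last by rewrite addn0.
    by rewrite hz addn1.
  + by rewrite hcard mS; case: posnP hz => //; rewrite addn0.
move=> a e1 ha ag1 [[aA ea] hin [hcard hb] hcnt hm] hx.
have [_ t1 _ _] : tables e1 by exact: tables_agree ag1 _ te.
have [u0 u1 _ _] := te; rewrite u0 u1 in ha hx.
(* An exhausted loop has a beyond d * k and hence beyond A; otherwise the failed guard gives A <=
   a.-1. *)
have aE : a = A.+1.
  suff : A < a by lia.
  case: hx => [|/eqP]; first by lia.
  rewrite t1 hcard; case: eqP => // /eqP; rewrite rows_met_full ?hA; lia.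
split.
- by rewrite ea aE //; lia.
- by rewrite hb aE; lia.
- by rewrite aE in hcnt.
- by move=> a' ha'; apply: hm; lia.
Qed.

Lemma prodD1 (F : nat -> R) i : 0 < i <= k ->
  (\prod_(1 <= j < k.+1) F j = F i * \prod_(1 <= j < k.+1 | j != i) F j)%R.
Proof. by move=> hi; rewrite (bigD1_seq i) ?iota_uniq // mem_index_iota. Qed.

(** From A on the counters are positive integers, so truncated and real subtraction agree and
    division by a counter is legitimate. *)
Lemma reach_real A a i : A <= a -> a <= d * k ->
  (forall a, a <= d * k -> (0 < reach r 1 a) = (A <= a)) -> 0 < i <= k ->
  i <= reach r i a /\ ((reach r i a)%:R - (i%:R - 1) = (reach r i a - i.-1)%:R :> R)%R.
Proof.
move=> Aa ad hA /andP[i0 ik].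
have le : i <= reach r i a.
  by apply: (reach_ge k_gt0 kd c_noninc entries ad) => //; rewrite hA.
by split=> //; rewrite natrB -?subn1 ?natrB //; lia.
Qed.

Lemma first_multiplicity_wp A e : tables e ->
  (forall a, a <= d * k -> (0 < reach r 1 a) = (A <= a)) -> 0 < A <= d * k ->
  natv e 23 0 = A -> natv e 22 0 = A.-1 -> counts_stored A e ->
  (forall a, 0 < a < A -> realv e 6 a = 0%R) ->
  wp first_multiplicity (fun e' =>
    realv e' 5 0 = (\prod_(1 <= i < k.+1) (reach r i A - i.-1)%:R)%R /\
    forall a, 0 < a <= A -> realv e' 6 a = (mult a)%:R%R) e.
Proof.
move=> te hA /andP[A0 Ad] eA eb hc hm; have [t0 t1 t18 t19] := te.
have [rng _ _] := entries; have [r0 rk c0 cd' _] := rng A A0 Ad.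
apply: wp_seq; apply: wp_store => /=; apply: wp_seq.
apply: (wp_for_all (fun i e' =>
  realv e' 5 0 = (\prod_(1 <= j < i) (reach r j A - j.-1)%:R)%R)) => /=.
- by [].
- by rewrite big_geq.
- rewrite t1 => i e1 hi [aN1 aR1] h1; apply: wp_store => /=.
  rewrite (aR1 4) //= h1 hc // ?hA //; last by have [] := reach_real (leqnn A) Ad hA hi; lia.
  by have [_ ->] := reach_real (leqnn A) Ad hA hi; rewrite big_nat_recr //=; lia.
rewrite t1 => e1 [aN1 aR1] h1; apply: wp_store => /=; split=> // a ha.
rewrite (aN1 18) // (aN1 22) // (aN1 23) //= (aR1 4) // (aR1 6) //= eA eb t18 h1.
rewrite addn1 prednK //.
have [->|ne] := eqVneq a A; last first.
  by rewrite hm /mult ?hA //; [case: leqP => //; lia|lia|lia].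
have hr : 0 < r A <= k by rewrite r0.
have [le eq] := reach_real (leqnn A) Ad hA hr.
rewrite hc // ?eq; last by lia.
rewrite (prodD1 _ hr) /mult hA // leqnn mul1n natr_prod.
by rewrite mulrC mulrA mulVf ?mul1r // pnatr_eq0; lia.
Qed.

(** From a.-1 to a, [reach] changes only in row [r a]. So the product over all rows at a.-1 becomes
    [mult a] after division by the counter of that row, and the product at a after multiplication by
    the incremented counter. *)
Lemma other_multiplicities_wp A e : tables e ->
  (forall a, a <= d * k -> (0 < reach r 1 a) = (A <= a)) -> 0 < A <= d * k ->
  natv e 22 0 = A.-1 -> counts_stored A e ->
  realv e 5 0 = (\prod_(1 <= i < k.+1) (reach r i A - i.-1)%:R)%R ->
  (forall a, 0 < a <= A -> realv e 6 a = (mult a)%:R%R) ->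
  wp other_multiplicities (fun e' =>
    forall a, 0 < a <= d * k -> realv e' 6 a = (mult a)%:R%R) e.
Proof.
move=> te hA /andP[A0 Ad] eb hc ep hm; have [t0 t1 t18 t19] := te.
have [rng _ _] := entries.
apply: (wp_for_all (fun a e' =>
  [/\ realv e' 5 0 = (\prod_(1 <= i < k.+1) (reach r i a.-1 - i.-1)%:R)%R,
      counts_stored a.-1 e'
    & forall a', 0 < a' < a -> realv e' 6 a' = (mult a')%:R%R])) => /=.
- by rewrite eb t0 t1; lia.
- rewrite eb (_ : (A.-1 + 2).-1 = A) ?ep; last by lia.
  by split=> // a' ha'; apply: hm; lia.
- rewrite eb t0 t1 => a e1 ha ag1 [h5 hcnt h6].
  have te1 : tables e1 by exact: tables_agree ag1 _ te.
  have [u0 u1 u18 u19] := te1.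
  have a0 : 0 < a by lia.
  have ad : a <= d * k by lia.
  have aP : a = a.-1.+1 by rewrite prednK.
  have [r0 rk c0 cd' _] := rng a a0 ad; have hr : 0 < r a <= k by rewrite r0.
  have rS i : reach r i a = reach r i a.-1 + (r a == i).
    by rewrite {1}aP reachS -aP.
  have hr' i := @reach_real A a.-1 i; have Aa : A <= a.-1 by lia.
  have ad' : a.-1 <= d * k by lia.
  have [le eq] := hr' _ Aa ad' hA hr.
  have n_r : realv e1 4 (r a) = (reach r (r a) a.-1 - (r a).-1)%:R%R.
    by rewrite hcnt //; lia.
  have P : (realv e1 5 0 / realv e1 4 (r a) =
      \prod_(1 <= i < k.+1 | i != r a) (reach r i a - i.-1)%:R :> R)%R.
    rewrite h5 (prodD1 _ hr) n_r mulrC mulrA mulVf ?mul1r; last first.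
      by rewrite pnatr_eq0; lia.
    by apply: eq_bigr => i ne; rewrite rS eq_sym (negbTE ne) addn0.
  do 3 (apply: wp_seq; apply: wp_store); apply: wp_store => /=.
  rewrite u18 P eqxx n_r; split=> /=.
  + rewrite (prodD1 _ hr) mulrC; congr (_ * _)%R.
    by rewrite rS eqxx -addnBAC ?natrD //; lia.
  + move=> i hi hi0 /=; case: eqP => [->|ne].
      rewrite rS eqxx -eq addn1 -natr1; ring.
    by move: hi0; rewrite rS (_ : (r a == i) = false) ?addn0; [exact: hcnt|lia].
  + move=> a' ha'; case: eqP => [->|ne]; last by apply: h6; lia.
    by rewrite /mult hA // (_ : A <= a) ?mul1n ?natr_prod //; lia.
rewrite t0 t1 => e1 _ [_ _ h] a ha; apply: h; lia.
Qed.

End Multiplicities.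

(** * Completing the chosen entry to a sequence *)

Definition find_threshold : cmd :=
  FOR j_ FROM 1 TO d_ DO
    IF V_$[sel_] <= U_$[Uidx] THEN t_ ::= j_ FI
  OD%prog.

Definition fill_pool : cmd :=
  FOR j_ FROM 1 TO t_ DO
    IF ~~ used_$[j_] THEN
      npool_ ::= npool_ + 1 ;; pool_$[npool_] ::= j_
    FI
  OD%prog.

Definition draw_row : cmd :=
  t_ ::= 0 ;; find_threshold ;; npool_ ::= 0 ;; fill_pool ;;
  DrawNat z_ npool_ ;; s_$[i_] ::= pool_$[z_] ;; used_$[pool_$[z_]] ::= 1.

Definition complete_row : cmd :=
  IF ~~ (i_ == i0_) THEN draw_row FI.

Definition complete_init : cmd :=
  i0_ ::= r_$[sel_] ;;
  j0_ ::= col_$[sel_] ;;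
  FOR j_ FROM 1 TO d_ DO used_$[j_] ::= 0 OD ;;
  s_$[i0_] ::= j0_ ;;
  used_$[j0_] ::= 1.

Section Completion.
Variables (R : realType) (d k : nat) (c : nat -> nat).
Variables (V : nat -> R) (r col : nat -> nat).
Hypotheses (k_gt0 : 0 < k) (kd : k <= d).
Hypothesis c_noninc : forall i j, 0 < i -> i <= j -> j <= d -> c j <= c i.
Hypothesis entries : sorted_entries d k c V r col.
Variable a : nat.
Hypothesis a_rng : 0 < a <= d * k.
Implicit Types e : env R.

Definition matrix_tables e : Prop :=
  [/\ tables d k r col e, realv e 3 = V, natv e 24 0 = a &
    forall i j, 0 < i -> i <= k -> 0 < j -> j <= d ->
      realv e 2 ((i - 1) * d + j) = Umx R d k c i j].

Lemma matrix_tables_agree m e e' : agree m e e' ->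
  [&& 0 \notin m.1, 1 \notin m.1, 18 \notin m.1, 19 \notin m.1 & 24 \notin m.1] ->
  (2 \notin m.2) && (3 \notin m.2) ->
  matrix_tables e -> matrix_tables e'.
Proof.
move=> ag /and5P[m0 m1 m18 m19 m24] /andP[m2 m3] [te tV ta tU].
have [aN aR] := ag; split.
- by apply: tables_agree ag _ te; rewrite m0 m1 m18 m19.
- by rewrite aR.
- by rewrite aN.
- by move=> i j *; rewrite aR // tU.
Qed.

Definition filled (i : nat) : seq nat :=
  [seq x <- iota 1 k | (x < i) || (x == r a)].

Lemma mem_filled i x : (x \in filled i) = (0 < x <= k) && ((x < i) || (x == r a)).
Proof. by rewrite mem_filter mem_iota andbC add1n ltnS. Qed.

Definition partial_output (i : nat) e : Prop :=
  [/\ matrix_tables e, natv e 25 0 = r a,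
      natv e 3 (r a) = col a /\
      (forall x, 0 < x < i -> x <= k -> 0 < natv e 3 x <= reach r x a),
      {in filled i &, injective (natv e 3)}
    & forall x, 0 < x <= d ->
        natv e 27 x = (x \in [seq natv e 3 y | y <- filled i])].

Let a0 : 0 < a. Proof. by case/andP: a_rng. Qed.
Let ad : a <= d * k. Proof. by case/andP: a_rng. Qed.

Let ra_rng : 0 < r a <= k.
Proof. by have [rng _ _] := entries; have [-> ->] := rng a a0 ad. Qed.

Let col_rng : 0 < col a <= d.
Proof. by have [rng _ _] := entries; have [_ _ -> ->] := rng a a0 ad. Qed.

Lemma complete_init_wp e : matrix_tables e -> wp complete_init (partial_output 1) e.
Proof.
move=> te; have [[t0 t1 t18 t19] tV ta tU] := te.
apply: wp_frame; apply: wp_seq; apply: wp_store; apply: wp_seq; apply: wp_store => /=.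
rewrite ta t18 t19; apply: wp_seq.
apply: (wp_for_all (fun j e' => forall x, 0 < x < j -> natv e' 27 x = 0)) => /=.
- by [].
- by move=> x; lia.
- move=> j e' hj _ h; apply: wp_store => /= x hx; case: eqP => // ne; apply: h; lia.
rewrite t0 => e' [aN _] h; apply: wp_seq; apply: wp_store; apply: wp_store => /=.
move=> ag; rewrite (aN 25) //= (aN 26) //=; split=> /=.
- exact: matrix_tables_agree ag _ _ te.
- by rewrite aN.
- by rewrite eqxx; split=> // x; lia.
- by move=> x y; rewrite !mem_filled => hx hy _; lia.
move=> x hx.
have -> : filled 1 = [:: r a].
  rewrite /filled (eq_in_filter (a2 := pred1 (r a))) => [|y].
    by rewrite filter_pred1_uniq ?iota_uniq // mem_iota add1n ltnS.
  by rewrite mem_iota /=; lia.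
by rewrite /= eqxx inE; case: eqP => // _; apply: h; lia.
Qed.

(** By [V_le_Umx] the test succeeds exactly for the columns up to [reach r i a], so its last success
    is the threshold. *)
Lemma find_threshold_wp i e : matrix_tables e -> natv e 32 0 = i -> 0 < i <= k ->
  natv e 28 0 = 0 -> wp find_threshold (fun e' => natv e' 28 0 = reach r i a) e.
Proof.
move=> te ei hi et; have [[t0 t1 t18 t19] tV ta tU] := te.
apply: (wp_for_all (fun j e' => natv e' 28 0 = minn j.-1 (reach r i a))) => /=.
- by [].
- by rewrite et min0n.
- rewrite t0 => j e' hj ag h; have [aN aR] := ag; apply: wp_cond => /=.
    rewrite !(aN 32) // !(aN 24) // !(aN 0) // ta ei t0 !aR // tV.
    rewrite tU ?(V_le_Umx k_gt0 kd c_noninc entries); try lia.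
    by case: leqP => // le _; apply: wp_store.
  rewrite !(aN 32) // !(aN 24) // !(aN 0) // ta ei t0 !aR // tV.
  rewrite tU ?(V_le_Umx k_gt0 kd c_noninc entries); try lia.
  case: leqP => // le _; apply: wp_skip => /=.
  by rewrite h; lia.
rewrite t0 => e' _ -> /=; apply/minn_idPr.
exact: (reach_le_d k_gt0 kd c_noninc entries).
Qed.

Lemma fill_pool_wp t e : natv e 28 0 = t -> natv e 30 0 = 0 ->
  let L := [seq x <- iota 1 t | natv e 27 x == 0] in
  wp fill_pool (fun e' => natv e' 30 0 = size L /\
    seg (natv e' 29) 1 (size L).+1 = L) e.
Proof.
move=> et en L.
pose Lj j := [seq x <- iota 1 j | natv e 27 x == 0].
apply: (wp_for_all (fun j e' => natv e' 30 0 = size (Lj j.-1) /\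
    seg (natv e' 29) 1 (size (Lj j.-1)).+1 = Lj j.-1)) => /=.
- by [].
- by rewrite en.
- move=> j e' hj [aN _] [h1 h2]; have [j0 _] := andP hj.
  have LjE : Lj j = Lj j.-1 ++ (if natv e 27 j == 0 then [:: j] else [::]).
    rewrite /Lj {1}(_ : j = j.-1 + 1) ?iotaD ?filter_cat; last by lia.
    by rewrite add1n prednK //=; case: eqP.
  apply: wp_cond => /=; rewrite aN // => h; last first.
    by apply: wp_skip; rewrite /= LjE; case: (natv e 27 j) h => // *; rewrite cats0.
  have u0 : natv e 27 j = 0 by case: (natv e 27 j) h.
  apply: wp_seq; apply: wp_store; apply: wp_store => /=.
  rewrite LjE u0 eqxx size_cat /= h1 !addn1; split=> //.
  rewrite seg_recr // eqxx -cats1; congr (_ ++ _); rewrite -[RHS]h2.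
  by apply: eq_seg => p hp; rewrite ltn_eqF //; lia.
by rewrite et => e' _.
Qed.

(* If row [r a] comes after row [i], then [col a] exceeds [reach r i a] and does
   not reduce the pool; otherwise it is among the items of the [i.-1] rows before. *)
Lemma pool_elements i e : partial_output i e -> 0 < i <= k -> i != r a ->
  let L := [seq x <- iota 1 (reach r i a) | natv e 27 x == 0] in
  [/\ size L = reach r i a - i.-1, uniq L &
    forall x, (x \in L) = (0 < x <= reach r i a) &&
      (x \notin [seq natv e 3 y | y <- filled i])].
Proof.
move=> [_ _ [ec es] inj eu] hi ne L; have [i0 ik] := andP hi.
have rd : reach r i a <= d by exact: (reach_le_d k_gt0 kd c_noninc entries).
have memL x : (x \in L) = (0 < x <= reach r i a) &&
      (x \notin [seq natv e 3 y | y <- filled i]).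
  rewrite mem_filter mem_iota andbC add1n ltnS; case: (boolP (0 < x <= _)) => //= hx.
  by rewrite eu ?eqb0; [|lia].
split=> //; last by rewrite filter_uniq // iota_uniq.
(* The items of the rows before i are i.-1 distinct elements of [reach r i a], by [reach_mono]. The
   pool is their complement there, wherever row [r a] lies. *)
pose M := [seq natv e 3 y | y <- iota 1 i.-1].
have sub y : y \in iota 1 i.-1 -> y \in filled i.
  by rewrite mem_iota mem_filled; lia.
have uM : uniq M.
  by rewrite map_inj_in_uniq ?iota_uniq // => x y /sub hx /sub hy; exact: inj.
have Mr x : x \in M -> 0 < x <= reach r i a.
  case/mapP => y; rewrite mem_iota => hy ->.
  have /andP[-> yr] : 0 < natv e 3 y <= reach r y a by apply: es; lia.
  apply: leq_trans yr _; apply: (reach_mono k_gt0 kd c_noninc entries) => //; lia.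
have -> : L = [seq x <- iota 1 (reach r i a) | x \notin M].
  apply: eq_in_filter => x; rewrite mem_iota => hx.
  rewrite eu ?eqb0; last by lia.
  congr (~~ _); apply/mapP/mapP => -[y hy xE]; last by exists y => //; exact: sub.
  move: hy; rewrite mem_filled => /andP[hy /orP[yi|/eqP yr]].
    by exists y => //; rewrite mem_iota; lia.
  exists y => //; rewrite mem_iota yr.
  suff : r a < i by have := ra_rng; lia.
  rewrite ltnNge leq_eqVlt (negbTE ne) /=; apply/negP => lt.
  have := reach_lt_col k_gt0 kd c_noninc entries a0 ad i0 lt.
  by move: hx; rewrite xE yr ec; lia.
have /perm_size eM : perm_eq [seq x <- iota 1 (reach r i a) | x \in M] M.
  apply: uniq_perm => // [|x]; first by rewrite filter_uniq // iota_uniq.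
  rewrite mem_filter mem_iota andbC; case: (boolP (x \in M)); last by rewrite andbF.
  by move=> /Mr; rewrite add1n ltnS => ->.
have := count_predC (mem M) (iota 1 (reach r i a)).
rewrite -!size_filter eM size_map !size_iota => e1.
by rewrite -[X in X - _]e1 addKn.
Qed.

Let row_test i e : natv e 32 0 = i -> natv e 25 0 = r a ->
  veval e (~~ (i_ == i0_))%prog = (i != r a) :> nat.
Proof. by move=> /= -> ->; case: (i == r a). Qed.

Lemma complete_row_skip i (st : state R) : i = r a ->
  natv (view st) 32 0 = i -> partial_output i (view st) ->
  exists2 st1, exec complete_row st = Ret R st1 &
    partial_output i.+1 (view st1) /\ natv (view st1) 3 = natv (view st) 3.
Proof.
move=> ir ei po; have [te e25 [ec es] inj eu] := po.
exists (tick 1 (tick (cost (~~ (i_ == i0_))%prog).+1 st)).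
  by rewrite /complete_row exec_cond (row_test ei e25) ir eqxx.
split=> //.
have fE : filled i.+1 =i filled i.
  move=> x; rewrite !mem_filled -ir ltnS (leq_eqVlt x i).
  by case: (x == i); rewrite ?orbT ?orbF.
split=> //.
- split=> // x hx xk; have [xi|xi] := ltnP x i; first by apply: es; lia.
  have -> : x = r a by lia.
  by rewrite ec (reach_col k_gt0 kd c_noninc entries) // leqnn; case/andP: col_rng => ->.
- by move=> x y; rewrite !fE; exact: inj.
- move=> x hx; rewrite eu //; congr nat_of_bool.
  by apply/mapP/mapP => -[y hy ->]; exists y => //; rewrite ?fE // -fE.
Qed.

Definition record_draw : cmd :=
  (s_$[i_] ::= pool_$[z_] ;; used_$[pool_$[z_]] ::= 1)%prog.

Lemma record_draw_wp i e e4 v z : 0 < i <= k -> i != r a ->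
  partial_output i e -> natv e 32 0 = i ->
  agree ([:: 28; 33; 30; 29], [::]) e e4 -> 0 < v <= reach r i a ->
  v \notin [seq natv e 3 y | y <- filled i] -> natv e4 29 z = v ->
  wp record_draw (fun e' => partial_output i.+1 e' /\
      natv e' 3 = fun x => if x == i then v else natv e 3 x)
    (put z_ 0 (z : value R TNat) e4).
Proof.
move=> hi ne [te e25 [ec es] inj eu] ei agr vr vn pz; have [aN aR] := agr.
have [i0 ik] := andP hi.
apply: wp_seq; apply: wp_store; apply: wp_store => /=.
rewrite /partial_output /= !(aN 32) // ei pz !(aN 3) // (aN 27) //.
have rd : reach r i a <= d by exact: (reach_le_d k_gt0 kd c_noninc entries).
have iF : i \notin filled i by rewrite mem_filled ltnn (negbTE ne) andbF.
have fE x : (x \in filled i.+1) = (x == i) || (x \in filled i).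
  rewrite !mem_filled ltnS (leq_eqVlt x i); case: (x =P i) => [->|_] //=.
  by rewrite hi.
have upE x : x \in filled i -> (if x == i then v else natv e 3 x) = natv e 3 x.
  by move=> hx; case: eqP => // xi; case/negP: iF; rewrite -[X in X \in _]xi.
split=> //; split=> /=.
- apply: matrix_tables_agree agr _ _ te => //.
- by rewrite aN.
- rewrite eq_sym (negbTE ne); split=> // x hx xk; case: eqP => [->|nx] //.
  by apply: es => //; lia.
- move=> x y; rewrite !fE => /orP[/eqP->|hx] /orP[/eqP->|hy] //; rewrite ?eqxx ?upE //.
  + by move=> e1; case/negP: vn; rewrite e1 map_f.
  + by move=> e1; case/negP: vn; rewrite -e1 map_f.
  + exact: inj.
move=> x hx; case: (x =P v) => [->|nx].
  by rewrite (_ : _ \in _) //; apply/mapP; exists i; rewrite ?fE eqxx.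
rewrite eu //; congr nat_of_bool; apply/mapP/mapP => -[y hy xE]; exists y.
- by rewrite fE hy orbT.
- by rewrite upE.
- by move: hy; rewrite fE; case: eqP xE => [-> //|//]; rewrite eqxx => /nx.
- by move: hy; rewrite fE xE; case: eqP xE => // -> ; rewrite ?eqxx => /nx.
Qed.

(** Apart from its draw the row is deterministic, so its tree is one uniform node with leaves [f z].
    L lists the pool, and outcome z selects its z-th element. *)
Lemma complete_row_draw i (st : state R) : 0 < i <= k -> i != r a ->
  natv (view st) 32 0 = i -> partial_output i (view st) ->
  exists (L : seq nat) (f : nat -> state R),
  [/\ exec complete_row st = UNat (size L) (fun z => Ret R (f z)),
      size L = reach r i a - i.-1, uniq L,
      forall x, (x \in L) = (0 < x <= reach r i a) &&
        (x \notin [seq natv (view st) 3 y | y <- filled i])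
    & forall z, 0 < z <= size L -> partial_output i.+1 (view (f z)) /\
        natv (view (f z)) 3 =
        fun x => if x == i then nth 0 L z.-1 else natv (view st) 3 x].
Proof.
move=> hi ne ei po; have [te e25 [ec es] inj eu] := po.
have [i0 ik] := andP hi.
have [] := pool_elements po hi ne.
set L := [seq _ <- _ | _] => sL uL memL.
pose st0 := tick (cost (~~ (i_ == i0_))%prog).+1 st.
have v0 : view st0 = view st by [].
have -> : exec complete_row st = exec draw_row st0.
  by rewrite /complete_row exec_cond (row_test ei e25) ne.
rewrite /draw_row.
have [|st1 -> [h1 ag1]] := @seq_det R (t_ ::= 0)%prog (fun e' => natv e' 28 0 = 0) st0 isT.
  exact: wp_store.
have te1 : matrix_tables (view st1) by exact: matrix_tables_agree ag1 _ _ te.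
have ei1 : natv (view st1) 32 0 = i by rewrite (ag1.1 32) // v0.
have [st2 -> [h2 ag2]] := @seq_det R find_threshold _ st1 isT
    (find_threshold_wp te1 ei1 hi h1).
have [|st3 -> [[h3 h3'] ag3]] := @seq_det R (npool_ ::= 0)%prog
    (fun e' => natv e' 30 0 = 0 /\ natv e' 28 0 = reach r i a) st2 isT.
  by apply: wp_store.
have [st4 -> [[h4 h4'] ag4]] := @seq_det R fill_pool _ st3 isT
  (fill_pool_wp h3' h3).
have agr : agree ([:: 28; 33; 30; 29], [::]) (view st) (view st4).
  apply: agree_trans (agree_sub _ _ ag1) _; [|by []|].
    by move=> x; rewrite /= !inE => ->.
  apply: agree_trans (agree_sub _ _ ag2) _; [|by []|].
    by move=> x; rewrite /= !inE => /orP[->|->]; rewrite ?orbT.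
  apply: agree_trans (agree_sub _ _ ag3) (agree_sub _ _ ag4); [|by []| |by []].
    by move=> x; rewrite /= !inE => ->; rewrite ?orbT.
  by move=> x; rewrite /= !inE => /or3P[] ->; rewrite ?orbT.
have u3 : natv (view st3) 27 = natv (view st) 27.
  by rewrite (ag3.1 27) // (ag2.1 27) // (ag1.1 27).
rewrite u3 -/L in h4 h4'.
pose st5 z := tick (cost npool_).+1 (store z_ 0 (z : value R TNat) st4).
(* The fallback [st4] never occurs, [record_draw] being draw-free. *)
pose f z := match exec record_draw (st5 z) with Ret st' => st' | _ => st4 end.
exists L, f; split=> //.
  rewrite exec_draw_nat (_ : veval (view st4) npool_ = size L :> nat); last first.
    by move: (view st4) h4.
  by [].
move=> z hz.
pose Q e' := partial_output i.+1 e' /\ natv e' 3 =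
    fun x => if x == i then nth 0 L z.-1 else natv (view st) 3 x.
have [st6 E6 ?] : exists2 st6, exec record_draw (st5 z) = Ret R st6 & Q (view st6); last first.
  by rewrite /f E6.
apply: wp_exec => //.
have v5 : view (st5 z) = put z_ 0 (z : value R TNat) (view st4) by rewrite -view_store.
rewrite v5; have vL : nth 0 L z.-1 \in L by apply: mem_nth; case: (z) hz.
move: (vL); rewrite memL => /andP[v_le v_new].
apply: (record_draw_wp hi ne po ei agr v_le v_new).
rewrite -[in RHS]h4' (nth_map 0) ?size_iota ?nth_iota; try lia.
by congr natv; lia.
Qed.

End Completion.

(** * The law of the completed sequence *)

Section Target.
Variables (d k : nat).

Definition target (S : k.-tuple 'I_d) (i : nat) : nat :=
  nth 0 [seq (x : nat).+1 | x : 'I_d <- S] i.-1.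

Lemma targetE (S : k.-tuple 'I_d) (i : 'I_k) : target S i.+1 = (tnth S i).+1.
Proof. by rewrite /target (nth_map (tnth S i)) ?size_tuple /= -?tnth_nth. Qed.

Lemma target_rng (S : k.-tuple 'I_d) i : 0 < i <= k -> 0 < target S i <= d.
Proof.
case: i => // i /= ik; have := targetE S (Ordinal ik); rewrite /= => ->.
by rewrite /= ltn_ord.
Qed.

Lemma target_inj (S : k.-tuple 'I_d) : uniq S <->
  (forall x y, 0 < x <= k -> 0 < y <= k -> target S x = target S y -> x = y).
Proof.
have sz : size [seq (x : nat).+1 | x : 'I_d <- S] = k by rewrite size_map size_tuple.
have <- : uniq [seq (x : nat).+1 | x : 'I_d <- S] = uniq S.
  by rewrite map_inj_uniq // => x y [] /val_inj.
split=> [/(uniqP 0) h x y hx hy e|h].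
  have : x.-1 = y.-1 by apply: h => //; rewrite inE sz; lia.
  by lia.
apply/(uniqP 0) => x y; rewrite !inE sz => hx hy e.
by have := h x.+1 y.+1 hx hy e => -[].
Qed.

Lemma outputsE (R : realType) (S : k.-tuple 'I_d) (st : state R) :
  outputs S st = all (fun i => natv (view st) 3 i == target S i) (iota 1 k).
Proof.
apply/forallP/allP => /= h i.
  rewrite mem_iota add1n ltnS => hi; case: i hi => // i /= ik.
  by have := h (Ordinal ik); rewrite -targetE /= lookup_view.
by rewrite -targetE lookup_view; apply: h; rewrite mem_iota add1n ltnS; exact: ltn_ord.
Qed.

End Target.

Section OutputLaw.
Variables (R : realType) (d k : nat) (c : nat -> nat).
Variables (V : nat -> R) (r col : nat -> nat).
Hypotheses (k_gt0 : 0 < k) (kd : k <= d).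
Hypothesis c_noninc : forall i j, 0 < i -> i <= j -> j <= d -> c j <= c i.
Hypothesis entries : sorted_entries d k c V r col.
Variable a : nat.
Hypothesis a_rng : 0 < a <= d * k.
Hypothesis a_full : 0 < reach r 1 a.
Implicit Types (e : env R) (S : k.-tuple 'I_d) (st : state R).

(** S is still possible before row i. Multiplied by [row_weight i], this is the conditional
    probability of the output S. *)
Definition extends (i : nat) e S : bool :=
  [&& `[< compatible k r col a (target S) >], uniq S
    & all (fun x => natv e 3 x == target S x) (filled k r a i)].

(** The probability that each remaining draw takes one prescribed candidate, the pool sizes being
    those of [pool_elements]. *)
Definition row_weight (i : nat) : R :=
  (\prod_(i <= x < k.+1 | x != r a) ((reach r x a - x.-1)%:R)^-1)%R.

Let a0 : 0 < a. Proof. by case/andP: a_rng. Qed.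
Let ad : a <= d * k. Proof. by case/andP: a_rng. Qed.

Let ra_rng : 0 < r a <= k.
Proof. by have [rng _ _] := entries; have [-> ->] := rng a a0 ad. Qed.

(** Once all rows are filled, the invariant makes the output distinct and compatible, so agreement
    with S alone decides. *)
Lemma extends_end st S : partial_output d k c V r col a k.+1 (view st) ->
  extends k.+1 (view st) S = outputs S st.
Proof.
move=> [te e25 [ec es] inj eu]; rewrite outputsE /extends.
have fE x : (x \in filled k r a k.+1) = (0 < x <= k).
  by rewrite mem_filled ltnS; case: (0 < x <= k) / andP => // -[_ ->].
have -> : all (fun x => natv (view st) 3 x == target S x) (filled k r a k.+1) =
          all (fun x => natv (view st) 3 x == target S x) (iota 1 k).
  by apply: eq_all_r => x; rewrite fE mem_iota add1n ltnS.
case: allP; rewrite ?andbF // => h.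
have hE x : 0 < x <= k -> natv (view st) 3 x = target S x.
  by move=> hx; apply/eqP/h; rewrite mem_iota add1n ltnS.
rewrite andbT; apply/andP; split; last first.
  by apply/target_inj => x y hx hy; rewrite -!hE //; apply: inj; rewrite fE.
apply/asboolP; split; first by rewrite -hE.
by move=> x hx; rewrite -hE //; apply: es; lia.
Qed.

Lemma exists_unique_output st : partial_output d k c V r col a k.+1 (view st) ->
  (\sum_(S : k.-tuple 'I_d) (outputs S st)%:R = 1 :> R)%R.
Proof.
move=> [te e25 [ec es] inj eu].
have lt (i : 'I_k) : (natv (view st) 3 i.+1).-1 < d.
  have /andP[h1 h2] : 0 < natv (view st) 3 i.+1 <= reach r i.+1 a.
    by apply: es; have := ltn_ord i; lia.
  have := reach_le_d k_gt0 kd c_noninc entries i.+1 ad.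
  by lia.
pose S0 : k.-tuple 'I_d := [tuple Ordinal (lt i) | i < k].
have outE S : outputs S st = (S == S0).
  have pos (i : 'I_k) : 0 < natv (view st) 3 i.+1.
    by have /andP[] : 0 < natv (view st) 3 i.+1 <= reach r i.+1 a
      by apply: es; have := ltn_ord i; lia.
  apply/forallP/eqP => [h|->] /=; last first.
    by move=> i; rewrite lookup_view tnth_mktuple /= prednK ?pos.
  apply: eq_from_tnth => i; rewrite tnth_mktuple; apply: val_inj => /=.
  by have /eqP := h i; rewrite lookup_view => /= ->.
rewrite (bigD1 S0) //= outE eqxx big1 ?addr0 // => S /negbTE ne.
by rewrite outE ne.
Qed.

Lemma partial_output_put i e : partial_output d k c V r col a i e ->
  partial_output d k c V r col a i (put i_ 0 (i : value R TNat) e).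
Proof.
move=> [te e25 [ec es] inj eu]; split=> //=.
Qed.

Lemma sum_index (L : seq nat) (t : nat) : uniq L ->
  (\sum_(1 <= z < (size L).+1) (nth 0 L z.-1 == t)%:R = (t \in L)%:R :> R)%R.
Proof.
move=> uL; rewrite big_add1 /= -natr_sum; congr (_%:R)%R.
rewrite -(big_nth 0 xpredT (fun x => nat_of_bool (x == t))).
rewrite -count_uniq_mem // -sum1_count [RHS]big_mkcond /=.
by apply: eq_bigr => x _; case: eqP.
Qed.

(* That the probabilities add up to 1 replaces counting the sequences that are
   compatible with [a]. *)
Lemma rows_Pr n i st : n = k.+1 - i -> 0 < i <= k.+1 ->
  partial_output d k c V r col a i (view st) ->
  (forall S, Pr (outputs S) (loop i_ (Lit 1) (exec complete_row) n i st) =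
     ((extends i (view st) S)%:R * row_weight i)%:E) /\
  (\sum_(S : k.-tuple 'I_d) Pr (outputs S) (loop i_ (Lit 1) (exec complete_row) n i st) = 1)%E.
Proof.
elim: n i st => [|n IH] i st en hi po.
  have -> : i = k.+1 by lia.
  have {}po : partial_output d k c V r col a k.+1 (view st) by rewrite (_ : k.+1 = i) //; lia.
  split=> [S|] /=; first by rewrite extends_end // /row_weight big_geq // mulr1.
  by rewrite sumEFin exists_unique_output.
have hik : 0 < i <= k by lia.
rewrite loopS [_ == 0]/=; set st1 := tick 1 _.
have v1 : view st1 = put i_ 0 (i : value R TNat) (view st).
  exact: (view_store st i_ 0 (i : value R TNat)).
clearbody st1.
have po1 : partial_output d k c V r col a i (view st1) by rewrite v1; exact: partial_output_put.
have ei1 : natv (view st1) 32 0 = i by rewrite v1.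
have ext1 S : extends i (view st1) S = extends i (view st) S by rewrite v1.
have [ir|ne] := eqVneq i (r a).
  have [st2 -> [po2 e3]] := complete_row_skip k_gt0 kd c_noninc entries a_rng ir ei1 po1.
  rewrite [bind _ _]/=; have [|||IH1 IH2] := IH i.+1 st2; [lia|lia|by []|].
  split=> // S; rewrite IH1 -ext1; congr (_%:E); congr (_%:R * _)%R.
    rewrite /extends e3; congr [&& _, _ & _]; apply: eq_all_r => x.
    rewrite !mem_filled -ir ltnS (leq_eqVlt x i).
    by case: (x == i); rewrite ?orbT ?orbF.
  by rewrite /row_weight [in RHS]big_ltn_cond ?ltnS ?ir ?eqxx //; case/andP: ra_rng.
have [L [f [-> sL uL memL hf]]] :=
  complete_row_draw k_gt0 kd c_noninc entries a_rng hik ne ei1 po1.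
have i_le : i <= reach r i a.
  by case/andP: hik => i0 ik; exact: (reach_ge k_gt0 kd c_noninc entries).
have m0 : ((size L)%:R != 0 :> R)%R by rewrite pnatr_eq0 sL; lia.
pose g z S := ((extends i.+1 (view (f z)) S)%:R * row_weight i.+1)%R.
have IHz z : 0 < z <= size L ->
    (forall S, Pr (outputs S) (loop i_ (Lit 1) (exec complete_row) n i.+1 (f z)) =
      (g z S)%:E) /\ (\sum_(S : k.-tuple 'I_d) g z S = 1)%R.
  move=> hz; have [||IH1 IH2] := IH i.+1 (f z) _ _ (hf z hz).1; [lia|lia|].
  split=> //; apply: EFin_inj; rewrite -IH2 -sumEFin.
  by apply: eq_bigr => S _; rewrite IH1.
have PrE S : Pr (outputs S) (bind (UNat (size L) (fun z => Ret R (f z)))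
    (loop i_ (Lit 1) (exec complete_row) n i.+1)) =
    ((size L)%:R^-1 * \sum_(1 <= z < (size L).+1) g z S)%:E.
  rewrite /= EFinM -sumEFin; congr (_ * _)%E; apply: eq_big_nat => z hz.
  by rewrite (IHz z _).1.
split=> [S|]; last first.
  rewrite (eq_bigr _ (fun S _ => PrE S)) sumEFin -mulr_sumr exchange_big /=.
  rewrite (eq_big_nat _ _ (F2 := fun=> 1%R)) => [|z hz]; last exact: (IHz z _).2.
  by rewrite big_const_nat subn1 /= iter_addr_0 mulVf.
rewrite PrE; congr (_%:E).
have iF : i \notin filled k r a i by rewrite mem_filled ltnn (negbTE ne) andbF.
(* S survives the draw z exactly if it was possible before and its item in row i is the one
   drawn. *)
have extz z : 0 < z <= size L -> extends i.+1 (view (f z)) S =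
    extends i (view st) S && (nth 0 L z.-1 == target S i).
  move=> hz; rewrite -ext1 /extends.
  suff -> : all (fun x => natv (view (f z)) 3 x == target S x) (filled k r a i.+1) =
     all (fun x => natv (view st1) 3 x == target S x) (filled k r a i) &&
     (nth 0 L z.-1 == target S i) by rewrite !andbA.
  rewrite (hf z hz).2 (eq_all_r (s2 := i :: filled k r a i)) => [|x]; last first.
    rewrite inE !mem_filled ltnS (leq_eqVlt x i); case: (x =P i) => [->|_] //=.
    by rewrite hik.
  rewrite andbC [all _ (_ :: _)]/= eqxx; congr (_ && _); apply: eq_in_all => x xF.
  by case: (x =P i) xF => // ->; rewrite (negbTE iF).
rewrite (eq_big_nat _ _ (F2 := fun z => (extends i (view st) S)%:R *
    row_weight i.+1 * (nth 0 L z.-1 == target S i)%:R)%R) => [|z hz]; last first.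
  by rewrite /g extz // -mulnb natrM mulrAC.
rewrite -mulr_sumr sum_index // mulrA mulrCA -mulrA; case: (boolP (extends _ _ _)) => [ext|_].
  have -> : target S i \in L.
    have /and3P[/asboolP[_ cS] uS /allP eS] := ext.
    rewrite memL (cS i hik) andTb; apply/mapP => -[y yF tE].
    case/negP: iF; have /andP[hy _] : (0 < y <= k) && ((y < i) || (y == r a)).
      by rewrite -mem_filled.
    suff iy : i = y by rewrite [X in X \in _]iy.
    apply: (target_inj S).1 => //; rewrite tE v1.
    by apply/eqP/eS.
  rewrite mulr1 mul1r /row_weight [in RHS]big_ltn_cond; last by case/andP: hik.
  by rewrite ne sL mul1r.
by rewrite !mul0r.
Qed.

End OutputLaw.

(** * The integral of a step function *)

Section StepIntegral.
Variables (R : realType) (n : nat) (W q : nat -> R) (f : R -> \bar R).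
Local Open Scope ring_scope.
Local Open Scope classical_set_scope.
Hypotheses (W0 : W 0 = 0) (W_le : forall a, W a <= W a.+1) (Wn_gt0 : 0 < W n).
Hypothesis q_ge0 : forall a, 0 <= q a.
Hypothesis fE : forall (u : R) (a : nat), 0 < u <= 1 -> (0 < a <= n)%N ->
  W a.-1 < u * W n <= W a -> f u = (q a)%:E.

Let step (a : nat) : set R := `]W a.-1 / W n, W a / W n].

Let W_mono a b : (a <= b)%N -> W a <= W b.
Proof.
move=> /subnK <-; elim: (b - a)%N => // m IH.
by rewrite addSn (le_trans IH).
Qed.

Let stepE a u : step a u <-> W a.-1 < u * W n <= W a.
Proof. by rewrite /step /= in_itv /= ltr_pdivrMr // ler_pdivlMr. Qed.

Let step_sub a : (0 < a <= n)%N -> step a `<=` `]0, 1].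
Proof.
move=> /andP[a0 an] u /stepE /andP[h1 h2]; rewrite /= in_itv /=.
have h3 : 0 <= W a.-1 by rewrite -W0 W_mono.
apply/andP; split.
  by rewrite -(pmulr_lgt0 _ Wn_gt0) (le_lt_trans h3).
by rewrite -(ler_pM2r Wn_gt0) mul1r (le_trans h2) // W_mono.
Qed.

(** With W the partial sums of the weights, inverting the distribution function selects a exactly
    for u in [step a]. So f is a finite sum of indicators on ]0, 1]; the point 0, where f is
    unspecified, is a null set. *)
Lemma integral_steps : (\int[lebesgue_measure]_(u in `[0%R, 1%R]) f u)%E =
  (\sum_(1 <= a < n.+1) q a * ((W a - W a.-1) / W n))%:E.
Proof.
pose g (a : nat) (u : R) : \bar R := ((q a)%:E * (\1_(step a) u)%:E)%E.
have mg a : measurable_fun (`]0%R, 1%R] : set R) (g a : R -> \bar R).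
  apply: emeasurable_funM => //; apply/measurable_EFinP.
  by apply: measurable_indic; exact: measurable_itv.
have fg : {in (`]0, 1] : set R), f =1 fun u => (\sum_(a <- index_iota 1 n.+1) g a u)%E}.
  move=> u /set_mem; rewrite /= in_itv /= => /andP[u0 u1].
  have hn : u * W n <= W n by rewrite ger_pMl.
  have ex : exists a, u * W n <= W a by exists n.
  (* The selected index is the least a with [u * W n <= W a]. *)
  case: (ex_minnP ex) => a ha amin.
  have an : (a <= n)%N by exact: amin.
  have a0 : (0 < a)%N.
    rewrite lt0n; apply/negP => /eqP a0.
    by move: ha; rewrite a0 W0 leNgt mulr_gt0.
  have hlt : W a.-1 < u * W n.
    by rewrite ltNge; apply/negP => /amin; rewrite -ltnS prednK // ltnn.
  rewrite (fE (a := a)) ?u0 ?a0 ?hlt //.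
  rewrite (bigD1_seq a) ?iota_uniq ?mem_index_iota ?a0 //=.
  rewrite /g indicE mem_set ?mule1; last by apply/stepE; rewrite hlt.
  rewrite big1 ?adde0 // => b ba; rewrite indicE memNset ?mule0 //.
  move=> /stepE /andP[h1 h2]; move: ba; rewrite neq_ltn => /orP[lt|lt].
    by have := amin _ h2; rewrite leqNgt lt.
  have : W a <= W b.-1 by apply: W_mono; rewrite -ltnS prednK //; exact: leq_ltn_trans lt.
  by rewrite leNgt (lt_le_trans h1).
rewrite -integral_itv_obnd_cbnd; last first.
  apply: eq_measurable_fun (_ : measurable_fun _ (fun u => \sum_(a <- index_iota 1 n.+1) g a u)%E).
    by move=> u hu; rewrite fg.
  exact: emeasurable_sum.
transitivity (\int[lebesgue_measure]_(u in `]0%R, 1%R])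
    (\sum_(a <- index_iota 1 n.+1) g a u))%E; first exact: eq_integral.
rewrite ge0_integral_sum //; last first.
  by move=> a u _; rewrite mule_ge0 ?lee_fin.
rewrite -sumEFin big_seq [RHS]big_seq; apply: eq_bigr => a.
rewrite mem_index_iota => ha.
rewrite /g ge0_integralZl_EFin //; last first.
  by apply/measurable_EFinP; apply: measurable_indic; exact: measurable_itv.
rewrite EFinM integral_indic //; try exact: measurable_itv.
congr (_ * _)%E.
rewrite setIidl; last by apply: step_sub.
rewrite [LHS]lebesgue_measure_itv /= lte_fin ltr_pM2r ?invr_gt0 //.
(* A weight 0 gives an empty step, covered by the other branch of the formula for the measure of an
   interval. *)
case: ltP => [_|le]; first by rewrite -EFinB -mulrBl.
have -> : W a = W a.-1 by apply/le_anti; rewrite le W_mono // leq_pred.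
by rewrite subrr mul0r.
Qed.

End StepIntegral.

(** * Sampling an entry *)

Definition complete_rows : cmd := FOR i_ FROM 1 TO k_ DO complete_row OD%prog.

Definition sample_weights : cmd :=
  sumw_ ::= Cast 0 ;;
  FOR a_ FROM 1 TO d_ * k_ DO
    w_$[a_] ::= m_$[a_] * Exp (eps_ * Ceil V_$[a_] / Cast 2) ;;
    sumw_ ::= sumw_ + w_$[a_]
  OD.

Definition choose_entry : cmd :=
  acc_ ::= Cast 0 ;;
  sel_ ::= 0 ;;
  FOR a_ FROM 1 TO d_ * k_ WHILE ~~ sel_ DO
    acc_ ::= acc_ + w_$[a_] ;;
    IF (Cast 0 < acc_) && (u_ * sumw_ <= acc_) THEN sel_ ::= a_ FI
  OD.

(** Regroups [;;] by associativity of [bind], so that the deterministic prologue becomes a single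
    program. *)
Lemma exec_complete_sequence (R : realType) (st : state R) :
  exec complete_sequence st = exec (Seq complete_init complete_rows) st.
Proof.
rewrite exec_seqA; apply: exec_seq_congr => {}st.
rewrite exec_seqA; apply: exec_seq_congr => {}st.
rewrite exec_seqA; apply: exec_seq_congr => {}st.
by rewrite exec_seqA; apply: exec_seq_congr => {}st.
Qed.

Lemma exec_sample_entry (R : realType) (st : state R) :
  exec (Seq sample_entry complete_sequence) st =
  exec (Seq sample_weights (Seq (DrawReal u_)
    (Seq choose_entry complete_sequence))) st.
Proof.
rewrite !exec_seqA; apply: exec_seq_congr => {}st.
rewrite !exec_seqA; apply: exec_seq_congr => {}st.
rewrite !exec_seqA; apply: exec_seq_congr => {}st.
rewrite !exec_seqA; apply: exec_seq_congr => {}st.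
by rewrite !exec_seqA; apply: exec_seq_congr => {}st.
Qed.

Lemma Pr_ureal (R : realType) A (P : A -> bool) (f : R -> tree R A) :
  Pr P (UReal f) =
  (\int[lebesgue_measure]_(u in `[0%R, 1%R]) Pr P (f u))%E.
Proof. by []. Qed.

Section Sampling.
Variables (R : realType) (d k : nat) (c : nat -> nat) (eps : R).
Variables (V : nat -> R) (r col : nat -> nat).
Hypotheses (k_gt0 : 0 < k) (kd : k <= d).
Hypothesis c_noninc : forall i j, 0 < i -> i <= j -> j <= d -> c j <= c i.
Hypothesis entries : sorted_entries d k c V r col.
Implicit Types (e : env R) (S : k.-tuple 'I_d) (st : state R).

Definition hits a S : bool := `[< compatible k r col a (target S) >] && uniq S.

Definition entry_weight a : R :=
  ((mult k r a)%:R * expR (eps * (Num.ceil (V a))%:~R / 2%:R))%R.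

Definition total_weight n : R := (\sum_(1 <= a < n.+1) entry_weight a)%R.

(** Before row 1 only row [r a] is filled, so [extends] reduces to [hits], and [row_weight 1] is the
    inverse of the multiplicity. *)
Lemma complete_sequence_Pr a st : 0 < a <= d * k -> 0 < reach r 1 a ->
  matrix_tables d k c V r col a (view st) ->
  (forall S, Pr (outputs S) (exec complete_sequence st) =
     ((hits a S)%:R / (mult k r a)%:R)%:E) /\
  (\sum_(S : k.-tuple 'I_d) Pr (outputs S) (exec complete_sequence st) = 1)%E.
Proof.
move=> ha ra te.
have [st1 E1 [po ag]] := @seq_det R complete_init _ st isT
  (complete_init_wp k_gt0 kd entries ha te).
pose st2 := tick (cost 1 + cost k_).+1 st1.
have po2 : partial_output d k c V r col a 1 (view st2) by exact: po.
have E : exec complete_sequence st =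
    loop i_ (Lit 1) (exec complete_row) (k.+1 - 1) 1 st2.
  rewrite exec_complete_sequence E1.
  have [[[_ t1 _ _] _ _ _] _ _ _ _] := po.
  have -> : k = eval st1 k_ by rewrite eval_view -t1; move: (view st1).
  by [].
have [|h1 h2] := rows_Pr k_gt0 kd c_noninc entries ha ra erefl _ po2; first by [].
rewrite E; split=> // S; rewrite h1; congr (_%:E).
have [_ _ [ec _] _ _] := po2.
have [rng _ _] := entries; have /andP[a0 ad] := ha; have [r0 rk _ _ _] := rng a a0 ad.
congr (_ * _)%R.
  congr (_%:R)%R; congr nat_of_bool; rewrite /extends /hits andbA.
  case: (boolP (_ && uniq S)) => // /andP[/asboolP[cS _] _]; rewrite andTb.
  apply/allP => x; rewrite mem_filled => /andP[hx /orP[|/eqP->]]; first by lia.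
  by rewrite ec cS.
rewrite /row_weight /mult  ra mul1n natr_prod.
by rewrite -prodfV.
Qed.

Lemma entry_weight_ge0 a : (0 <= entry_weight a)%R.
Proof. by rewrite mulr_ge0 ?ler0n // expR_ge0. Qed.

Lemma total_weightS n : total_weight n.+1 = (total_weight n + entry_weight n.+1)%R.
Proof. by rewrite /total_weight big_nat_recr. Qed.

Lemma total_weight_le a b : a <= b -> (total_weight a <= total_weight b)%R.
Proof.
move=> /subnK <-; elim: (b - a) => // n IH.
by rewrite addSn total_weightS (le_trans IH) // lerDl entry_weight_ge0.
Qed.

Definition sampling_tables e : Prop :=
  [/\ tables d k r col e, realv e 3 = V &
    forall i j, 0 < i -> i <= k -> 0 < j -> j <= d ->
      realv e 2 ((i - 1) * d + j) = Umx R d k c i j].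

Lemma sampling_tables_agree m e e' : agree m e e' ->
  [&& 0 \notin m.1, 1 \notin m.1, 18 \notin m.1 & 19 \notin m.1] ->
  (2 \notin m.2) && (3 \notin m.2) ->
  sampling_tables e -> sampling_tables e'.
Proof.
move=> ag m1 /andP[m2 m3] [te tV tU]; have [aN aR] := ag; split.
- exact: tables_agree ag m1 te.
- by rewrite aR.
- by move=> i j *; rewrite aR // tU.
Qed.

Lemma sample_weights_wp e : sampling_tables e -> realv e 0 0 = eps ->
  (forall a, 0 < a <= d * k -> realv e 6 a = (mult k r a)%:R%R) ->
  wp sample_weights (fun e' =>
    (forall a, 0 < a <= d * k -> realv e' 7 a = entry_weight a) /\
    realv e' 8 0 = total_weight (d * k)) e.
Proof.
move=> [[t0 t1 t18 t19] tV tU] ee em; apply: wp_seq; apply: wp_store => /=.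
apply: (wp_for_all (fun a e' =>
    (forall b, 0 < b < a -> realv e' 7 b = entry_weight b) /\
    realv e' 8 0 = total_weight a.-1)) => /=.
- by [].
- by split; [move=> b; lia|rewrite /total_weight big_geq].
- rewrite t0 t1 => a e1 ha [aN aR] [h7 h8].
  apply: wp_seq; apply: wp_store; apply: wp_store => /=.
  rewrite !(aR 0) // !(aR 3) // !(aR 6) //= ee tV em // eqxx.
  have aS : a.-1.+1 = a by rewrite prednK //; case/andP: ha.
  split; last by rewrite h8 -[in RHS]aS total_weightS aS.
  by move=> b hb; case: eqP => [->|ne] //; apply: h7; lia.
by rewrite t0 t1 => e1 _ [h7 h8]; split.
Qed.

(** For u > 0 and a positive total, the positivity test follows from the other one, so the loop
    stops at the first partial sum that reaches [u * total_weight (d * k)]. *)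
Lemma choose_entry_wp a e (u : R) : sampling_tables e -> (0 < u)%R ->
  (forall b, 0 < b <= d * k -> realv e 7 b = entry_weight b) ->
  realv e 8 0 = total_weight (d * k) -> realv e 10 0 = u ->
  (0 < total_weight (d * k))%R -> 0 < a <= d * k ->
  (total_weight a.-1 < u * total_weight (d * k) <= total_weight a)%R ->
  wp choose_entry (fun e' => natv e' 24 0 = a) e.
Proof.
move=> [[t0 t1 t18 t19] tV tU] u0 h7 h8 h10 W0 ha /andP[lo hi].
do 2 (apply: wp_seq; apply: wp_store => /=).
apply: (wp_for (fun b e' => [/\ b <= a.+1, realv e' 9 0 = total_weight b.-1 &
    natv e' 24 0 = if b <= a then 0 else a])) => /=.
- by [].
- by split=> //; [rewrite /total_weight big_geq|case/andP: ha => ->].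
- rewrite t0 t1 => b e1 hb [aN aR] [ba h9 h24] hg.
  have {}ba : b <= a by move: hg; rewrite h24; case: leqP => //; case: (a) ha.
  have bS : b.-1.+1 = b by rewrite prednK //; case/andP: hb.
  have acc : (realv e1 9 0 + entry_weight b)%R = total_weight b.
    by rewrite h9 -[in RHS]bS total_weightS bS.
  apply: wp_seq; apply: wp_store => /=; rewrite (aR 7) //= h7 // acc.
  apply: wp_cond => /=; rewrite (aR 10) // (aR 8) //= h8 h10 => hc.
    apply: wp_store => /=.
    have le : (u * total_weight (d * k) <= total_weight b)%R.
      by move: hc; case: (_ <= total_weight b)%R; rewrite ?muln0.
    have -> : b = a.
      apply/eqP; rewrite eqn_leq ba leqNgt; apply/negP => lt.
      move: lo; apply/negP; rewrite -leNgt (le_trans le) // total_weight_le //.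
      by rewrite -ltnS prednK //; case/andP: ha.
    by rewrite ltnn.
  have lt : b < a.
    rewrite ltn_neqAle ba andbT; apply/eqP => ab; move: hc.
    by rewrite ab hi (lt_le_trans (mulr_gt0 u0 W0) hi).
  apply: wp_skip; split=> //=.
  by rewrite h24 ba lt.
move=> b e1 hb [aN aR] [ba h9 h24] hx; move: hb hx; rewrite t0 t1 => hb hx.
rewrite h24; case: leqP => // le; case: hx => [|/eqP]; first by lia.
by rewrite h24 le.
Qed.

Lemma sampling_Pr S st : sampling_tables (view st) -> realv (view st) 0 0 = eps ->
  (forall a, 0 < a <= d * k -> realv (view st) 6 a = (mult k r a)%:R%R) ->
  (0 < total_weight (d * k))%R ->
  Pr (outputs S) (exec (Seq sample_entry complete_sequence) st) =
  (\sum_(1 <= a < (d * k).+1) (hits a S)%:R / (mult k r a)%:R *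
     (entry_weight a / total_weight (d * k)))%R%:E.
Proof.
move=> te ee em W0; rewrite exec_sample_entry.
have [st1 -> [[h7 h8] ag]] := @seq_det R sample_weights _ st isT
  (sample_weights_wp te ee em).
have te1 : sampling_tables (view st1) by exact: sampling_tables_agree ag _ _ te.
rewrite exec_draw_real Pr_ureal.
(* Each weight is an increment of the partial sums, the form that [integral_steps] expects. *)
transitivity ((\sum_(1 <= a < (d * k).+1) (hits a S)%:R / (mult k r a)%:R *
     ((total_weight a - total_weight a.-1) / total_weight (d * k)))%R%:E); last first.
  congr (_%:E); apply: eq_big_nat => a /andP[a0 _].
  have aS : a.-1.+1 = a by rewrite prednK.
  by rewrite -[X in (total_weight X - _)%R]aS total_weightS aS addrAC subrr add0r.
apply: (@integral_steps R (d * k) total_weight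
  (fun a => (hits a S)%:R / (mult k r a)%:R)%R) => //.
- by rewrite /total_weight big_geq.
- by move=> a; exact: total_weight_le.
move=> u a /andP[u0 u1] ha hW.
set st2 := tick 1 _.
have v2 : view st2 = put u_ 0 (u : value R TReal) (view st1).
  exact: (view_store st1 u_ 0 (u : value R TReal)).
clearbody st2.
have te2 : sampling_tables (view st2).
  by rewrite v2; exact: sampling_tables_agree (agree_put u_ 0 _ _) _ _ te1.
have hw : wp choose_entry (fun e' => natv e' 24 0 = a) (view st2).
  rewrite v2 in te2 *; move: (view st1) h7 h8 te2 => e1 h7 h8 te2.
  exact: choose_entry_wp te2 u0 h7 h8 _ W0 ha hW.
have [st3 E3 [e24 ag3]] := @seq_det R choose_entry _ st2 isT hw.
have te3 : sampling_tables (view st3) by exact: sampling_tables_agree ag3 _ _ te2.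
(* The interval that selects a is nonempty, so a has nonzero weight, hence nonzero multiplicity, and
   row 1 has been met. *)
have ra : 0 < reach r 1 a.
  rewrite lt0n; apply/negP => /eqP r1.
  have aS : a.-1.+1 = a by rewrite prednK //; case/andP: ha.
  have eW : total_weight a = total_weight a.-1.
    rewrite -[in LHS]aS total_weightS aS /entry_weight /mult  r1.
    by rewrite mul0n mul0r addr0.
  by move: hW; rewrite eW => /andP[lo /(lt_le_trans lo)]; rewrite ltxx.
rewrite E3.
have [t1 t2 t3] := te3.
by have [-> _] := @complete_sequence_Pr a st3 ha ra (And4 t1 t2 e24 t3).
Qed.

End Sampling.

(** * The exponential mechanism *)

Section Utility.
Variables (R : realType) (d k : nat) (c : nat -> nat) (eps : R).
Variables (V : nat -> R) (r col : nat -> nat).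
Hypotheses (k_gt0 : 0 < k) (kd : k <= d) (eps_gt0 : (0 < eps)%R).
Hypothesis c_noninc : forall i j, 0 < i -> i <= j -> j <= d -> c j <= c i.
Hypothesis entries : sorted_entries d k c V r col.
Variables (D : dataset d) (item_of : {perm 'I_d}).
Hypothesis cE : forall j : 'I_d, c j.+1 = item_count D (item_of j).
Implicit Types (S : k.-tuple 'I_d).

Let em := em_weight eps D item_of kd.

(** By [compatible_util] the largest loss of count is attained in row [r a] and equals minus the
    ceiling of V a. *)
Lemma em_weight_hits a S : 0 < a <= d * k -> hits r col a S ->
  em S = expR (eps * (Num.ceil (V a))%:~R / 2%:R)%R.
Proof.
move=> ha /andP[/asboolP cS uS].
have [vE v_le] := compatible_util k_gt0 kd c_noninc entries ha cS.
have [rng _ _] := entries; have /andP[a0 ad] := ha; have [r0 rk _ _ _] := rng a a0 ad.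
rewrite /em /em_weight /ustar uS.
have termE (i : 'I_k) : ((item_count D (item_of (widen_ord kd i)))%:R -
    (item_count D (item_of (tnth S i)))%:R)%R =
    (- ((c (target S i.+1))%:Z - (c i.+1)%:Z)%R%:~R)%R :> R.
  by rewrite targetE !cE rmorphB /= -!pmulrn opprB (cE (widen_ord kd i)).
have -> : (\big[maxe/-oo]_(i < k) ((item_count D (item_of (widen_ord kd i)))%:R -
    (item_count D (item_of (tnth S i)))%:R : R)%R%:E = (- (Num.ceil (V a))%:~R : R)%R%:E)%E.
  apply/eqP; rewrite eq_le; apply/andP; split.
    apply/bigmax_leP; split=> [|i _]; first exact: leNye.
    by rewrite termE lee_fin lerN2 ler_int v_le //= ltn_ord.
  have ri : (r a).-1 < k by rewrite prednK.
  apply: le_trans (le_bigmax _ _ (Ordinal ri)).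
  by rewrite termE /= prednK // vE.
by rewrite /= opprK mulrAC.
Qed.

(** Positivity of [eps] makes its product with -oo equal to -oo. *)
Lemma em_weight_nuniq S : ~~ uniq S -> em S = 0%R.
Proof.
move=> /negbTE nu; rewrite /em /em_weight /ustar nu.
by rewrite gt0_muleNy ?lte_fin ?divr_gt0.
Qed.

End Utility.

(** * The law of the whole run and its normalising constant *)

Section Run.
Variables (R : realType) (d k : nat) (eps : R) (D : dataset d).
Hypotheses (k_gt0 : 0 < k) (kd : k <= d) (eps_gt0 : (0 < eps)%R).

Let st0 := joint_input D k eps.

Definition ready (c : nat -> nat) (V : nat -> R) (r col : nat -> nat) (e : env R) :=
  [/\ sampling_tables d k c V r col e, realv e 0 0 = eps &
    forall a, 0 < a <= d * k -> realv e 6 a = (mult k r a)%:R%R].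

(** Everything before [sample_entry] is draw-free, so the run continues from one concrete state. *)
Lemma run_Joint_prefix :
  exists (c : nat -> nat) (V : nat -> R) (r col : nat -> nat) (st : state R),
  [/\ forall i j, 0 < i -> i <= j -> j <= d -> c j <= c i,
      perm_eq (seg c 1 d.+1) [seq item_count D j | j <- enum 'I_d],
      sorted_entries d k c V r col, ready c V r col (view st)
    & run_Joint D k eps = exec (Seq sample_entry complete_sequence) st].
Proof.
have d_gt0 : 0 < d by exact: leq_trans kd.
have [i0 ik] : natv (view st0) 0 0 = d /\ natv (view st0) 1 0 = k by [].
have [st1 E1 [[pm c_le] ag1]] := @seq_det R relabel _ st0 isT (relabel_wp i0 d_gt0).
have d1 : natv (view st1) 0 0 = d by rewrite (ag1.1 0).
have k1 : natv (view st1) 1 0 = k by rewrite (ag1.1 1).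
set c := natv (view st1) 14 in pm c_le.
have [st2 E2 [ms ag2]] := @seq_det R build_matrix _ st1 isT (build_matrix_wp d1 k1).
rewrite -/c in ms.
have d2 : natv (view st2) 0 0 = d by rewrite (ag2.1 0).
have k2 : natv (view st2) 1 0 = k by rewrite (ag2.1 1).
have [st3 E3 [entries ag3]] := @seq_det R sort_entries _ st2 isT
  (sort_entries_wp k_gt0 kd c_le d2 k2 ms).
set V := realv (view st3) 3 in entries; set r := natv (view st3) 18 in entries.
set col := natv (view st3) 19 in entries.
have t3 : tables d k r col (view st3).
  by split=> //; [rewrite (ag3.1 0)|rewrite (ag3.1 1)].
have s3 : sampling_tables d k c V r col (view st3).
  split=> // i j hi hik hj hjd; rewrite (ag3.2 2) //.
  have [|-> _ _ _] := ms ((i - 1) * d + j).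
    by have := leq_mul2l d i k; rewrite hik orbT; nia.
  by rewrite entry_rowE ?entry_colE.
have [A hA [rA hreach]] := first_full k_gt0 kd c_le entries.
have [st4 E4 [[h20 h21 h22] ag4]] := @seq_det R reset_counts _ st3 isT
  (reset_counts_wp k_gt0 kd t3).
have t4 : tables d k r col (view st4) by exact: tables_agree ag4 _ t3.
have [st5 E5 [[h23 h22' hcnt hm0] ag5]] := @seq_det R scan_until_all_rows _ st4 isT
  (scan_wp k_gt0 kd c_le entries t4 hreach hA h20 h21 h22).
have t5 : tables d k r col (view st5) by exact: tables_agree ag5 _ t4.
have [st6 E6 [[hp hm] ag6]] := @seq_det R first_multiplicity _ st5 isT
  (first_multiplicity_wp k_gt0 kd c_le entries t5 hreach hA h23 h22' hcnt hm0).
have t6 : tables d k r col (view st6) by exact: tables_agree ag6 _ t5.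
have hb6 : natv (view st6) 22 0 = A.-1 by rewrite (ag6.1 22).
have cnt6 : counts_stored k r A (view st6).
  by move=> i hi hr; rewrite (ag6.2 4) //; exact: hcnt.
have [st7 E7 [hmult ag7]] := @seq_det R other_multiplicities _ st6 isT
  (other_multiplicities_wp k_gt0 kd c_le entries t6 hreach hA hb6 cnt6 hp hm).
exists c, V, r, col, st7; split=> //.
- rewrite (perm_trans pm) // (_ : seg _ _ _ = [seq item_count D j | j <- enum 'I_d]) //.
  apply: (@eq_from_nth _ 0) => [|j].
    by rewrite size_seg size_map size_enum_ord subn1.
  rewrite size_seg subn1 => jd; rewrite (nth_map 0) ?size_iota ?subn1 // nth_iota ?subn1 //.
- split=> //.
    apply: sampling_tables_agree ag7 _ _ _ => //.
    apply: sampling_tables_agree ag6 _ _ _ => //.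
    apply: sampling_tables_agree ag5 _ _ _ => //.
    exact: sampling_tables_agree ag4 _ _ _.
  rewrite (ag7.2 0) // (ag6.2 0) // (ag5.2 0) // (ag4.2 0) // (ag3.2 0) //.
  by rewrite (ag2.2 0) // (ag1.2 0).
by rewrite /run_Joint /Joint E1 E2 E3 E4 E5 E6 E7.
Qed.

(** Two nonincreasing lists of the same multiset coincide, so it does no harm if [item_of] and the
    merge sort break ties differently. *)
Lemma sorted_counts (item_of : {perm 'I_d}) (c : nat -> nat) :
  is_relabeling D item_of ->
  (forall i j, 0 < i -> i <= j -> j <= d -> c j <= c i) ->
  perm_eq (seg c 1 d.+1) [seq item_count D j | j <- enum 'I_d] ->
  forall j : 'I_d, c j.+1 = item_count D (item_of j).
Proof.
move=> rel c_le pm j.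
have nthE : nth 0 [seq item_count D (item_of i) | i <- enum 'I_d] j =
    item_count D (item_of j).
  by rewrite (nth_map j) ?size_enum_ord // nth_ord_enum.
have nthc i : i < d -> nth 0 (seg c 1 d.+1) i = c i.+1.
  by move=> hi; rewrite (nth_map 0) ?size_iota ?nth_iota ?subn1 // add1n.
rewrite -nthc // -nthE; congr nth.
apply: (@sorted_eq _ geq).
- by move=> x y z h1 h2; exact: leq_trans h2 h1.
- by move=> x y h; apply/eqP; rewrite eqn_leq andbC.
- apply/(sortedP 0) => i; rewrite size_seg subn1 => hi.
  by rewrite /= !nthc //; [apply: c_le; lia|lia].
- apply/(sortedP 0) => i; rewrite size_map size_enum_ord => hi.
  have hi' : i < d by exact: ltnW.
  rewrite !(nth_map (Ordinal hi)) -?enumT ?size_enum_ord //.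
  apply: rel; have := nth_enum_ord (Ordinal hi) hi; have := nth_enum_ord (Ordinal hi) hi'.
  by rewrite -?enumT => -> ->.
apply: (perm_trans pm).
have -> : [seq item_count D (item_of i) | i <- enum 'I_d] =
   [seq item_count D i | i <- [seq item_of i | i <- enum 'I_d]].
  by rewrite -[RHS]map_comp; apply: eq_map.
apply: perm_map; apply: uniq_perm; first exact: enum_uniq.
  by rewrite map_inj_uniq ?enum_uniq //; exact: perm_inj.
move=> i; rewrite mem_enum; apply/esym/mapP.
by exists ((item_of^-1)%g i); rewrite ?mem_enum // permKV.
Qed.

Lemma mult_gt0 (c : nat -> nat) (V : nat -> R) r col a :
  (forall i j, 0 < i -> i <= j -> j <= d -> c j <= c i) ->
  sorted_entries d k c V r col -> a <= d * k -> 0 < reach r 1 a -> 0 < mult k r a.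
Proof.
move=> c_le entries ad r1; rewrite /mult r1 mul1n big_seq_cond.
apply: prodn_cond_gt0 => i; rewrite mem_index_iota ltnS => /andP[/andP[i0 ik] _].
by have := reach_ge k_gt0 kd c_le entries ad i0 ik r1; lia.
Qed.

Lemma run_Joint_Pr (item_of : {perm 'I_d}) (S : k.-tuple 'I_d) :
  is_relabeling D item_of ->
  Pr (outputs S) (run_Joint D k eps) =
  (em_weight eps D item_of kd S /
   \sum_(S' : k.-tuple 'I_d) em_weight eps D item_of kd S')%R%:E.
Proof.
move=> rel.
have [c [V [r [col [st [c_le pm entries [te ee em] ->]]]]]] := run_Joint_prefix.
have cE := sorted_counts rel c_le pm.
pose n := d * k; pose W := total_weight k eps V r n.
have mgt a := mult_gt0 (a := a) c_le entries.
have [A hA [rA hreach]] := first_full k_gt0 kd c_le entries.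
have [A0 Ad] := andP hA.
(* The entry (1, 1), at position A, already has positive multiplicity. *)
have W_gt0 : (0 < W)%R.
  apply: (@lt_le_trans _ _ (entry_weight k eps V r A)).
    by rewrite mulr_gt0 ?expR_gt0 // ltr0n mgt // hreach.
  have AS : A.-1.+1 = A by rewrite prednK.
  apply: le_trans (total_weight_le k eps V r Ad).
  rewrite -[in X in (_ <= X)%R]AS total_weightS AS lerDr.
  by rewrite sumr_ge0 // => b _; exact: entry_weight_ge0.
(* A sequence with distinct items is hit by exactly one a, whose multiplicity cancels against its
   weight. *)
have PE S' : Pr (outputs S') (exec (Seq sample_entry complete_sequence) st) =
    (em_weight eps D item_of kd S' / W)%R%:E.
  rewrite (sampling_Pr k_gt0 kd c_le entries S' te ee em W_gt0); congr (_%:E).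
  have [uS|nS] := boolP (uniq S'); last first.
    rewrite em_weight_nuniq // mul0r big1 // => a _.
    by rewrite /hits (negbTE nS) andbF !mul0r.
  have [a ha ca] := compatible_ex k_gt0 kd c_le entries (target_rng S').
  have [a0 ad] := andP ha.
  have hS : hits r col a S' by rewrite /hits uS andbT; apply/asboolP.
  rewrite (bigD1_seq a) ?iota_uniq ?mem_index_iota ?ltnS //= big1_seq ?addr0 => [|b].
    rewrite hS (em_weight_hits eps k_gt0 kd c_le entries cE ha hS) /entry_weight.
    rewrite mul1r !mulrA mulVf ?mul1r // pnatr_eq0 -lt0n mgt //.
    by have := ca.2 1; lia.
  rewrite mem_index_iota ltnS => /andP[ba hb].
  case: (boolP (hits r col b S')); last by rewrite !mul0r.
  move=> /andP[/asboolP cb _]; case/eqP: ba.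
  exact: (compatible_inj k_gt0 kd c_le entries hb ha cb ca).
(* W is identified by summing [PE] over all sequences: the total is 1, since each conditional law
   given a has mass 1. *)
suff <- : W = (\sum_(S' : k.-tuple 'I_d) em_weight eps D item_of kd S')%R by exact: PE.
apply: (@mulIf _ W^-1%R); first by rewrite invr_eq0 gt_eqF.
rewrite mulfV ?gt_eqF // mulr_suml; apply: EFin_inj.
rewrite -sumEFin -(eq_bigr _ (fun S' _ => PE S')).
under eq_bigr => S' _ do rewrite (sampling_Pr k_gt0 kd c_le entries S' te ee em W_gt0).
rewrite sumEFin exchange_big /= -/n; congr (_%:E).
rewrite (eq_big_nat _ _ (F2 := fun a => entry_weight k eps V r a / W))%R; last first.
  move=> a; rewrite ltnS => ha; rewrite -mulr_suml.
  have [r1|r1] := posnP (reach r 1 a).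
    by rewrite /entry_weight /mult r1 mul0n !mul0r mulr0.
  (* An auxiliary state with [sel_] set to a by hand; the completion started there shows that the
     conditional law has mass 1. *)
  pose sta := store sel_ 0 (a : value R TNat) st.
  have tea : matrix_tables d k c V r col a (view sta).
    by rewrite /sta view_store; case: te => [[t0 t1 t18 t19] tV tU]; split.
  have [h1 h2] := complete_sequence_Pr k_gt0 kd c_le entries ha r1 tea.
  suff -> : (\sum_(S' : k.-tuple 'I_d) (hits r col a S')%:R / (mult k r a)%:R = 1
      :> R)%R by rewrite mul1r.
  apply: EFin_inj; rewrite -sumEFin -h2.
  by apply: eq_bigr => S' _; rewrite h1.
by rewrite -mulr_suml divff // gt_eqF.
Qed.

End Run.

(** * Time and space *)

Section Resources.
Variable R : realType.
Implicit Types (st : state R) (beta : nat -> option nat).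

Definition within (b : option nat) (v : nat) : bool :=
  if b is Some m then v <= m else true.

Definition ole (a b : option nat) : bool :=
  if b is Some n then (if a is Some m then m <= n else false) else true.

Lemma within_ole a b v : ole a b -> within a v -> within b v.
Proof. by case: a b => [m|] [n|] //= mn vm; exact: leq_trans mn. Qed.

Definition value_within (s : ty) : option nat -> value R s -> bool :=
  match s return option nat -> value R s -> bool with
  | TNat => within
  | TReal => fun _ _ => true
  end.

(* [beta x] bounds all cells of the array of naturals named [x], and [M] the
   length of every array. *)
Definition respects (beta : nat -> option nat) (M : nat) st : Prop :=
  [/\ forall x i, within (beta x) (lookup st (Name TNat x) i),
      forall x, size (nth [::] (nats st) x) <= M,
      forall x, size (nth [::] (reals st) x) <= M
    & size (nats st) <= 34 /\ size (reals st) <= 11].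

(** A static bound, [None] meaning that none is known. Subtraction and division keep the bound of
    their first operand, so [i_ - 1] is bounded like [i_]. *)
Fixpoint ub (beta : nat -> option nat) (s : ty) (e : expr s) : option nat :=
  match e with
  | Lit n => Some n
  | Get TNat x _ => beta (id x)
  | Bin o TNat e1 e2 =>
      match o, ub beta e1, ub beta e2 with
      | Add, Some m, Some n => Some (m + n)
      | Mul, Some m, Some n => Some (m * n)
      | Sub, b, _ | Div, b, _ => b
      | _, _, _ => None
      end
  | Cmp _ _ _ _ => Some 1
  | _ => None
  end.

Lemma ub_within beta M st (s : ty) (e : expr s) : respects beta M st ->
  value_within (ub beta e) (eval st e).
Proof.
move=> [hb _ _ _]; elim: e => //=.
- by case=> // -[x] i _ /=; exact: hb.
- case=> -[] // e1 IH1 e2 IH2 /=; move: IH1 IH2 => /=.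
  + by case: (ub beta e1) (ub beta e2) => [m|] [n|] //= h1 h2; exact: leq_add.
  + by case: (ub beta e1) => //= m h1 _; exact: leq_trans (leq_subr _ _) h1.
  + by case: (ub beta e1) (ub beta e2) => [m|] [n|] //= h1 h2; exact: leq_mul.
  + by case: (ub beta e1) => //= m h1 _; exact: leq_trans (leq_div _ _) h1.
- by move=> o s' e1 _ e2 _; case: cmp_val.
Qed.

Lemma ub_leq beta M st (e : expr TNat) m : respects beta M st ->
  ole (ub beta e) (Some m) -> (eval st e : nat) <= m.
Proof.
move=> hr h; have := ub_within e hr; rewrite /=; case: (ub beta e) h => //= n nm h.
exact: leq_trans nm.
Qed.

Lemma respects_tick beta M n st : respects beta M (tick n st) <-> respects beta M st.
Proof. by []. Qed.

Lemma respects_sub beta beta' M st : (forall x, ole (beta x) (beta' x)) ->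
  respects beta M st -> respects beta' M st.
Proof.
by move=> h [h1 h2 h3 h4]; split=> // x i; exact: within_ole (h x) (h1 x i).
Qed.

Lemma size_write (T : Type) (z : T) m a i v b :
  size (nth [::] (write z m a i v) b) <= maxn (size (nth [::] m b)) i.+1.
Proof.
rewrite /write nth_set_nth /=; case: eqP => [->|_]; last exact: leq_maxl.
by rewrite size_set_nth maxnC.
Qed.

Lemma respects_store beta beta' M (s : ty) (x : name s) i (v : value R s) st :
  (forall y, ole (beta y) (beta' y)) ->
  i < M -> id x < (if s is TNat then 34 else 11) ->
  (if s is TNat then value_within (beta' (id x)) v else true) ->
  respects beta M st -> respects beta' M (store x i v st).
Proof.
move=> bb iM; case: s x v => -[x] v /= hx hv /(respects_sub bb)[h1 h2 h3 [h4 h5]]; split=> //=.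
- move=> y j; rewrite /lookup /= nth_write /upd; case: eqP => [->|_]; last exact: h1.
  by case: eqP => _; [exact: hv|exact: h1].
- by move=> y; apply: leq_trans (size_write _ _ _ _ _ _) _; rewrite geq_max h2.
- by split=> //; rewrite /write size_set_nth geq_max hx.
- by move=> y; apply: leq_trans (size_write _ _ _ _ _ _) _; rewrite geq_max h3.
- by split=> //; rewrite /write size_set_nth geq_max hx.
Qed.

Lemma clock_store (s : ty) (x : name s) i (v : value R s) st :
  clock (store x i v st) = clock st.
Proof. by case: s x v. Qed.

(** Time and array lengths are bounded together with the stored values, because loop bounds and
    indices are themselves read from memory. *)
Definition bounded beta (M : nat) (c : cmd) (N : nat) : Prop :=
  forall st, respects beta M st ->
  always (fun st' => respects beta M st' /\ clock st' <= clock st + N) (exec c st).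

Lemma bounded_leq beta M c N N' : N <= N' -> bounded beta M c N -> bounded beta M c N'.
Proof.
move=> NN h st hr; apply: always_impl (h st hr) => st' [h1 h2]; split=> //; lia.
Qed.

Lemma bounded_seq beta M c1 c2 N1 N2 : bounded beta M c1 N1 -> bounded beta M c2 N2 ->
  bounded beta M (Seq c1 c2) (N1 + N2).
Proof.
move=> h1 h2 st hr; apply/always_bind; apply: always_impl (h1 st hr) => st1 [r1 t1].
by apply: always_impl (h2 st1 r1) => st2 [r2 t2]; split=> //; lia.
Qed.

Lemma bounded_cond beta M (b : expr TNat) c1 c2 N1 N2 :
  bounded beta M c1 N1 -> bounded beta M c2 N2 ->
  bounded beta M (Cond b c1 c2) ((cost b).+1 + N1 + N2).
Proof.
move=> h1 h2 st hr /=.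
by case: ifP => _; [apply: always_impl (h1 (tick (cost b).+1 st) hr)
  |apply: always_impl (h2 (tick (cost b).+1 st) hr)] => st1 [r1 t1]; split=> //;
  move: t1 => /=; lia.
Qed.

Lemma bounded_store beta M (s : ty) (x : name s) (i : expr TNat) (e : expr s) :
  ole (ub beta i) (Some M.-1) -> 0 < M -> id x < (if s is TNat then 34 else 11) ->
  (if s is TNat then ole (ub beta e) (beta (id x)) else true) ->
  bounded beta M (Store x i e) (cost i + cost e).+1.
Proof.
move=> hi M0 hx he st hr; split=> /=; last by rewrite clock_store.
apply/respects_tick; apply: respects_store (hr) => //.
- by move=> y; case: (beta y) => //= n.
- by have := ub_leq hr hi; lia.
case: s x e hx he => //= x e _ he.
exact: within_ole he (ub_within e hr).
Qed.

Lemma bounded_for beta M (x : name TNat) (lo hi g : expr TNat) c h N :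
  ub beta hi = Some h -> ole (Some h) (beta (id x)) -> 0 < M -> id x < 34 ->
  bounded beta M c N ->
  bounded beta M (For x lo hi g c)
    ((cost lo + cost hi).+1 + h.+1 * (cost g + 2 + N) + (cost g + 2)).
Proof.
move=> uh hx M0 x34 hc st hr /=.
have hh : (eval st hi : nat) <= h by apply: (ub_leq hr); rewrite uh /=.
set st1 := tick _ st; have r1 : respects beta M st1 by [].
move: (eval st lo : nat) => L; set H : nat := eval st hi in hh *.
suff main n i st2 : n = H.+1 - i -> respects beta M st2 ->
    always (fun st' => respects beta M st' /\
      clock st' <= clock st2 + n * (cost g + 2 + N) + (cost g + 2))
      (loop x g (exec c) n i st2).
  apply: always_impl (main _ _ st1 erefl r1) => st' [r' t']; split=> //.
  apply: leq_trans t' _; rewrite /st1 /=.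
  have : (H.+1 - L) * (cost g + 2 + N) <= h.+1 * (cost g + 2 + N).
    by rewrite leq_mul2r; apply/orP; right; lia.
  lia.
elim: n i st2 => [|n IH] i st2 en r2 /=; first by split=> //; lia.
case: ifP => _ /=; first by split=> //; lia.
apply/always_bind; set st3 := tick 1 _.
have r3 : respects beta M st3.
  apply: (@respects_store beta beta M TNat x 0 (i : nat) (tick (cost g).+1 st2)) => //.
    by move=> y; case: (beta y) => //= m.
  by apply: within_ole hx _ => /=; lia.
apply: always_impl (hc st3 r3) => st4 [r4 t4].
have en4 : n = H.+1 - i.+1 by lia.
apply: always_impl (IH i.+1 st4 en4 r4) => st5 [r5 t5]; split=> //.
apply: leq_trans t5 _; rewrite mulSn; move: t4; rewrite /st3 /=; lia.
Qed.

Lemma bounded_skip beta M : bounded beta M Skip 1. Proof. by []. Qed.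

Lemma bounded_draw_real beta M (x : name TReal) : 0 < M -> id x < 11 ->
  bounded beta M (DrawReal x) 1.
Proof.
move=> M0 hx st hr u hu; split=> //=.
by apply: (@respects_store beta beta M TReal x 0 u st) => // y; case: (beta y) => //= n.
Qed.

Lemma bounded_draw_nat beta M (x : name TNat) (m : expr TNat) : 0 < M -> id x < 34 ->
  ole (ub beta m) (beta (id x)) -> bounded beta M (DrawNat x m) (cost m).+1.
Proof.
move=> M0 hx hm st hr u hu; split=> //=.
apply: (@respects_store beta beta M TNat x 0 (u : nat) st) => //.
  by move=> y; case: (beta y) => //= n.
apply: within_ole hm _; have := ub_within m hr; rewrite /=.
by case: (ub beta m) => //= n; move: hu; lia.
Qed.

Fixpoint safe beta (M : nat) (c : cmd) : Prop :=
  match c with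
  | Skip => True
  | Store s x i e => [/\ ole (ub beta i) (Some M.-1),
      id x < (if s is TNat then 34 else 11)
      & if s is TNat then ole (ub beta e) (beta (id x)) else true]
  | Seq c1 c2 | Cond _ c1 c2 => safe beta M c1 /\ safe beta M c2
  | For x _ hi _ c => [/\ isSome (ub beta hi), ole (ub beta hi) (beta (id x)),
      id x < 34 & safe beta M c]
  | DrawReal x => id x < 11
  | DrawNat x m => id x < 34 /\ ole (ub beta m) (beta (id x))
  end.

(** A conditional pays for both branches and a loop for all passes up to the bound of its upper
    limit. The order is still right except for [merge_loop], which leaves early by its guard. *)
Fixpoint time beta (c : cmd) : nat :=
  match c with
  | Skip => 1
  | Store s x i e => (cost i + cost e).+1
  | Seq c1 c2 => time beta c1 + time beta c2
  | Cond b c1 c2 => (cost b).+1 + time beta c1 + time beta c2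
  | For x lo hi g c => (cost lo + cost hi).+1 +
      (odflt 0 (ub beta hi)).+1 * (cost g + 2 + time beta c) + (cost g + 2)
  | DrawReal x => 1
  | DrawNat x m => (cost m).+1
  end.

Lemma safe_bounded beta M c : 0 < M -> safe beta M c -> bounded beta M c (time beta c).
Proof.
move=> M0; elim: c => /=.
- by move=> _; exact: bounded_skip.
- by case=> x i e [h1 h2 h3]; apply: bounded_store.
- by move=> c1 IH1 c2 IH2 [/IH1 h1 /IH2 h2]; exact: bounded_seq.
- by move=> b c1 IH1 c2 IH2 [/IH1 h1 /IH2 h2]; exact: bounded_cond.
- move=> x lo hi g c IH [h1 h2 h3 /IH h4].
  by case eh: (ub beta hi) h1 h2 => [h|] //= _ h2; exact: bounded_for.
- by move=> x hx; exact: bounded_draw_real.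
- by move=> x m [h1 h2]; exact: bounded_draw_nat.
Qed.

Section MergeTime.
Variables (beta : nat -> option nat) (M T kk i : nat).
Hypothesis M_gt0 : 0 < M.
Let key : name TReal := Name TReal kk.
Let idx : name TNat := Name TNat i.+4.+4.+4.+1.

Lemma merge_pass_width (e : env R) : wp (merge_pass key idx) (fun e' =>
  natv e' 5 0 = 2 * natv e 5 0 /\ natv e' 4 0 = natv e 4 0) e.
Proof.
do 4 (apply: wp_seq; apply: wp_store => /=).
apply: wp_seq; apply: wp_impl (@frame R _ _) => e1 [aN1 _].
apply: wp_seq; apply: wp_impl (@frame R _ _) => e2 [aN2 _].
apply: wp_store => /=; rewrite (aN2 4) // (aN2 5) //.
by rewrite (aN1 4) // (aN1 5).
Qed.

(** Testing the guard costs 6 and updating the counter 1. *)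
Let B := time beta (merge_pass key idx) + 7.

(** p bounds the doublings of the width still needed to reach the total; each pass performs one. The
    final 6 pays for the failing guard. *)
Lemma merge_loop_time h n j p st : safe beta M (merge_pass key idx) ->
  ole (Some h) (beta 10) -> n = h.+1 - j -> respects beta M st ->
  natv (view st) 4 0 <= natv (view st) 5 0 * 2 ^ p ->
  always (fun st' => respects beta M st' /\ clock st' <= clock st + p * B + 6)
    (loop pass_ (width_ < total_)%prog (exec (merge_pass key idx)) n j st).
Proof.
move=> hs h10; elim: n j p st => [|n IH] j p st en hr hp.
  by split=> //=; lia.
rewrite loopS; case: ifP => [_|g0]; first by split=> //=; lia.
apply/always_bind; set st3 := tick 1 _.
have r3 : respects beta M st3.
  apply: (@respects_store beta beta M TNat pass_ 0 (j : nat) (tick 6 st)) => //.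
    by move=> y; case: (beta y) => //= m.
  by apply: within_ole h10 _ => /=; lia.
have v3 : view st3 = put pass_ 0 (j : value R TNat) (view st).
  exact: (view_store st pass_ 0 (j : value R TNat)).
have wt : natv (view st) 5 0 < natv (view st) 4 0.
  by move: g0; rewrite /= !lookup_view /=; case: ltnP.
case: p hp => [|p] hp; first by move: hp; rewrite muln1; lia.
apply: always_impl (always_and (safe_bounded M_gt0 hs r3)
  (merge_pass_width (e := view st3) erefl)) => st4 [[r4 t4] [w4 tt4]].
have en4 : n = h.+1 - j.+1 by lia.
have hp4 : natv (view st4) 4 0 <= natv (view st4) 5 0 * 2 ^ p.
  by rewrite w4 tt4 v3; apply: leq_trans hp _; rewrite expnS mulnCA mulnA.
apply: always_impl (IH j.+1 p st4 en4 r4 hp4) => st5 [r5 t5]; split=> //.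
have c3 : clock st3 = clock st + 7 by rewrite /st3 /= -addnA.
by apply: leq_trans t5 _; rewrite mulSn {2}/B; move: t4; rewrite c3; lia.
Qed.

End MergeTime.

(** Since num <= 2 ^ up_log 2 h, that many doublings of [len] reach [len * num]. The last two
    hypotheses say that [len] and [num] do not read the variables set before the loop. *)
Lemma merge_runs_bounded beta M (kk i : nat) (len num : expr TNat) h :
  let key : name TReal := Name TReal kk in
  let idx : name TNat := Name TNat i.+4.+4.+4.+1 in
  0 < M -> safe beta M (merge_pass key idx) ->
  ub beta num = Some h -> ole (Some h) (beta 10) ->
  ole (ub beta (len * num)%prog) (beta 4) -> ole (ub beta len) (beta 5) ->
  (forall (e : env R) v, veval (put total_ 0 v e) len = veval e len) ->
  (forall (e : env R) v w, veval (put width_ 0 w (put total_ 0 v e)) num = veval e num) ->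
  bounded beta M (merge_runs key idx len num)
    (2 * cost len + 2 * cost num + 20 +
     up_log 2 h * (time beta (merge_pass key idx) + 7)).
Proof.
move=> key idx M0 hs un h10 h4 h5 e_len e_num st hr.
rewrite merge_runsE; set st1 := tick (cost (0%N) + cost (len * num)%prog).+1
  (store total_ 0 (eval st (len * num)%prog) st).
have r1 : respects beta M st1.
  apply/respects_tick; apply: (@respects_store beta beta M TNat) (hr) => //.
    by move=> y; case: (beta y) => //= n.
  exact: within_ole h4 (ub_within (len * num)%prog hr).
have v1 : view st1 = put total_ 0 (veval (view st) (len * num)%prog) (view st).
  by rewrite -eval_view; exact: (view_store st total_ 0 (eval st (len * num)%prog)).
set st2 := tick (cost (0%N) + cost len).+1 (store width_ 0 (eval st1 len) st1).
have r2 : respects beta M st2.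
  apply/respects_tick; apply: (@respects_store beta beta M TNat) (r1) => //.
    by move=> y; case: (beta y) => //= n.
  exact: within_ole h5 (ub_within len r1).
have v2 : view st2 = put width_ 0 (veval (view st) len) (view st1).
  rewrite -(e_len (view st) (veval (view st) (len * num)%prog)) -v1 -eval_view.
  exact: (view_store st1 width_ 0 (eval st1 len)).
rewrite -[exec _ _]/(exec (merge_loop key idx num) st2).
have num_le : (veval (view st) num : nat) <= h.
  by rewrite -eval_view; apply: (ub_leq hr); rewrite un /=.
have e2 : eval st2 num = veval (view st) num.
  by rewrite eval_view v2 v1 e_num.
set st3 := tick (cost (Lit 1) + cost num).+1 st2.
rewrite /merge_loop exec_for -/st3 [eval st2 (Lit 1)]/=.
have v3 : view st3 = view st2 by [].
have c3 : clock st3 <= clock st + 2 * cost len + 2 * cost num + 13.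
  by rewrite /st3 /= ; lia.
have r3 : respects beta M st3 by exact: r2.
clearbody st3.
move: (merge_loop_time (kk := kk) (i := i) (h := eval st2 num)
  (n := (eval st2 num : nat).+1 - 1)
  (j := 1) (p := up_log 2 h) (st := st3) M0 hs).
move=> /(_ _ erefl) H; apply: always_impl (H _ r3 _).
- by move=> st4 [r4 t4]; split=> //; rewrite -/key -/idx in t4; lia.
- rewrite e2; move: h10; case: (beta 10) => //= m; exact: leq_trans.
- rewrite v3 v2 v1 /= leq_mul2l; apply/orP; right; apply: leq_trans num_le _.
  exact: up_logP.
Qed.

(** [npool_ + 1] has no static bound below that of [npool_], so [safe] fails here. Instead the
    invariant [npool_ < i] before pass i is carried, which is why the reset to 0 belongs to the
    program treated. *)
Lemma fill_pool_bounded beta M t c N : 0 < M -> t < M ->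
  ub beta t_ = Some t -> ole (Some t) (beta 30) -> ole (Some t) (beta 33) ->
  ole (Some t) (beta 29) -> bounded beta M c N ->
  bounded beta M (npool_ ::= 0 ;; fill_pool ;; c)%prog (20 * t + 20 + N).
Proof.
move=> M0 tM ut h30 h33 h29 hc st hr.
set st1 := tick 3 (store npool_ 0 (0 : nat) st).
have refl y : ole (beta y) (beta y) by case: (beta y) => //= n.
have r1 : respects beta M st1.
  apply/respects_tick; apply: (@respects_store beta beta M TNat) (hr) => //=.
  by apply: within_ole h30 _.
have v1 : view st1 = put npool_ 0 (0 : value R TNat) (view st).
  exact: (view_store st npool_ 0 (0 : value R TNat)).
have n1 : lookup st1 npool_ 0 = 0 by rewrite lookup_view v1.
rewrite -[exec _ _]/(exec (Seq fill_pool c) st1).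
have t1 : (eval st1 t_ : nat) <= t by apply: (ub_leq r1); rewrite ut /=.
have main n i st2 : i + n <= t.+1 -> 0 < i -> respects beta M st2 ->
    lookup st2 npool_ 0 < i ->
    always (fun st' => respects beta M st' /\ clock st' <= clock st2 + n * 20 + 3)
      (loop j_ (Lit 1) (exec (IF ~~ used_$[j_] THEN
          npool_ ::= npool_ + 1 ;; pool_$[npool_] ::= j_ FI)%prog) n i st2).
  elim: n i st2 => [|n IH] i st2 ti i0 r2 n2; first by split=> //=; lia.
  rewrite loopS [_ == 0]/=; apply/always_bind; set st3 := tick 1 _.
  have it : i <= t by lia.
  have r3 : respects beta M st3.
    apply: (@respects_store beta beta M TNat j_ 0 (i : nat) (tick 2 st2)) => //.
    by apply: within_ole h33 _.
  have v3 : view st3 = put j_ 0 (i : value R TNat) (view st2).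
    exact: (view_store st2 j_ 0 (i : value R TNat)).
  have n3 : lookup st3 npool_ 0 = lookup st2 npool_ 0 by rewrite !lookup_view v3.
  have j3 : lookup st3 j_ 0 = i by rewrite lookup_view v3.
  have c3 : clock st3 = clock st2 + 3 by rewrite /st3 /= -addnA.
  clear v3; clearbody st3.
  suff h4 : always (fun st4 => [/\ respects beta M st4, lookup st4 npool_ 0 < i.+1 &
      clock st4 <= clock st3 + 17]) (exec (IF ~~ used_$[j_] THEN
          npool_ ::= npool_ + 1 ;; pool_$[npool_] ::= j_ FI)%prog st3).
    apply: always_impl h4 => st4 [r4 n4 c4].
    have ti4 : i.+1 + n <= t.+1 by rewrite addSn -addnS.
    apply: always_impl (IH i.+1 st4 ti4 isT r4 n4) => st5 [r5 c5]; split=> //; lia.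
  rewrite exec_cond; case: ifP => _; last first.
    by split=> //=; [rewrite -n3 in n2; exact: leqW|lia].
  set st4 := tick (cost (~~ used_$[j_])%prog).+1 st3.
  have v4 : view st4 = view st3 by [].
  set st5 := tick 6 (store npool_ 0 (lookup st4 npool_ 0 + 1 : nat) st4).
  have v5 : view st5 = put npool_ 0 (lookup st3 npool_ 0 + 1 : value R TNat) (view st3).
    exact: (view_store st3 npool_ 0 (lookup st3 npool_ 0 + 1 : value R TNat)).
  have n5 : lookup st5 npool_ 0 = lookup st3 npool_ 0 + 1 by rewrite lookup_view v5.
  have j5 : lookup st5 j_ 0 = i by rewrite lookup_view v5 -j3 lookup_view.
  have r5 : respects beta M st5.
    have hv : within (Some t) (lookup st3 npool_ 0 + 1) by rewrite /= n3; lia.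
    apply/respects_tick; apply: (@respects_store beta beta M TNat) (r3) => //.
    exact: within_ole h30 hv.
  have c5 : clock st5 = clock st3 + 12 by rewrite /st5 /= -addnA.
  rewrite -[exec _ _]/(Ret R (tick 5 (store pool_ (lookup st5 npool_ 0) (lookup st5 j_ 0) st5))).
  clear v5; clearbody st5; split.
  - apply/respects_tick; apply: (@respects_store beta beta M TNat) (r5) => //=.
      by rewrite n5 n3; lia.
    by apply: within_ole h29 _ => /=; rewrite j5.
  - have -> : lookup (tick 5 (store pool_ (lookup st5 npool_ 0)
        (lookup st5 j_ 0 : value R TNat) st5)) npool_ 0 = lookup st5 npool_ 0.
      rewrite [RHS]lookup_view lookup_view.
      by rewrite -[view (tick _ _)]/(view (store _ _ _ _)) view_store.
    by rewrite n5 n3 addn1.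
  - by rewrite /= c5; lia.
apply/always_bind.
have H := main ((eval st1 t_ : nat).+1 - 1) 1 (tick 4 st1) _ isT (r1) _.
apply: always_impl (H _ _) => [st2 [r2 t2]||]; last 2 first.
- by rewrite subn1 /= add1n ltnS.
- by rewrite -[lookup _ _ _]/(lookup st1 npool_ 0) n1.
apply: always_impl (hc st2 r2) => st3 [r3 t3]; split=> //.
have : ((eval st1 t_ : nat).+1 - 1) * 20 <= t * 20 by rewrite leq_mul2r subn1.
by move: t2; rewrite /st1 /=; lia.
Qed.

End Resources.

(** * Resources of Joint *)

Section JointResources.
Variables (R : realType) (d k : nat).
Hypotheses (k_gt0 : 0 < k) (kd : k <= d).

(* Bounds on the arrays of naturals 0 .. 33, where [T] bounds the number of
   items being merged. *)
Definition array_bound (T x : nat) : option nat :=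
  nth None [:: Some d; Some k; None; None; Some T; None; None; None; None; None;
    Some d; Some T; Some (2 * (d * k)); Some (2 * (d * k)); None; Some k; Some d;
    Some (2 * (d * k)); Some k; Some d; None; None; Some (d * k); Some (d * k);
    Some (d * k); Some k; Some d; None; Some d; Some d; Some d; None; Some k;
    Some d] x.

(** [ub] bounds [Uidx] by [k * d + d], at most [2 * (d * k)]; the summand 2 makes room for cell
    0. *)
Let M := 2 * (d * k) + 2.
Let M_gt0 : 0 < M. Proof. by rewrite /M addn2. Qed.

Let k_le : k <= d * k. Proof. by rewrite leq_pmull // (leq_trans k_gt0). Qed.
Let d_le : d <= d * k. Proof. by rewrite leq_pmulr. Qed.

Ltac solve_safe := rewrite /= /M ?[k * d]mulnC; repeat split; rewrite ?leqnn //; lia.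

Lemma relabel_bounded :
  bounded R (array_bound d) M relabel (1000 * d + 1000 * (up_log 2 d * d)).
Proof.
apply: (@bounded_leq R); last first.
  apply: (@bounded_seq R); last apply: (@bounded_seq R).
  - apply: (@safe_bounded R) => //; solve_safe.
  - apply: (@merge_runs_bounded R _ _ 1 0 (Lit 1) d_ d) => //; try solve_safe.
  - apply: (@safe_bounded R) => //; solve_safe.
have := leq_pmulr (up_log 2 d) (leq_trans k_gt0 kd); move: (up_log 2 d) => L.
rewrite /=; have := leq_trans k_gt0 kd; nia.
Qed.

Let beta := array_bound (d * k).

Ltac by_safe := apply: (@safe_bounded R) => //; solve_safe.

Lemma sort_entries_bounded :
  bounded R beta M sort_entries (1000 * (d * k) + 1000 * (up_log 2 k * (d * k))).
Proof.
apply: (@bounded_leq R); last first.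
  apply: (@bounded_seq R); last by_safe.
  apply: (@merge_runs_bounded R _ _ 2 4 d_ k_ k) => //; try solve_safe.
have := leq_pmulr (up_log 2 k) (leq_trans k_gt0 k_le); move: (up_log 2 k) => L.
have := leq_trans k_gt0 k_le; rewrite /=; nia.
Qed.

Lemma complete_sequence_bounded :
  bounded R beta M complete_sequence (1000 * (d * k)).
Proof.
apply: (@bounded_leq R); last first.
  do 5 (apply: (@bounded_seq R); first by_safe).
  apply: (@bounded_for R _ _ _ _ _ _ _ k); [by []|solve_safe|by []|by []|].
  apply: (@bounded_cond R); last exact: bounded_skip.
  apply: (@bounded_seq R); first by_safe.
  apply: (@bounded_seq R); first by_safe.
  apply: (@fill_pool_bounded R _ _ d);
    [by []|solve_safe|by []|solve_safe|solve_safe|solve_safe|by_safe].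
have := leq_trans k_gt0 k_le; rewrite /=; nia.
Qed.

Lemma Joint_bounded (eps : R) (D : dataset d) :
  always (fun st => respects beta M st /\
    clock st <= 5000 * (d * k + up_log 2 d * d + up_log 2 k * (d * k)))
  (run_Joint D k eps).
Proof.
have r0 : respects (array_bound d) M (joint_input D k eps).
  split=> [x i|x|x|//].
  - case: x => [|[|[|x]]] /=; [by case: i => [|[|i]]|by case: i => [|[|i]]|by []|].
    by rewrite /lookup /= !nth_nil; case: array_bound.
  - have dM : d.+1 <= M by have := d_le; rewrite /M; lia.
    case: x => [|[|[|x]]]; [exact: M_gt0|exact: M_gt0| |by rewrite /= nth_nil].
    by rewrite /= size_map size_enum_ord.
  - by case: x => [|x]; [exact: M_gt0|rewrite /= nth_nil].
rewrite /run_Joint /Joint; apply/always_bind.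
apply: always_impl (relabel_bounded r0) => st1 [r1 t1].
(* Relabeling was bounded with d items being merged and is weakened to d * k only now; charging it
   for d * k items would have produced a term d k log d. *)
have {}r1 : respects beta M st1.
  apply: respects_sub r1 => x; do 34 (case: x => [|x] //=).
  by rewrite /beta /array_bound /= nth_nil.
have rest : bounded R beta M (build_matrix ;; sort_entries ;; reset_counts ;;
    scan_until_all_rows ;; first_multiplicity ;; other_multiplicities ;;
    sample_entry ;; complete_sequence)%prog
    (4000 * (d * k) + 1000 * (up_log 2 k * (d * k))).
  apply: (@bounded_leq R); last first.
    apply: (@bounded_seq R); first by_safe.
    apply: (@bounded_seq R); first exact: sort_entries_bounded.
    do 5 (apply: (@bounded_seq R); first by_safe).
    exact: complete_sequence_bounded.
  move: (up_log 2 k * (d * k)) (d_le) (k_le) (leq_trans k_gt0 k_le) => u.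
  rewrite /=; lia.
apply: always_impl (rest st1 r1) => st2 [r2 t2]; split=> //.
apply: leq_trans t2 _; move: t1; rewrite /=; have := d_le; lia.
Qed.

Lemma footprint_respects T st : respects (R := R) (array_bound T) M st ->
  footprint st <= 45 * M.
Proof.
have sumB A (s : seq (seq A)) : (forall x, size (nth [::] s x) <= M) ->
    sumn (map size s) <= size s * M.
  elim: s => //= a s IH h; rewrite mulSn leq_add //; first exact: (h 0).
  by apply: IH => x; exact: (h x.+1).
move=> [_ h2 h3 [h4 h5]]; rewrite /footprint (_ : 45 = 34 + 11) // mulnDl leq_add //.
  by apply: leq_trans (sumB _ _ h2) _; rewrite leq_mul2r h4 orbT.
by apply: leq_trans (sumB _ _ h3) _; rewrite leq_mul2r h5 orbT.
Qed.

End JointResources.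

(** 2 ^ (up_log 2 n - 1) < n for n > 1, so rounding up costs at most an additive ln 2. *)
Lemma up_log_ln (R : realType) n : 0 < n ->
  ((up_log 2 n)%:R * ln 2 <= ln n%:R + ln 2 :> R)%R.
Proof.
move=> n0; have ln2 : (0 < ln 2 :> R)%R by rewrite ln_gt0 // ltr1n.
have lnn : (0 <= ln n%:R :> R)%R by rewrite ln_ge0 // ler1n.
have [L0|L0] := posnP (up_log 2 n); first by rewrite L0 mul0r addr_ge0 // ltW.
have n1 : 1 < n by move: L0; case: n {n0 lnn} => [|[|n]] //; rewrite ?up_log0 ?up_log1.
have /andP[lt _] := up_log_bounds (isT : 1 < 2) n1.
rewrite -[up_log 2 n](prednK L0) -natr1 mulrDl mul1r lerD2r.
rewrite mulr_natl -lnXn ?ltr0n // ler_ln ?posrE ?exprn_gt0 ?ltr0n //.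
by rewrite -natrX ler_nat ltnW.
Qed.

Lemma Joint_resources (R : realType) : exists C : R,
  forall (d k : nat) (eps : R) (D : dataset d),
    1 <= k -> k <= d ->
    always (fun st : state R =>
      ((clock st)%:R <=
        C * Num.max 1 (d%:R * k%:R * ln k%:R + d%:R * ln d%:R) /\
      (footprint st)%:R <= C * (d%:R * k%:R))%R)
    (run_Joint D k eps).
Proof.
have ln2 : (0 < ln 2 :> R)%R by rewrite ln_gt0 // ltr1n.
pose K := (1 + (ln 2)^-1 : R)%R.
have K1 : (1 <= K)%R by rewrite lerDl invr_ge0 ltW.
pose q : R := 5000%:R.
(* 180 = 45 * 4: there are at most 45 arrays, of at most 2 d k + 2 <= 4 d k cells each. *)
have q_ge : (180%:R <= q)%R by rewrite ler_nat.
(* The three summands of [Joint_bounded] each contribute K * m, by [dkm], [Ld] and [Lk], and the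
   remainders d and d k of the last two are again at most K * m. *)
exists (q * (5 * K))%R => d k eps D k0 kd.
have d0 : 0 < d by exact: leq_trans kd.
apply: always_impl (Joint_bounded k0 kd eps D) => st [hr ht].
have dk1 : (1 <= d%:R * k%:R :> R)%R by rewrite -natrM ler1n muln_gt0 d0.
split; last first.
  have := footprint_respects hr; rewrite -(ler_nat R) => /le_trans; apply.
  rewrite natrM natrD !natrM.
  have : (d%:R * k%:R <= K * (d%:R * k%:R) :> R)%R by rewrite ler_peMl // (le_trans _ dk1).
  move: dk1; set x := (d%:R * k%:R)%R; set y := (K * x)%R => x1 xy.
  apply: (@le_trans _ _ (180%:R * y)%R); first lra.
  rewrite -!mulrA -/y; apply: ler_pM => //; lra.
set X := (d%:R * k%:R * ln k%:R + d%:R * ln d%:R)%R.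
set m := Num.max 1%R X.
have m1 : (1 <= m)%R by rewrite le_max lexx.
have mX : (X <= m)%R by rewrite le_max lexx orbT.
have lnk : (0 <= ln k%:R :> R)%R by rewrite ln_ge0 // ler1n.
have lnd : (0 <= ln d%:R :> R)%R by rewrite ln_ge0 // ler1n.
(* The linear term is absorbed by the 1 in the maximum if d = 1, by d ln d if k = 1 < d, and by d k
   ln k otherwise; the last two cases cost the factor 1 / ln 2 in K. *)
have dkm : (d%:R * k%:R <= K * m)%R.
  have [d1|d2] := leqP d 1.
    have [-> ->] : d = 1 /\ k = 1 by lia.
    by rewrite mulr1 (le_trans m1) // ler_peMl // (le_trans _ m1).
  have : (d%:R * k%:R * ln 2 <= X)%R.
    have [k1|k2] := leqP k 1.
      have -> : k = 1 by lia.
      rewrite mulr1 /X (_ : k = 1) ?ln1; last by lia.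
      by rewrite mulr0 add0r ler_wpM2l // ler_ln ?posrE ?ltr0n // ler_nat.
    rewrite /X (@le_trans _ _ (d%:R * k%:R * ln k%:R)%R) //; last first.
      by rewrite lerDl mulr_ge0.
    by rewrite ler_wpM2l ?mulr_ge0 // ler_ln ?posrE ?ltr0n // ler_nat.
  rewrite -ler_pdivlMr // => h; apply: le_trans h _.
  have -> : (K * m = m + m / ln 2)%R by rewrite mulrDl mul1r [(_^-1 * m)%R]mulrC.
  rewrite -[leLHS]add0r lerD //; first exact: le_trans m1.
  by rewrite ler_wpM2r // invr_ge0 ltW.
have log_le n (x : R) : 0 < n -> (0 <= x)%R -> (x * ln n%:R <= X)%R ->
    ((up_log 2 n)%:R * x <= K * m + x :> R)%R.
  move=> n0 x0 hx; have hL := up_log_ln R n0.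
  have : ((up_log 2 n)%:R * x * ln 2 <= (K * m + x) * ln 2)%R.
    rewrite mulrAC (le_trans (ler_wpM2r x0 hL)) // mulrDl mulrDl mulrC lerD //;
      last by rewrite mulrC.
    have -> : (K * m * ln 2 = m * ln 2 + m)%R.
      by rewrite /K mulrAC mulrDl mul1r mulVf ?gt_eqF // mulrDl mul1r [(ln 2 * m)%R]mulrC.
    rewrite -[leLHS]add0r lerD //; last exact: le_trans mX.
    by rewrite mulr_ge0 ?ltW // (lt_le_trans _ m1).
  by rewrite ler_pM2r.
have Ld : ((up_log 2 d)%:R * d%:R <= K * m + d%:R :> R)%R.
  by apply: log_le => //; rewrite /X lerDr !mulr_ge0.
have Lk : ((up_log 2 k)%:R * (d%:R * k%:R) <= K * m + d%:R * k%:R :> R)%R.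
  by apply: log_le => //; rewrite /X lerDl mulr_ge0.
have dle : (d%:R <= d%:R * k%:R :> R)%R by rewrite ler_peMr // ler1n.
have := ht; rewrite -(ler_nat R) natrM !natrD !natrM -/q => /le_trans; apply.
move: dkm Ld Lk dle; rewrite -!mulrA ler_pM2l; last by rewrite ltr0n.
set x := (d%:R * k%:R)%R; set y := (K * m)%R.
move: (_ * d%:R)%R (_ * x)%R => u v; lra.
Qed.

Unset Implicit Arguments.
Set Strict Implicit.
Set Printing Implicit Defensive.
Local Open Scope ring_scope.

(* For d >= 2 the maximum is its second argument; the 1 only matters for
   d = k = 1, where the latter vanishes. *)
Theorem theorem3p9 (R : realType) :
  (forall (d k : nat) (hkd : (k <= d)%N) (eps : R) (D : dataset d)
     (item_of : {perm 'I_d}),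
     (1 <= k)%N -> 0 < eps -> is_relabeling D item_of ->
     forall S : k.-tuple 'I_d,
       Pr (outputs S) (run_Joint D k eps) =
       (em_weight eps D item_of hkd S /
        \sum_(S' : k.-tuple 'I_d) em_weight eps D item_of hkd S')%:E)
  /\
  (exists C : R,
     forall (d k : nat) (eps : R) (D : dataset d),
       (1 <= k)%N -> (k <= d)%N -> 0 < eps ->
       always (fun st : state R =>
           (clock st)%:R <=
             C * Num.max 1 (d%:R * k%:R * ln k%:R + d%:R * ln d%:R) /\
           (footprint st)%:R <= C * (d%:R * k%:R))
         (run_Joint D k eps)).
Proof.
split.
  by move=> d k hkd eps D item_of k_gt0 eps_gt0 rel S; exact: run_Joint_Pr.
have [C hC] := Joint_resources R.
by exists C => d k eps D k_gt0 hkd _; exact: hC.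
Qed.
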